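(* Assume that $\Re(c)>\Re(a)>0$, $b\in\mathbb{C}$ and $\lambda\in\mathbb{R}\setminus\{0\}$. Then as $x\to+\infty$, $$\Phi_1[a,b;c;-x,i\lambda x]\sim\frac{\Gamma(c)}{\Gamma(a)}x^{-b}e^{i\lambda x}\sum_{k=0}^{\infty}a_k^{(1)}(i\lambda)\,(i\lambda x)^{a-c-k}+\frac{\Gamma(c)}{\Gamma(c-a)}\sum_{k=0}^{\infty}a_k^{(2)}(-i\lambda)\,x^{-a-k},$$ where $$a_k^{(1)}(\mu)=(b-a+1)_k\sum_{n=0}^{k}\frac{(b)_n(c-a)_{k-n}}{(b-a+1)_n\,n!\,(k-n)!}(-\mu)^n,\qquad a_k^{(2)}(\mu)=\frac{(a)_k(a-c+1)_k}{k!}\,U(a+k,\,a-b+k+1,\,\mu),$$ and $U(a,b,z)$ denotes the Kummer $U$-function.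
   Context: $(\alpha)_n=\Gamma(\alpha+n)/\Gamma(\alpha)$ is the Pochhammer symbol; the quotient $(b-a+1)_k/(b-a+1)_n$ means $(b-a+1+n)_{k-n}$ when $b-a+1\in\mathbb{Z}_{\leqslant0}$. Powers and $U$ take principal values. The sign $\sim$ denotes a compound asymptotic expansion: truncating both series after $N$ terms leaves an error of the order of the first neglected terms, $\mathcal{O}(x^{\Re(a-b-c)-N})+\mathcal{O}(x^{-\Re(a)-N})$. The Humbert function $\Phi_1$ is defined for $|x|<1$, $y\in\mathbb{C}$ by $$\Phi_1[a,b;c;x,y]=\sum_{m,n=0}^{\infty}\frac{(a)_{m+n}(b)_m}{(c)_{m+n}}\frac{x^m}{m!}\frac{y^n}{n!},$$ and is continued analytically to all $x\in\mathbb{C}\setminus[1,\infty)$, $y\in\mathbb{C}$ by $$\Phi_1[a,b;c;x,y]=\sum_{n=0}^{\infty}\frac{(a)_n}{(c)_n}\,{}_2F_1\left[\begin{matrix}a+n,b\\ c+n\end{matrix};x\right]\frac{y^n}{n!}$$ (principal branch of ${}_2F_1$). *)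

(* Defs.v *)
From mathcomp Require Import all_boot all_order all_algebra.
From mathcomp Require Import all_classical all_reals all_analysis.
From mathcomp Require Export complex.

Set Implicit Arguments.
Unset Strict Implicit.
Unset Printing Implicit Defensive.

Import Order.TTheory GRing.Theory Num.Theory.
Import numFieldNormedType.Exports.

Local Open Scope classical_set_scope.
Local Open Scope ring_scope.
Local Open Scope complex_scope.

Section ComplexAnalysis.
Variable R : realType.
Local Notation C := (R[i]).
Implicit Types z w : C.

Definition Cexp z : C :=
  (expR (complex.Re z) * cos (complex.Im z)) +i*
  (expR (complex.Re z) * sin (complex.Im z)).

Definition Cabs z : R := complex.Re `|z|.

(* For z != 0, the argument in ]-pi, pi]. *)
Definition Carg z : R :=
  if 0 <= complex.Im z then acos (complex.Re z / Cabs z)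
  else - acos (complex.Re z / Cabs z).

Definition Clog z : C := ln (Cabs z) +i* Carg z.

(* At the base 0, the same convention as for powR. *)
Definition Cpow z w : C := if z == 0 then (w == 0)%:R else Cexp (w * Clog z).

(* R[i]^o is R[i] with the topology given by its norm. *)
Definition Cseries_sum (u : nat -> C) : C := limn (series u : nat -> R[i]^o).

Definition Cseries_cvg (u : nat -> C) (l : C) : Prop :=
  (series u : nat -> R[i]^o) @ \oo --> (l : R[i]^o).

Definition Cintegral (D : set R) (f : R -> C) : C :=
  Rintegral lebesgue_measure D (fun t => complex.Re (f t)) +i*
  Rintegral lebesgue_measure D (fun t => complex.Im (f t)).

Definition analytic_on (D : set C) (f : C -> C) : Prop :=
  forall z0, D z0 -> exists (r : R) (u : nat -> C), 0 < r /\
    forall z, Cabs (z - z0) < r ->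
      Cseries_cvg (fun n => u n * (z - z0) ^+ n) (f z).

(* The analytic continuation of f0 from D0 to D.  On a connected open D
   containing the nonempty open D0 it is unique if it exists; its values
   outside D are arbitrary. *)
Definition continuation (D0 : set C) (f0 : C -> C) (D : set C) : C -> C :=
  xget (fun=> 0) [set f | analytic_on D f /\ forall z, D0 z -> f z = f0 z].

End ComplexAnalysis.

Section SpecialFunctions.
Variable R : realType.
Local Notation C := (R[i]).
Implicit Types a b c z : C.

(* Gamma(al + n) / Gamma(al), extended to the poles of Gamma. *)
Definition pochhammer (al : C) (n : nat) : C := \prod_(i < n) (al + i%:R).

(* Euler's integral: this is the Gamma function for 0 < Re z only. *)
Definition CGamma z : C :=
  Cintegral `]0, +oo[ (fun t => Cpow t%:C (z - 1) * Cexp (- t%:C)).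

Definition gauss_term a b c z (n : nat) : C :=
  pochhammer a n * pochhammer b n / (pochhammer c n * n`!%:R) * z ^+ n.

Definition unit_disc : set C := [set z | Cabs z < 1].

(* The complex plane cut along [1, +oo[. *)
Definition hyp_plane : set C :=
  [set z | ~ (complex.Im z = 0 /\ 1 <= complex.Re z)].

(* 2F1 [a, b; c; z], principal branch. *)
Definition hyp2F1 a b c : C -> C :=
  continuation unit_disc (fun z => Cseries_sum (gauss_term a b c z)) hyp_plane.

Definition right_half_plane : set C := [set z | 0 < complex.Re z].

(* The complex plane cut along ]-oo, 0]. *)
Definition log_plane : set C :=
  [set z | ~ (complex.Im z = 0 /\ complex.Re z <= 0)].

Definition kummerU_integral a b z : C :=
  (CGamma a)^-1 *
  Cintegral `]0, +oo[ (fun t =>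
    Cexp (- (z * t%:C)) * Cpow t%:C (a - 1) * Cpow (1 + t%:C) (b - a - 1)).

(* The principal branch of Kummer's U (a, b, z) for 0 < Re a: its Laplace
   integral converges for 0 < Re z and is continued analytically in z. *)
Definition kummerU a b : C -> C :=
  continuation right_half_plane (kummerU_integral a b) log_plane.

(* Humbert's Phi_1 [a, b; c; x, y] for x outside [1, +oo[. *)
Definition humbert_Phi1 a b c (x y : C) : C :=
  Cseries_sum (fun n => pochhammer a n / pochhammer c n *
    hyp2F1 (a + n%:R) b (c + n%:R) x * (y ^+ n / n`!%:R)).

(* (b - a + 1)_k / (b - a + 1)_n is written (b - a + 1 + n)_(k - n), which is
   also meaningful when b - a + 1 is a nonpositive integer. *)
Definition humbert_coef1 a b c (k : nat) (mu : C) : C :=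
  \sum_(n < k.+1)
    pochhammer (b - a + 1 + n%:R) (k - n) *
    (pochhammer b n * pochhammer (c - a) (k - n) / (n`!%:R * (k - n)`!%:R)) *
    (- mu) ^+ n.

Definition humbert_coef2 a b c (k : nat) (mu : C) : C :=
  pochhammer a k * pochhammer (a - c + 1) k / k`!%:R *
  kummerU (a + k%:R) (a - b + k%:R + 1) mu.

End SpecialFunctions.

(* Main.v *)
Require Import Defs.
From mathcomp Require Import all_boot all_order all_algebra.
From mathcomp Require Import all_classical all_reals all_analysis.
From mathcomp Require Import measurable_realfun ring lra.

(** Let y = i lambda x. Euler's integral for 2F1 and the exponential series give
    Phi_1 [a, b; c; - x, y] = B (a, c - a) ^ (-1) * I (x), where I (x) is the
    integral over 0 < t < 1 of
      t ^ (a - 1) * (1 - t) ^ (c - a - 1) * (1 + x t) ^ (- b) * exp (i lambda x t)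
    ([humbert_Phi1_integral]). On 0 < t < 1 the exponential oscillates. It decays
    in the direction i s, where s is the sign of lambda, so the path is turned:
    I (x) is the integral along the half line from 0 to i s oo minus the integral
    along the half line from 1 to 1 + i s oo ([contour_shift]). This is proved
    without Cauchy's theorem, by differentiating the integral over the segment
    from i s v to 1 + i s v with respect to v.

    Both half lines are rescaled by v = t / x, after which they carry the weight
    exp (- |lambda| t) and depend on x through powers of binomials only.

    At the endpoint 0 the factor (1 + x t) ^ (- b) becomes (1 + i s t) ^ (- b) and
    is kept, and (1 - i s t / x) ^ (c - a - 1) is expanded in powers of 1 / x. The
    terms are Laplace-type integrals of Kummer's U, and give the second series
    ([left_expansion]). The argument - i lambda of U lies on the boundary of the
    half plane where the Laplace integral of U converges; the value of the
    continuation there comes from the rotated integral of [kummer_kernel], by the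
    identity theorem along a segment ([kummerU_imaginary]).

    At the endpoint 1 the exponential contributes the factor exp (i lambda x), and
    1 + x + i s t = x * (1 + t v) * (1 + w / (1 + t v)) with w = 1 / x, v = i s / x.
    Both binomials are expanded, the terms are Gamma integrals, and those of equal
    degree in 1 / x add up to the coefficients of the first series
    ([right_expansion]).

    The errors are controlled by one estimate, [Cpow_remainder]: for Re u >= 0 the
    remainder of order N of (1 + u) ^ w is O (|u| ^ N * (1 + |u|) ^ M), and this is
    integrable against the exponential weight uniformly in x.

    Analytic continuations enter as follows. A function that has locally a power
    series is determined along a segment by its values near the starting point
    ([analytic_segment]), so a continuation is computed by exhibiting one analytic
    extension ([continuation_segment]); the extensions are integrals whose kernels
    are expanded termwise ([analytic_integral]). The quotients of Gamma values
    come from B (a, b) * Gamma (a + b) = Gamma a * Gamma b and from the fact that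
    Gamma has no zeros, both proved through Euler's limit. *)

Set Implicit Arguments.
Unset Strict Implicit.
Unset Printing Implicit Defensive.
Import Order.TTheory GRing.Theory Num.Theory.
Import numFieldNormedType.Exports.
Local Open Scope classical_set_scope.
Local Open Scope ring_scope.
Local Open Scope complex_scope.

(** * Complex exponential, principal logarithm and powers *)

Section ComplexBasics.
Variable R : realType.
Local Notation C := R[i].
Local Notation Re := (@complex.Re R).
Local Notation Im := (@complex.Im R).
Implicit Types (z w : C) (x y r : R).

Lemma ReD z w : Re (z + w) = Re z + Re w. Proof. by case: z w => ? ? []. Qed.
Lemma ImD z w : Im (z + w) = Im z + Im w. Proof. by case: z w => ? ? []. Qed.
Lemma ReN z : Re (- z) = - Re z. Proof. by case: z. Qed.
Lemma ImN z : Im (- z) = - Im z. Proof. by case: z. Qed.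
Lemma ReM z w : Re (z * w) = Re z * Re w - Im z * Im w.
Proof. by case: z w => ? ? []. Qed.
Lemma ImM z w : Im (z * w) = Re z * Im w + Im z * Re w.
Proof. by case: z w => ? ? []. Qed.
Lemma Re_real r : Re r%:C = r. Proof. by []. Qed.
Lemma Im_real r : Im r%:C = 0. Proof. by []. Qed.
Lemma Re_nat n : Re n%:R = n%:R.
Proof. by rewrite -(rmorph_nat (real_complex R)). Qed.
Lemma Im_nat n : Im n%:R = 0.
Proof. by rewrite -(rmorph_nat (real_complex R)). Qed.
Lemma Re_1 : Re 1 = 1. Proof. exact: (Re_nat 1). Qed.
Lemma Im_1 : Im 1 = 0. Proof. exact: (Im_nat 1). Qed.
Lemma Re_0 : Re 0 = 0. Proof. exact: (Re_nat 0). Qed.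
Lemma Im_0 : Im 0 = 0. Proof. exact: (Im_nat 0). Qed.

Lemma eqC z w : Re z = Re w -> Im z = Im w -> z = w.
Proof. by case: z w => ? ? [] /= ? ? -> ->. Qed.

Lemma CabsE z : Cabs z = Num.sqrt (Re z ^+ 2 + Im z ^+ 2).
Proof. by rewrite /Cabs normc_def. Qed.

Lemma normC_Cabs z : `|z| = (Cabs z)%:C.
Proof. by rewrite CabsE normc_def. Qed.

Lemma Cabs_ge0 z : 0 <= Cabs z. Proof. by rewrite CabsE sqrtr_ge0. Qed.

Lemma Cabs_eq0 z : (Cabs z == 0) = (z == 0).
Proof. by rewrite -(inj_eq (@complexI R)) -normC_Cabs normr_eq0. Qed.

Lemma Cabs_gt0 z : (0 < Cabs z) = (z != 0).
Proof. by rewrite lt_def Cabs_ge0 andbT Cabs_eq0. Qed.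

Lemma CabsM z w : Cabs (z * w) = Cabs z * Cabs w.
Proof. by apply: complexI; rewrite rmorphM /= -!normC_Cabs normrM. Qed.

Lemma CabsV z : Cabs z^-1 = (Cabs z)^-1.
Proof.
apply: complexI; rewrite -normC_Cabs normfV normC_Cabs.
by rewrite -(fmorphV (real_complex R)).
Qed.

Lemma CabsN z : Cabs (- z) = Cabs z.
Proof. by apply: complexI; rewrite -!normC_Cabs normrN. Qed.

Lemma CabsB z w : Cabs (z - w) = Cabs (w - z).
Proof. by rewrite -CabsN opprB. Qed.

Lemma CabsD z w : Cabs (z + w) <= Cabs z + Cabs w.
Proof. by rewrite -lecR rmorphD /= -!normC_Cabs ler_normD. Qed.

Lemma CabsX z n : Cabs (z ^+ n) = Cabs z ^+ n.
Proof. by apply: complexI; rewrite rmorphXn /= -!normC_Cabs normrX. Qed.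

Lemma Cabs_real r : Cabs r%:C = `|r|.
Proof. by rewrite CabsE /= expr0n addr0 sqrtr_sqr. Qed.

Lemma Cabs_nat n : Cabs (n%:R : C) = n%:R.
Proof.
by rewrite -(rmorph_nat (real_complex R)) Cabs_real ger0_norm.
Qed.

Lemma Cabs0 : Cabs (0 : C) = 0. Proof. by rewrite (Cabs_nat 0). Qed.
Lemma Cabs1 : Cabs (1 : C) = 1. Proof. by rewrite (Cabs_nat 1). Qed.

Lemma Cabs_sum (I : Type) (s : seq I) (P : pred I) (F : I -> C) :
  Cabs (\sum_(i <- s | P i) F i) <= \sum_(i <- s | P i) Cabs (F i).
Proof.
elim/big_rec2 : _ => [|i y1 y2 _ h]; first by rewrite Cabs0.
by apply: (le_trans (CabsD _ _)); rewrite lerD2l.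
Qed.

Lemma Re_le_Cabs z : `|Re z| <= Cabs z.
Proof. by rewrite CabsE -sqrtr_sqr ler_wsqrtr // lerDl sqr_ge0. Qed.

Lemma Im_le_Cabs z : `|Im z| <= Cabs z.
Proof. by rewrite CabsE -sqrtr_sqr ler_wsqrtr // lerDr sqr_ge0. Qed.

Lemma Cabs_le z : Cabs z <= `|Re z| + `|Im z|.
Proof.
rewrite [in leLHS](_ : z = (Re z)%:C + 'i%C * (Im z)%:C); last exact: complexE.
apply: (le_trans (CabsD _ _)); rewrite CabsM !Cabs_real.
by rewrite CabsE /= expr0n expr1n add0r sqrtr1 mul1r.
Qed.

Lemma sqr_Cabs z : Cabs z ^+ 2 = Re z ^+ 2 + Im z ^+ 2.
Proof. by rewrite CabsE sqr_sqrtr // addr_ge0 // sqr_ge0. Qed.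

Lemma CabsB_ge z w : Cabs z - Cabs w <= Cabs (z - w).
Proof. by rewrite lerBlDr -[in leLHS](subrK w z) CabsD. Qed.

Lemma CexpD z w : Cexp (z + w) = Cexp z * Cexp w.
Proof.
apply: eqC; rewrite ?ReM ?ImM /= ReD ImD expRD ?cosD ?sinD; ring.
Qed.

Lemma Cexp0 : Cexp (0 : C) = 1.
Proof. by apply: eqC; rewrite /= expR0 ?cos0 ?sin0 mul1r. Qed.

Lemma Cabs_Cexp z : Cabs (Cexp z) = expR (Re z).
Proof.
rewrite CabsE /= !exprMn -mulrDr cos2Dsin2 mulr1 sqrtr_sqr.
by rewrite ger0_norm // expR_ge0.
Qed.

Lemma Cexp_neq0 z : Cexp z != 0.
Proof. by rewrite -Cabs_gt0 Cabs_Cexp expR_gt0. Qed.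

Lemma CexpN z : Cexp (- z) = (Cexp z)^-1.
Proof.
by apply: (mulfI (Cexp_neq0 z)); rewrite -CexpD subrr Cexp0 divff // Cexp_neq0.
Qed.

Lemma Cexp_real r : Cexp r%:C = (expR r)%:C.
Proof. by apply: eqC; rewrite /= ?cos0 ?sin0 ?mulr1 ?mulr0. Qed.

Lemma Carg_acos_dom z : z != 0 -> -1 <= Re z / Cabs z <= 1.
Proof.
rewrite -Cabs_gt0 => z0; rewrite -ler_norml normrM normfV.
by rewrite (ger0_norm (Cabs_ge0 z)) ler_pdivrMr // mul1r Re_le_Cabs.
Qed.

Lemma Carg_bound z : z != 0 -> - pi < Carg z <= pi.
Proof.
move=> z0; have h := Carg_acos_dom z0; have p0 := pi_gt0 R.
rewrite /Carg; case: ifPn => Iz.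
  rewrite acos_lepi // andbT; apply: lt_le_trans (acos_ge0 h); lra.
have -> /= : - acos (Re z / Cabs z) <= pi.
  apply: le_trans (_ : 0 <= _); last lra.
  by rewrite oppr_le0 acos_ge0.
rewrite andbT ltrN2; apply: acos_ltpi; case/andP: h => h1 h2; rewrite h2 andbT.
rewrite lt_neqAle h1 andbT; apply/eqP => e.
move: Iz; rewrite -ltNge => Iz.
have z1 : 0 < Cabs z by rewrite Cabs_gt0.
have er : Re z = - Cabs z by rewrite -mulN1r e -mulrA mulVf ?mulr1 // gt_eqF.
have := sqr_Cabs z; rewrite er sqrrN -[X in X = _ -> _]addr0 => /addrI.
by move/esym/eqP; rewrite sqrf_eq0 lt_eqF.
Qed.

Lemma ClogK z : z != 0 -> Cexp (Clog z) = z.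
Proof.
move=> z0; have h := Carg_acos_dom z0.
have z1 : 0 < Cabs z by rewrite Cabs_gt0.
have cosA : cos (Carg z) = Re z / Cabs z.
  by rewrite /Carg; case: ifP => _; rewrite ?cosN acosK //= in_itv /=.
have sinA : sin (Carg z) = Im z / Cabs z.
  have e : sin (acos (Re z / Cabs z)) = `|Im z| / Cabs z.
    rewrite sin_acos //; apply/eqP.
    rewrite -(@eqrXn2 _ 2) // ?sqrtr_ge0 ?divr_ge0 ?Cabs_ge0 //; apply/eqP.
    rewrite sqr_sqrtr; last first.
      by rewrite subr_ge0 -real_normK ?num_real // expr_le1 // ler_norml.
    rewrite !exprMn real_normK ?num_real // exprVn sqr_Cabs.
    have : Re z ^+ 2 + Im z ^+ 2 != 0 by rewrite -sqr_Cabs expf_neq0 // gt_eqF.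
    by move=> n0; field.
  rewrite /Carg; case: ifPn => Iz; first by rewrite e ger0_norm.
  by rewrite sinN e ltr0_norm ?ltNge // mulNr opprK.
apply: eqC; rewrite /= ?cosA ?sinA lnK ?posrE //; field; exact: lt0r_neq0.
Qed.

Lemma CexpK w : - pi < Im w <= pi -> Clog (Cexp w) = w.
Proof.
move=> /andP[w1 w2]; apply: eqC; first by rewrite /= Cabs_Cexp expRK.
rewrite /= /Carg Cabs_Cexp /=.
have e0 := expR_gt0 (Re w).
have -> : expR (Re w) * cos (Im w) / expR (Re w) = cos (Im w).
  by field; exact: lt0r_neq0.
have [w0|w0] := leP 0 (Im w).
  by rewrite mulr_ge0 ?expR_ge0 ?sin_ge0_pi ?w0 // cosK // in_itv /= w0.
rewrite pmulr_rge0 // leNgt -[Im w]opprK sinN oppr_lt0 sin_gt0_pi /=; last lra.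
by rewrite opprK cosKN ?opprK //; lra.
Qed.

(** Multiplicativity holds exactly under this bound on the sum of the two
    principal arguments; the product rules for logarithms and powers below all
    come down to checking it. *)
Lemma Clog_mul z w : z != 0 -> w != 0 -> - pi < Carg z + Carg w <= pi ->
  Clog (z * w) = Clog z + Clog w.
Proof.
move=> z0 w0 h; rewrite -[in LHS](ClogK z0) -[in LHS](ClogK w0) -CexpD CexpK //.
Qed.

Lemma Im_Clog z : Im (Clog z) = Carg z. Proof. by []. Qed.

Lemma Re_gt0_neq0 z : 0 < Re z -> z != 0.
Proof. by move=> h; apply/eqP => e; move: h; rewrite e ltxx. Qed.

(** Unlike acos, atan is differentiable everywhere, so that this formula
    gives the derivative of the logarithm. *)
Lemma Carg_atan z : 0 < Re z -> Carg z = atan (Im z / Re z).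
Proof.
move=> z0; pose t := atan (Im z / Re z).
have Rn0 : Re z != 0 by exact: lt0r_neq0.
have t1 := atan_gtNpi2 (Im z / Re z); have t2 := atan_ltpi2 (Im z / Re z).
have p0 := pi_gt0 R.
have ct : 0 < cos t by apply: cos_gt0_pihalf; rewrite t1.
have tt : tan t = Im z / Re z by exact: atanK.
have c1 : Cabs z * cos t = Re z.
  have e : (Cabs z * cos t) ^+ 2 = Re z ^+ 2.
    rewrite exprMn sqr_Cabs.
    have := cos2_tan2 (lt0r_neq0 ct); rewrite tt => e.
    have -> : cos t ^+ 2 = (1 + (Im z / Re z) ^+ 2)^-1.
      by rewrite -e invrK.
    have n1 : Re z ^+ 2 + Im z ^+ 2 != 0.
      by rewrite gt_eqF // ltr_wpDr ?sqr_ge0 // exprn_gt0.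
    by field; rewrite Rn0.
  apply/eqP; rewrite -(@eqrXn2 _ 2) //; first by rewrite e.
    by rewrite mulr_ge0 ?Cabs_ge0 // ltW.
  exact: ltW.
have s1 : Cabs z * sin t = Im z.
  have -> : sin t = tan t * cos t by rewrite /tan -mulrA mulVf ?mulr1 // gt_eqF.
  rewrite tt mulrCA c1; field; exact: Rn0.
have a0 : 0 < Cabs z by rewrite Cabs_gt0 Re_gt0_neq0.
have -> : z = Cexp (ln (Cabs z) +i* t).
  by apply: eqC; rewrite /= lnK ?posrE.
rewrite -Im_Clog CexpK /=; last by rewrite /t; apply/andP; split; lra.
by rewrite lnK ?posrE // c1 s1.
Qed.

Lemma Carg_Re_gt0 z : 0 < Re z -> - (pi / 2) < Carg z < pi / 2.
Proof. by move=> z0; rewrite Carg_atan // atan_gtNpi2 atan_ltpi2. Qed.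

Lemma Clog_real r : 0 < r -> Clog r%:C = (ln r)%:C.
Proof.
move=> r0; apply: eqC => /=; first by rewrite Cabs_real gtr0_norm.
by rewrite Carg_atan //= mul0r atan0.
Qed.

(** Each argument lies in ]-pi/2, pi/2[. *)
Lemma Clog_mul_Re z w : 0 < Re z -> 0 < Re w -> Clog (z * w) = Clog z + Clog w.
Proof.
move=> z0 w0; have := Carg_Re_gt0 z0; have := Carg_Re_gt0 w0 => /andP[h1 h2].
move=> /andP[h3 h4]; apply: Clog_mul; [exact: Re_gt0_neq0..|].
by apply/andP; split; lra.
Qed.

Lemma Clog_mulr z r : 0 < r -> z != 0 -> Clog (r%:C * z) = Clog r%:C + Clog z.
Proof.
move=> r0 z0; have : Carg r%:C = 0 by rewrite -Im_Clog Clog_real.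
move=> e; apply: Clog_mul => //; last by rewrite e add0r Carg_bound.
by apply: Re_gt0_neq0.
Qed.

Lemma log_plane_neq0 z : log_plane z -> z != 0.
Proof. by move=> h; apply/eqP => e; apply: h; rewrite e. Qed.

Lemma log_plane_Carg z : log_plane z -> - pi < Carg z < pi.
Proof.
move=> h; have z0 := log_plane_neq0 h; have /andP[h1 h2] := Carg_bound z0.
rewrite h1 lt_neqAle h2 andbT; apply/eqP => e; apply: h.
by rewrite -(ClogK z0) /= e sinpi cospi mulr0 mulrN1 oppr_le0 expR_ge0.
Qed.

(** The distance from z to the cut ]-oo, 0]: a displacement of z shorter than
    this cannot cross the cut. *)
Definition cut_dist z : R := if 0 < Re z then Cabs z else `|Im z|.

Lemma cut_dist_gt0 z : log_plane z -> 0 < cut_dist z.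
Proof.
move=> h; rewrite /cut_dist; case: ifPn => hz.
  by rewrite Cabs_gt0 log_plane_neq0.
by rewrite normr_gt0; apply/eqP => e; apply: h; split=> //; rewrite leNgt.
Qed.

Lemma cut_dist_le z : cut_dist z <= Cabs z.
Proof. by rewrite /cut_dist; case: ifP => // _; exact: Im_le_Cabs. Qed.

(** The quotient 1 + h / z is in the right half plane. If Re z <= 0, then z + h
    lies on the same side of the real axis as z, and an argument sum outside
    ]-pi, pi] would give Im (z + h) the wrong sign. *)
Lemma Clog_near z h : log_plane z -> Cabs h < cut_dist z ->
  Clog (z + h) = Clog z + Clog (1 + h / z) /\ 0 < Re (1 + h / z).
Proof.
move=> zp hd; have z0 := log_plane_neq0 zp.
have hz : Cabs (h / z) < 1.
  by rewrite CabsM CabsV ltr_pdivrMr ?Cabs_gt0 // mul1r (lt_le_trans hd) // cut_dist_le.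
have B0 : 0 < Re (1 + h / z).
  rewrite ReD Re_1; have := Re_le_Cabs (h / z); rewrite ler_norml => /andP[? _].
  by lra.
split=> //; have -> : z + h = z * (1 + h / z) by field.
have Bn0 := Re_gt0_neq0 B0; have /andP[b1 b2] := Carg_Re_gt0 B0.
have /andP[z1 z2] := log_plane_Carg zp.
apply: Clog_mul => //.
have e : Im (z + h) = Cabs z * Cabs (1 + h / z) * sin (Carg z + Carg (1 + h / z)).
  have -> : z + h = z * (1 + h / z) by field.
  have := CexpD (Clog z) (Clog (1 + h / z)); rewrite !ClogK // => <-.
  by rewrite /= expRD !lnK ?posrE ?Cabs_gt0.
have P0 : 0 < Cabs z * Cabs (1 + h / z) by rewrite mulr_gt0 ?Cabs_gt0.
have p0 := pi_gt0 R.
case: (ltP 0 (Re z)) => rz.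
  have /andP[z3 z4] := Carg_Re_gt0 rz; by apply/andP; split; lra.
move: hd; rewrite /cut_dist ifN; last by rewrite -leNgt.
move=> hd.
have := le_lt_trans (Im_le_Cabs h) hd; rewrite ltr_norml.
have [Iz|Iz] := leP 0 (Im z).
  rewrite ger0_norm // => /andP[i1 i2].
  have A0 : 0 <= Carg z by rewrite /Carg Iz acos_ge0 // Carg_acos_dom.
  apply/andP; split; first by lra.
  rewrite leNgt; apply/negP => c.
  have : 0 < Im (z + h) by rewrite ImD; lra.
  rewrite e pmulr_rgt0 // -[_ + _](subrK pi) sinDpi oppr_gt0.
  apply/negP; rewrite -leNgt; apply: sin_ge0_pi; apply/andP; split; lra.
rewrite ltr0_norm // opprK => /andP[i1 i2].
have A0 : Carg z <= 0.
  rewrite /Carg ifN; last by rewrite -ltNge.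
  by rewrite oppr_le0 acos_ge0 // Carg_acos_dom.
apply/andP; split; last by lra.
rewrite ltNge; apply/negP => c.
have : Im (z + h) < 0 by rewrite ImD; lra.
rewrite e pmulr_rlt0 //; apply/negP; rewrite -leNgt.
have -> : sin (Carg z + Carg (1 + h / z)) = sin (- (Carg z + Carg (1 + h / z) + pi)).
  by rewrite sinN sinDpi opprK.
by apply: sin_ge0_pi; apply/andP; split; lra.
Qed.

Lemma CpowE z w : z != 0 -> Cpow z w = Cexp (w * Clog z).
Proof. by rewrite /Cpow => /negbTE ->. Qed.

Lemma Cpow_neq0 z w : z != 0 -> Cpow z w != 0.
Proof. by move=> z0; rewrite CpowE // Cexp_neq0. Qed.

Lemma CpowD z w1 w2 : z != 0 -> Cpow z (w1 + w2) = Cpow z w1 * Cpow z w2.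
Proof. by move=> z0; rewrite !CpowE // mulrDl CexpD. Qed.

Lemma CpowN z w : z != 0 -> Cpow z (- w) = (Cpow z w)^-1.
Proof. by move=> z0; rewrite !CpowE // mulNr CexpN. Qed.

Lemma Cpow0 z : Cpow z 0 = 1.
Proof.
have [->|z0] := eqVneq z 0; first by rewrite /Cpow !eqxx.
by rewrite CpowE // mul0r Cexp0.
Qed.

Lemma Cpow1 z : z != 0 -> Cpow z 1 = z.
Proof. by move=> z0; rewrite CpowE // mul1r ClogK. Qed.

Lemma Cpow_nat z n : z != 0 -> Cpow z n%:R = z ^+ n.
Proof.
move=> z0; elim: n => [|n IH]; first by rewrite Cpow0.
by rewrite -natr1 CpowD // IH Cpow1 // exprSr.
Qed.

Lemma CpowB1 z w : z != 0 -> Cpow z (w - 1) = Cpow z w / z.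
Proof. by move=> z0; rewrite CpowD // CpowN // Cpow1. Qed.

Lemma Cpow_base1 w : Cpow 1 w = 1.
Proof. by rewrite CpowE ?oner_neq0 // (Clog_real ltr01) ln1 mulr0 Cexp0. Qed.

Lemma Cpow_mul z1 z2 w : z1 != 0 -> z2 != 0 ->
  Clog (z1 * z2) = Clog z1 + Clog z2 -> Cpow (z1 * z2) w = Cpow z1 w * Cpow z2 w.
Proof. by move=> h1 h2 e; rewrite !CpowE ?mulf_neq0 // e mulrDr CexpD. Qed.

Lemma Cpow_mul_Re z1 z2 w : 0 < Re z1 -> 0 < Re z2 ->
  Cpow (z1 * z2) w = Cpow z1 w * Cpow z2 w.
Proof.
by move=> h1 h2; apply: Cpow_mul; rewrite ?Re_gt0_neq0 // Clog_mul_Re.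
Qed.

Lemma Cpow_mulr r z w : 0 < r -> z != 0 ->
  Cpow (r%:C * z) w = Cpow r%:C w * Cpow z w.
Proof.
move=> h1 h2; apply: Cpow_mul => //; last exact: Clog_mulr.
exact: Re_gt0_neq0.
Qed.

Lemma Cpow_mulrr r s w : 0 < r -> 0 < s ->
  Cpow (r * s)%:C w = Cpow r%:C w * Cpow s%:C w.
Proof. by move=> h1 h2; rewrite rmorphM /= Cpow_mulr // Re_gt0_neq0. Qed.

Lemma Cpow_invr r w : 0 < r -> Cpow (r^-1)%:C w = (Cpow r%:C w)^-1.
Proof.
move=> r0; have h : Cpow r%:C w != 0 by rewrite Cpow_neq0 ?Re_gt0_neq0.
apply: (mulfI h); rewrite -Cpow_mulrr ?invr_gt0 // (divff h) divff ?lt0r_neq0 //.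
exact: Cpow_base1.
Qed.

Lemma Cabs_Cpow z w : z != 0 ->
  Cabs (Cpow z w) = Cabs z `^ Re w * expR (- (Im w * Carg z)).
Proof.
move=> z0; rewrite CpowE // Cabs_Cexp ReM /= expRD; congr (_ * _).
by rewrite /powR Cabs_eq0 (negbTE z0).
Qed.

Lemma Cabs_Cpow_le z w : z != 0 ->
  Cabs (Cpow z w) <= expR (`|Im w| * pi) * Cabs z `^ Re w.
Proof.
move=> z0; rewrite Cabs_Cpow // mulrC ler_wpM2r ?powR_ge0 // ler_expR.
apply: le_trans (ler_norm _) _; rewrite normrN normrM ler_wpM2l //.
by have /andP[h1 h2] := Carg_bound z0; rewrite ler_norml h2 ltW.
Qed.

Lemma Cabs_Cpow_real r w : 0 < r -> Cabs (Cpow r%:C w) = r `^ Re w.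
Proof.
move=> r0; rewrite Cabs_Cpow ?Re_gt0_neq0 // Cabs_real gtr0_norm //.
by rewrite -Im_Clog Clog_real //= mulr0 oppr0 expR0 mulr1.
Qed.

End ComplexBasics.

(** * Derivatives along the real line, and limits of complex sequences *)

Section ComplexDerivative.
Variable R : realType.
Local Notation C := R[i].
Local Notation Re := (@complex.Re R).
Local Notation Im := (@complex.Im R).
Implicit Types (z w l : C) (x y r t : R) (f g : R -> C).

(** Every differentiation of this file, also of an analytic function, is along
    a real parameter, so a pair of real derivatives suffices. *)
Definition is_Cder f t l :=
  is_derive t (1 : R) (fun s => Re (f s)) (Re l) /\
  is_derive t (1 : R) (fun s => Im (f s)) (Im l).

Lemma is_Cder_eq f t l l' : is_Cder f t l -> l = l' -> is_Cder f t l'.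
Proof. by move=> h <-. Qed.

Lemma is_Cder_ext f g t l : (forall s, f s = g s) -> is_Cder f t l -> is_Cder g t l.
Proof. by move=> /funext ->. Qed.

Lemma is_Cder_near f g t l : (\forall s \near t, f s = g s) ->
  is_Cder f t l -> is_Cder g t l.
Proof.
move=> h [h1 h2]; split; [apply: near_eq_is_derive h1|apply: near_eq_is_derive h2];
  by apply: filterS h => s ->.
Qed.

Lemma is_Cder_cst (z : C) t : is_Cder (fun=> z) t 0.
Proof. by split; exact: is_derive_cst. Qed.

Lemma is_Cder_real (g : R -> R) t (l : R) : is_derive t 1 g l ->
  is_Cder (fun s => (g s)%:C) t l%:C.
Proof. by move=> h; split => //=; exact: is_derive_cst. Qed.

Lemma is_Cder_id t : is_Cder (fun s => s%:C) t 1.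
Proof. by apply: is_Cder_real; exact: is_derive_id. Qed.

Lemma is_CderD f g t l l' : is_Cder f t l -> is_Cder g t l' ->
  is_Cder (fun s => f s + g s) t (l + l').
Proof.
move=> [h1 h2] [h3 h4]; split.
  rewrite ReD; under eq_fun do rewrite ReD; exact: is_deriveD.
rewrite ImD; under eq_fun do rewrite ImD; exact: is_deriveD.
Qed.

Lemma is_CderN f t l : is_Cder f t l -> is_Cder (fun s => - f s) t (- l).
Proof.
move=> [h1 h2]; split.
  rewrite ReN; under eq_fun do rewrite ReN; exact: is_deriveN.
rewrite ImN; under eq_fun do rewrite ImN; exact: is_deriveN.
Qed.

Lemma is_CderB f g t l l' : is_Cder f t l -> is_Cder g t l' ->
  is_Cder (fun s => f s - g s) t (l - l').
Proof. by move=> h1 h2; apply: is_CderD => //; exact: is_CderN. Qed.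

Lemma is_CderM f g t l l' : is_Cder f t l -> is_Cder g t l' ->
  is_Cder (fun s => f s * g s) t (l * g t + f t * l').
Proof.
move=> [h1 h2] [h3 h4]; split.
  under eq_fun do rewrite ReM.
  apply: is_derive_eq; rewrite ReD !ReM /GRing.scale /=; ring.
under eq_fun do rewrite ImM.
apply: is_derive_eq; rewrite ImD !ImM /GRing.scale /=; ring.
Qed.

Lemma is_CderZ z f t l : is_Cder f t l -> is_Cder (fun s => z * f s) t (z * l).
Proof.
move=> h; apply: is_Cder_eq (is_CderM (is_Cder_cst z t) h) _.
by rewrite mul0r add0r.
Qed.

Lemma is_Cder_sum (I : Type) (s : seq I) (P : pred I) (F : I -> R -> C) (l : I -> C) t :
  (forall i, is_Cder (F i) t (l i)) ->
  is_Cder (fun x => \sum_(i <- s | P i) F i x) t (\sum_(i <- s | P i) l i).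
Proof.
move=> h; elim: s => [|i s IH].
  by rewrite big_nil; under eq_fun do rewrite big_nil; exact: is_Cder_cst.
rewrite big_cons; under eq_fun do rewrite big_cons.
by case: ifP => _ //; exact: is_CderD.
Qed.

Lemma is_Cder_lin z w t : is_Cder (fun s => z + s%:C * w) t w.
Proof.
apply: is_Cder_eq.
  apply: is_CderD; first exact: is_Cder_cst.
  by apply: is_CderM; [exact: is_Cder_id | exact: is_Cder_cst].
by rewrite mulr0 addr0 add0r mul1r.
Qed.

Lemma is_CderX f t l n : is_Cder f t l ->
  is_Cder (fun s => f s ^+ n) t (n%:R * f t ^+ n.-1 * l).
Proof.
move=> h; elim: n => [|n IH].
  by rewrite !mul0r; under eq_fun do rewrite expr0; exact: is_Cder_cst.
under eq_fun do rewrite exprS.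
apply: is_Cder_eq (is_CderM h IH) _ => /=.
case: n {IH} => [|n]; first by rewrite /= !expr0 mul0r mul0r mulr0 addr0 mulr1 !mul1r.
by rewrite /= -[n.+2%:R]natr1 exprS; ring.
Qed.

Lemma is_Cder_Cexp f t l : is_Cder f t l ->
  is_Cder (fun s => Cexp (f s)) t (l * Cexp (f t)).
Proof.
move=> [h1 h2]; split => /=.
  have hc := is_derive1_comp (is_derive_cos (Im (f t))) h2.
  have he := is_derive1_comp (is_derive_expR (Re (f t))) h1.
  apply: is_derive_eq (is_deriveM he hc) _; rewrite ReM /GRing.scale /=; ring.
have hc := is_derive1_comp (is_derive_sin (Im (f t))) h2.
have he := is_derive1_comp (is_derive_expR (Re (f t))) h1.
apply: is_derive_eq (is_deriveM he hc) _; rewrite ImM /GRing.scale /=; ring.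
Qed.

Lemma is_Cder_continuous f t l : is_Cder f t l ->
  {for t, continuous (fun s => Re (f s))} /\ {for t, continuous (fun s => Im (f s))}.
Proof.
move=> [h1 h2]; split.
  by apply: differentiable_continuous; apply/derivable1_diffP; case: h1.
by apply: differentiable_continuous; apply/derivable1_diffP; case: h2.
Qed.

(** In the right half plane Clog f = ln |f| + i atan (Im f / Re f). *)
Lemma is_Cder_Clog_Re f t l : is_Cder f t l -> 0 < Re (f t) ->
  is_Cder (fun s => Clog (f s)) t (l / f t).
Proof.
move=> hf p0; have [c1 c2] := is_Cder_continuous hf; case: hf => h1 h2.
have np : \forall s \near t, 0 < Re (f s) by exact: cvgr_gt c1 _ p0.
have q0 : 0 < Re (f t) ^+ 2 + Im (f t) ^+ 2.
  by rewrite ltr_wpDr ?sqr_ge0 // exprn_gt0.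
have vE : (l / f t) = (Re l * Re (f t) + Im l * Im (f t)) / (Re (f t) ^+ 2 + Im (f t) ^+ 2)
   +i* ((Im l * Re (f t) - Re l * Im (f t)) / (Re (f t) ^+ 2 + Im (f t) ^+ 2)).
  have fn : f t != 0 by exact: Re_gt0_neq0.
  apply: (mulIf fn); rewrite divfK //; apply: eqC; rewrite ?ReM ?ImM /=;
   by field; exact: lt0r_neq0.
rewrite vE; split => /=.
- pose g := fun s => 2^-1 * ln (Re (f s) * Re (f s) + Im (f s) * Im (f s)).
  apply: (@near_eq_is_derive _ _ _ g).
    apply: filterS np => s s0; rewrite /g.
    have c0 : 0 < Cabs (f s) by rewrite Cabs_gt0 Re_gt0_neq0.
    by rewrite -!expr2 -sqr_Cabs lnXn //=; lra.
  rewrite /g.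
  have q0' : 0 < Re (f t) * Re (f t) + Im (f t) * Im (f t) by rewrite -!expr2.
  have d1 : is_derive t 1 (fun s => Re (f s) * Re (f s) + Im (f s) * Im (f s))
     (2 * (Re l * Re (f t) + Im l * Im (f t))).
    apply: is_derive_eq; rewrite /GRing.scale /=; ring.
  have d2 := @is_derive1_comp _ (@ln R)
    (fun s => Re (f s) * Re (f s) + Im (f s) * Im (f s)) t _ _ (is_derive1_ln q0') d1.
  have d3 := is_deriveZ 2^-1 d2.
  apply: is_derive_eq d3 _; rewrite /GRing.scale /=; field.
  by rewrite lt0r_neq0 // lt0r_neq0.
- apply: (@near_eq_is_derive _ _ _ (fun s => atan (Im (f s) * (Re (f s))^-1))).
    by apply: filterS np => s s0; rewrite Carg_atan.
  have Rn : Re (f t) != 0 by exact: lt0r_neq0.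
  have d1 := is_deriveV Rn h1.
  have d2 := is_deriveM h2 d1.
  have d3 := @is_derive1_comp _ (@atan R) (fun s => Im (f s) * (Re (f s))^-1) t _ _
    (is_derive1_atan (Im (f t) * (Re (f t))^-1)) d2.
  apply: is_derive_eq d3 _; rewrite /GRing.scale /=; field.
  by rewrite Rn lt0r_neq0.
Qed.

Lemma is_Cder_near_small f t l (e : R) : is_Cder f t l -> 0 < e ->
  \forall s \near t, Cabs (f s - f t) < e.
Proof.
move=> /is_Cder_continuous[c1 c2] e0.
have e1 : 0 < e / 2 by lra.
move/cvgrPdist_lt : c1 => /(_ _ e1) c1; move/cvgrPdist_lt : c2 => /(_ _ e1) c2.
near=> s; rewrite CabsB; apply: (le_lt_trans (Cabs_le _)); rewrite !ReD !ImD !ReN !ImN.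
have : `|Re (f t) - Re (f s)| < e / 2 by near: s.
have : `|Im (f t) - Im (f s)| < e / 2 by near: s.
lra.
Unshelve. all: by end_near. Qed.

(** For s near t, Clog (f s) = Clog (f t) + Clog (f s / f t), where f s / f t is
    close to 1, hence in the right half plane. *)
Lemma is_Cder_Clog f t l : is_Cder f t l -> log_plane (f t) ->
  is_Cder (fun s => Clog (f s)) t (l / f t).
Proof.
move=> hf fp.
have d0 := cut_dist_gt0 fp; have fn := log_plane_neq0 fp.
pose g s := Clog (f t) + Clog (1 + (f s - f t) / f t).
apply: (@is_Cder_near g).
  apply: filterS (is_Cder_near_small hf d0) => s hs.
  by rewrite /g; have [<- _] := Clog_near fp hs; rewrite addrC subrK.
apply: is_Cder_eq.
  apply: is_CderD; first exact: is_Cder_cst.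
  apply: is_Cder_Clog_Re; last by rewrite subrr mul0r addr0 Re_1.
  apply: is_CderD; first exact: is_Cder_cst.
  apply: is_CderM; last exact: is_Cder_cst.
  by apply: is_CderB; [exact: hf | exact: is_Cder_cst].
by rewrite /= subrr !mul0r addr0 add0r add0r subr0 addr0 divr1.
Qed.

Lemma is_Cder_Cpow f t l w : is_Cder f t l -> log_plane (f t) ->
  is_Cder (fun s => Cpow (f s) w) t (w * l / f t * Cpow (f t) w).
Proof.
move=> hf fp; have fn := log_plane_neq0 fp.
apply: (@is_Cder_near (fun s => Cexp (w * Clog (f s)))).
  have e0 : 0 < Cabs (f t) by rewrite Cabs_gt0.
  apply: filterS (is_Cder_near_small hf e0) => s hs.
  rewrite CpowE //; apply/eqP => e; move: hs; rewrite e sub0r CabsN.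
  by rewrite ltxx.
rewrite CpowE // -(mulrA w); apply: (is_Cder_Cexp (f := fun s => w * Clog (f s))).
by apply: is_CderZ; exact: is_Cder_Clog.
Qed.

Lemma log_plane_Re z : 0 < Re z -> log_plane z.
Proof. by move=> h [_]; rewrite leNgt h. Qed.

Lemma log_plane_Im z : Im z != 0 -> log_plane z.
Proof. by move=> h [e _]; rewrite e eqxx in h. Qed.

(** The real mean value theorem for the real and the imaginary part separately,
    which costs the factor 2. *)
Lemma Cder_mean_value f df (a b M : R) : a <= b ->
  (forall s, a <= s <= b -> is_Cder f s (df s)) ->
  (forall s, a <= s <= b -> Cabs (df s) <= M) ->
  Cabs (f b - f a) <= 2 * M * (b - a).
Proof.
move=> ab hd hM; have [->|ab'] := eqVneq a b.
  by rewrite !subrr mulr0 Cabs0.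
have {}ab : a < b by rewrite lt_neqAle ab'.
have key (P : C -> R) : (forall s, a <= s <= b ->
   is_derive s 1 (fun s => P (f s)) (P (df s))) ->
   (forall z, `|P z| <= Cabs z) -> `|P (f b) - P (f a)| <= M * (b - a).
  move=> hP hPl.
  have cP : {within `[a, b], continuous (fun s => P (f s))}.
    apply: derivable_within_continuous => s; rewrite in_itv /= => /hP.
    by case.
  have [|c] := @MVT _ (fun s => P (f s)) (fun s => P (df s)) a b ab _ cP.
    by move=> s; rewrite in_itv /= => /andP[s1 s2]; apply: hP; rewrite !ltW.
  rewrite in_itv /= => /andP[c1 c2] ->; rewrite normrM (gtr0_norm (_ : 0 < b - a)) ?subr_gt0 //.
  apply: ler_wpM2r; first by rewrite subr_ge0 ltW.
  by apply: le_trans (hPl _) (hM _ _); rewrite !ltW.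
have h1 : `|Re (f b) - Re (f a)| <= M * (b - a).
  by apply: key => [s /hd[]|z] //; exact: Re_le_Cabs.
have h2 : `|Im (f b) - Im (f a)| <= M * (b - a).
  by apply: key => [s /hd[]|z] //; exact: Im_le_Cabs.
apply: le_trans (Cabs_le _) _; rewrite ReD ImD ReN ImN; lra.
Qed.

Lemma Ccvg_Cabs (u : nat -> C) l :
  ((u : nat -> R[i]^o) @ \oo --> (l : R[i]^o)) <->
  (fun n => Cabs (u n - l)) @ \oo --> (0 : R).
Proof.
split => [/cvgrPdist_lt h|/cvgrPdist_lt h].
  apply/cvgrPdist_lt => e e0.
  have e0' : (0 : R[i]) < e%:C by rewrite ltcR.
  have := h _ e0'; apply: filterS => n /=.
  by rewrite normC_Cabs ltcR sub0r normrN (ger0_norm (Cabs_ge0 _)) CabsB.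
apply/cvgrPdist_lt => e e0.
have er : e = (Re e)%:C by rewrite RRe_real // gtr0_real.
have e0' : 0 < Re e by rewrite er ltcR in e0.
have := h _ e0'; apply: filterS => n /=.
by rewrite er normC_Cabs ltcR sub0r normrN (ger0_norm (Cabs_ge0 _)) CabsB.
Qed.

Lemma Ccvg_ReIm (u : nat -> C) l :
  ((u : nat -> R[i]^o) @ \oo --> (l : R[i]^o)) <->
  (fun n => Re (u n)) @ \oo --> Re l /\ (fun n => Im (u n)) @ \oo --> Im l.
Proof.
rewrite Ccvg_Cabs; split.
  move=> /cvgrPdist_lt h; split; apply/cvgrPdist_lt => e e0;
    apply: filterS (h _ e0) => n; rewrite sub0r normrN (ger0_norm (Cabs_ge0 _)) CabsB.
    by apply: le_lt_trans; rewrite -ReN -ReD Re_le_Cabs.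
  by apply: le_lt_trans; rewrite -ImN -ImD Im_le_Cabs.
move=> [/cvgrPdist_lt h1 /cvgrPdist_lt h2]; apply/cvgrPdist_lt => e e0.
have e1 : 0 < e / 2 by lra.
near=> n; rewrite sub0r normrN (ger0_norm (Cabs_ge0 _)) CabsB.
apply: (le_lt_trans (Cabs_le _)); rewrite ReD ImD ReN ImN.
have : `|Re l - Re (u n)| < e / 2 by near: n; exact: h1.
have : `|Im l - Im (u n)| < e / 2 by near: n; exact: h2.
lra.
Unshelve. all: by end_near. Qed.

Lemma Ccvg_le (u : nat -> C) l (e : nat -> R) :
  (\forall n \near \oo, Cabs (u n - l) <= e n) -> e @ \oo --> (0 : R) ->
  (u : nat -> R[i]^o) @ \oo --> (l : R[i]^o).
Proof.
move=> h he; apply/Ccvg_Cabs; apply: squeeze_cvgr (cvg_cst 0) he.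
by apply: filterS h => n ->; rewrite Cabs_ge0.
Qed.

Lemma Ccvg_unique (u : nat -> C) l l' :
  (u : nat -> R[i]^o) @ \oo --> (l : R[i]^o) ->
  (u : nat -> R[i]^o) @ \oo --> (l' : R[i]^o) -> l = l'.
Proof. by move=> h1 h2; apply: (cvg_unique _ h1 h2). Qed.

Lemma Ccvg_M (u v : nat -> C) l l' :
  (u : nat -> R[i]^o) @ \oo --> (l : R[i]^o) ->
  (v : nat -> R[i]^o) @ \oo --> (l' : R[i]^o) ->
  ((fun n => u n * v n) : nat -> R[i]^o) @ \oo --> (l * l' : R[i]^o).
Proof.
move=> /Ccvg_ReIm[h1 h2] /Ccvg_ReIm[h3 h4]; apply/Ccvg_ReIm; split.
  rewrite ReM; under eq_fun do rewrite ReM.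
  exact: cvgB (cvgM h1 h3) (cvgM h2 h4).
rewrite ImM; under eq_fun do rewrite ImM.
exact: cvgD (cvgM h1 h4) (cvgM h2 h3).
Qed.

Lemma Ccvg_D (u v : nat -> C) l l' :
  (u : nat -> R[i]^o) @ \oo --> (l : R[i]^o) ->
  (v : nat -> R[i]^o) @ \oo --> (l' : R[i]^o) ->
  ((fun n => u n + v n) : nat -> R[i]^o) @ \oo --> (l + l' : R[i]^o).
Proof.
move=> /Ccvg_ReIm[h1 h2] /Ccvg_ReIm[h3 h4]; apply/Ccvg_ReIm; split.
  by rewrite ReD; under eq_fun do rewrite ReD; exact: cvgD.
by rewrite ImD; under eq_fun do rewrite ImD; exact: cvgD.
Qed.

Lemma Ccvg_Z (u : nat -> C) l z :
  (u : nat -> R[i]^o) @ \oo --> (l : R[i]^o) ->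
  ((fun n => z * u n) : nat -> R[i]^o) @ \oo --> (z * l : R[i]^o).
Proof.
move=> /Ccvg_ReIm[h1 h2]; apply: Ccvg_M; apply/Ccvg_ReIm; split=> //; exact: cvg_cst.
Qed.

Lemma Cseries_sumE (u : nat -> C) l : Cseries_cvg u l -> Cseries_sum u = l.
Proof. by move=> h; apply: (cvg_lim (@norm_hausdorff _ _) h). Qed.

Lemma is_Cder_cvg f t l (s : nat -> R) : is_Cder f t l -> s @ \oo --> t ->
  ((fun n => f (s n)) : nat -> R[i]^o) @ \oo --> (f t : R[i]^o).
Proof.
move=> /is_Cder_continuous[c1 c2] hs; apply/Ccvg_ReIm; split.
  exact: (cvg_comp _ _ hs c1).
exact: (cvg_comp _ _ hs c2).
Qed.

End ComplexDerivative.

Arguments Ccvg_Z {R u l} z _.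
Arguments is_CderZ {R} z {f t l} _.
Arguments is_CderX {R f t l} n _.
Arguments is_Cder_Cpow {R f t l} w _ _.
Arguments is_Cder_lin {R} z w t.

(** * Integrals of complex-valued functions *)

Section ComplexIntegral.
Variable R : realType.
Local Notation C := R[i].
Local Notation Re := (@complex.Re R).
Local Notation Im := (@complex.Im R).
Local Notation mu := (@lebesgue_measure R).
Implicit Types (z w l : C) (x y r t : R) (f g : R -> C) (D : set R).

Definition Cmeasurable D f :=
  measurable_fun D (fun t => Re (f t)) /\ measurable_fun D (fun t => Im (f t)).

Definition Rintegrable D (g : R -> R) := mu.-integrable D (EFin \o g).

Definition Cintegrable D f :=
  Rintegrable D (fun t => Re (f t)) /\ Rintegrable D (fun t => Im (f t)).

Lemma Cmeasurable_ext D f g : (forall t, D t -> f t = g t) ->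
  Cmeasurable D f -> Cmeasurable D g.
Proof.
move=> e [h1 h2]; split; [apply: eq_measurable_fun h1|apply: eq_measurable_fun h2];
  by move=> t /set_mem/e ->.
Qed.

Lemma Cmeasurable_cst D z : Cmeasurable D (fun=> z).
Proof. by split. Qed.

Lemma CmeasurableD D f g : Cmeasurable D f -> Cmeasurable D g ->
  Cmeasurable D (fun t => f t + g t).
Proof.
move=> [h1 h2] [h3 h4]; split; under eq_fun do rewrite ?ReD ?ImD;
  exact: measurable_funD.
Qed.

Lemma CmeasurableM D f g : Cmeasurable D f -> Cmeasurable D g ->
  Cmeasurable D (fun t => f t * g t).
Proof.
move=> [h1 h2] [h3 h4]; split; under eq_fun do rewrite ?ReM ?ImM.
  by apply: measurable_funB; exact: measurable_funM.
by apply: measurable_funD; exact: measurable_funM.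
Qed.

Lemma Cmeasurable_sum D (F : nat -> R -> C) n : (forall i, Cmeasurable D (F i)) ->
  Cmeasurable D (fun t => \sum_(0 <= i < n) F i t).
Proof.
move=> h; elim: n => [|n IH].
  by under eq_fun do rewrite big_nil; exact: Cmeasurable_cst.
by under eq_fun do rewrite big_nat_recr //=; exact: CmeasurableD.
Qed.

Lemma Rintegrable_le D (f g : R -> R) : measurable D -> measurable_fun D f ->
  Rintegrable D g -> (forall t, D t -> `|f t| <= g t) -> Rintegrable D f.
Proof.
move=> mD mf ig h; apply: le_integrable ig => //; first exact/measurable_EFinP.
by move=> t Dt /=; rewrite lee_fin (le_trans (h t Dt)) // ler_norm.
Qed.

Lemma Cintegrable_le D f (g : R -> R) : measurable D -> Cmeasurable D f ->
  Rintegrable D g -> (forall t, D t -> Cabs (f t) <= g t) -> Cintegrable D f.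
Proof.
move=> mD [m1 m2] ig h; split; apply: (Rintegrable_le mD _ ig) => // t Dt;
 apply: le_trans (h t Dt); [exact: Re_le_Cabs|exact: Im_le_Cabs].
Qed.

Lemma Cintegrable_meas D f : Cintegrable D f -> Cmeasurable D f.
Proof.
move=> [h1 h2].
by split; apply/measurable_EFinP; apply: (measurable_int mu).
Qed.

Lemma RintegrableD D (f g : R -> R) : measurable D ->
  Rintegrable D f -> Rintegrable D g -> Rintegrable D (fun t => f t + g t).
Proof. by rewrite /Rintegrable => mD h1 h2; exact: (@integrableD _ _ _ mu D mD _ _ h1 h2). Qed.

Lemma RintegrableZ D (f : R -> R) k : measurable D ->
  Rintegrable D f -> Rintegrable D (fun t => k * f t).
Proof. by rewrite /Rintegrable => mD h1; exact: (@integrableZl _ _ _ mu D mD k _ h1). Qed.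

Lemma Cintegrable_Cabs D f : measurable D -> Cintegrable D f ->
  exists2 g, Rintegrable D g & forall t, Cabs (f t) <= g t.
Proof.
move=> mD [h1 h2]; exists (fun t => `|Re (f t)| + `|Im (f t)|) => [|t].
  by apply: RintegrableD => //; exact: integrable_norm.
exact: Cabs_le.
Qed.

Lemma CintegrableD D f g : measurable D -> Cintegrable D f -> Cintegrable D g ->
  Cintegrable D (fun t => f t + g t).
Proof.
move=> mD [h1 h2] [h3 h4]; split; rewrite /Rintegrable;
  under eq_fun do rewrite ?ReD ?ImD; exact: RintegrableD.
Qed.

Lemma CintegrableZ D f z : measurable D -> Cintegrable D f ->
  Cintegrable D (fun t => z * f t).
Proof.
move=> mD hf; have [g ig hg] := Cintegrable_Cabs mD hf.
apply: (@Cintegrable_le _ _ (fun t => Cabs z * g t)) => //.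
- by apply: CmeasurableM (Cintegrable_meas hf); exact: Cmeasurable_cst.
- exact: RintegrableZ.
by move=> t _; rewrite CabsM ler_wpM2l ?Cabs_ge0.
Qed.

Lemma Cintegrable_ext D f g : measurable D -> (forall t, D t -> f t = g t) ->
  Cintegrable D f -> Cintegrable D g.
Proof.
by move=> mD e [h1 h2]; split; [apply: eq_integrable h1|apply: eq_integrable h2] => //
  t /set_mem/e /= ->.
Qed.

Lemma eq_Cintegral D f g : (forall t, D t -> f t = g t) ->
  Cintegral D f = Cintegral D g.
Proof.
by move=> e; rewrite /Cintegral; congr (_ +i* _); apply: eq_Rintegral => t /set_mem/e ->.
Qed.

Lemma CintegralD D f g : measurable D -> Cintegrable D f -> Cintegrable D g ->
  Cintegral D (fun t => f t + g t) = Cintegral D f + Cintegral D g.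
Proof.
move=> mD [h1 h2] [h3 h4]; apply: eqC => /=.
  by rewrite -RintegralD //; apply: eq_Rintegral => t _; rewrite ReD.
by rewrite -RintegralD //; apply: eq_Rintegral => t _; rewrite ImD.
Qed.

Lemma CintegralZ D f z : measurable D -> Cintegrable D f ->
  Cintegral D (fun t => z * f t) = z * Cintegral D f.
Proof.
move=> mD [h1 h2]; apply: eqC; rewrite ?ReM ?ImM /=.
  rewrite -!RintegralZl // -RintegralB //; [|exact: RintegrableZ..].
  by apply: eq_Rintegral => t _; rewrite ReM.
rewrite -!RintegralZl // -RintegralD //; [|exact: RintegrableZ..].
by apply: eq_Rintegral => t _; rewrite ImM.
Qed.

Lemma CintegralB D f g : measurable D -> Cintegrable D f -> Cintegrable D g ->
  Cintegral D (fun t => f t - g t) = Cintegral D f - Cintegral D g.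
Proof.
move=> mD h1 h2.
rewrite -[- Cintegral _ _]mulN1r -CintegralZ // -CintegralD //.
  by apply: eq_Cintegral => t _; rewrite mulN1r.
exact: CintegrableZ.
Qed.

Lemma CintegrableB D f g : measurable D -> Cintegrable D f -> Cintegrable D g ->
  Cintegrable D (fun t => f t - g t).
Proof.
move=> mD h1 h2; have := CintegrableD mD h1 (CintegrableZ (-1) mD h2).
by apply: Cintegrable_ext => // t _; rewrite mulN1r.
Qed.

Lemma Cintegral0 D : Cintegral D (fun=> 0) = 0.
Proof. by rewrite /Cintegral /= /Rintegral integral0. Qed.

Lemma Cintegrable0 D : measurable D -> Cintegrable D (fun=> 0).
Proof. by move=> mD; split; exact: integrable0. Qed.

Lemma Cintegrable_sum D (F : nat -> R -> C) n : measurable D ->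
  (forall i, Cintegrable D (F i)) ->
  Cintegrable D (fun t => \sum_(0 <= i < n) F i t) /\
  Cintegral D (fun t => \sum_(0 <= i < n) F i t) = \sum_(0 <= i < n) Cintegral D (F i).
Proof.
move=> mD h; elim: n => [|n [IH1 IH2]].
  under eq_fun do rewrite big_nil; rewrite big_nil; split.
    exact: Cintegrable0.
  exact: Cintegral0.
under eq_fun do rewrite big_nat_recr //=; rewrite big_nat_recr //=; split.
  exact: CintegrableD.
by rewrite CintegralD // IH2.
Qed.

Lemma Cabs_Cintegral_le D f (g : R -> R) : measurable D -> Cmeasurable D f ->
  Rintegrable D g -> (forall t, D t -> Cabs (f t) <= g t) ->
  Cabs (Cintegral D f) <= 2 * Rintegral mu D g.
Proof.
move=> mD mf ig h; have [i1 i2] := Cintegrable_le mD mf ig h.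
have key (P : C -> R) : Rintegrable D (fun t => P (f t)) ->
    (forall z, `|P z| <= Cabs z) ->
    `|Rintegral mu D (fun t => P (f t))| <= Rintegral mu D g.
  move=> iP hP; have hh : `|Rintegral mu D (fun t => P (f t))| <= Rintegral mu D (fun t => `|P (f t)|).
    exact: (@le_normr_Rintegral _ _ _ mu D _ mD iP).
  apply: le_trans hh _.
  apply: le_Rintegral => //; first exact: integrable_norm.
  by move=> t Dt; apply: le_trans (h t Dt); exact: hP.
have h1 := key _ i1 (@Re_le_Cabs R); have h2 := key _ i2 (@Im_le_Cabs R).
apply: le_trans (Cabs_le _) _; apply: (le_trans (lerD h1 h2)).
by rewrite -mulr2n mulr_natl.
Qed.

Lemma Rdct D (u : nat -> R -> R) (f g : R -> R) : measurable D ->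
  (forall n, measurable_fun D (u n)) -> measurable_fun D f ->
  (forall t, D t -> u n t @[n --> \oo] --> f t) ->
  Rintegrable D g -> (forall n t, D t -> `|u n t| <= g t) ->
  Rintegrable D f /\ Rintegral mu D (u n) @[n --> \oo] --> Rintegral mu D f.
Proof.
move=> mD mu_ mf cv ig ub.
have [|||i1 _ i3] := @dominated_convergence _ _ _ mu D mD (fun n => EFin \o u n) (EFin \o f)
   (EFin \o g) (fun n => proj2 (measurable_EFinP _ _) (mu_ n))
   (proj2 (measurable_EFinP _ _) mf).
- by apply: aeW => t Dt; apply: cvg_EFin; [exact: nearW|exact: cv].
- exact: ig.
- by apply: aeW => t n Dt; rewrite lee_fin; exact: ub.
split => //; apply: fine_cvg; rewrite fineK ?integrable_fin_num //.
Qed.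

Lemma Cdct D (u : nat -> R -> C) f (g : R -> R) : measurable D ->
  (forall n, Cmeasurable D (u n)) -> Cmeasurable D f ->
  (forall t, D t -> ((fun n => u n t) : nat -> R[i]^o) @ \oo --> (f t : R[i]^o)) ->
  Rintegrable D g -> (forall n t, D t -> Cabs (u n t) <= g t) ->
  Cintegrable D f /\
  ((fun n => Cintegral D (u n)) : nat -> R[i]^o) @ \oo --> (Cintegral D f : R[i]^o).
Proof.
move=> mD mu_ [m1 m2] cv ig ub.
have [i1 c1] : Rintegrable D (fun t => Re (f t)) /\
   Rintegral mu D (fun t => Re (u n t)) @[n --> \oo] --> Rintegral mu D (fun t => Re (f t)).
  apply: (@Rdct _ _ _ g) => // [n|t Dt|n t Dt]; first by case: (mu_ n).
    by have /Ccvg_ReIm[] := cv t Dt.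
  exact: le_trans (Re_le_Cabs _) (ub n t Dt).
have [i2 c2] : Rintegrable D (fun t => Im (f t)) /\
   Rintegral mu D (fun t => Im (u n t)) @[n --> \oo] --> Rintegral mu D (fun t => Im (f t)).
  apply: (@Rdct _ _ _ g) => // [n|t Dt|n t Dt]; first by case: (mu_ n).
    by have /Ccvg_ReIm[] := cv t Dt.
  exact: le_trans (Im_le_Cabs _) (ub n t Dt).
by split=> //; apply/Ccvg_ReIm.
Qed.

(** The partial sums are dominated by B * g. *)
Lemma Cseries_integral D (u : nat -> R -> C) f (g : R -> R) (b : nat -> R) (B : R) :
  measurable D -> (forall n, Cmeasurable D (u n)) -> Cmeasurable D f ->
  (forall t, D t -> Cseries_cvg (fun n => u n t) (f t)) ->
  Rintegrable D g -> (forall n t, D t -> Cabs (u n t) <= g t * b n) ->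
  (forall t, D t -> 0 <= g t) -> (forall n, \sum_(0 <= i < n) b i <= B) ->
  Cseries_cvg (fun n => Cintegral D (u n)) (Cintegral D f).
Proof.
move=> mD mu_ mf cv ig ub g0 bB.
have iu n : Cintegrable D (u n).
  apply: (@Cintegrable_le _ _ (fun t => b n * g t)) => //; first exact: RintegrableZ.
  by move=> t Dt; rewrite mulrC ub.
have := @Cdct D (fun n t => \sum_(0 <= i < n) u i t) f (fun t => B * g t) mD _ mf.
case => [n|t Dt||n t Dt|_]; first exact: Cmeasurable_sum.
- exact: cv.
- exact: RintegrableZ.
- apply: le_trans (Cabs_sum _ _ _) _.
  apply: (@le_trans _ _ (\sum_(0 <= i < n) g t * b i)).
    by apply: ler_sum => i _; exact: ub.
  by rewrite -mulr_sumr mulrC ler_wpM2r ?g0.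
by under eq_fun do rewrite (Cintegrable_sum _ mD iu).2.
Qed.

(** An open interval as a limit of compact ones: this reduces integrals over it
    to the fundamental theorem of calculus on compact intervals. *)
Definition exhausts D (a b : nat -> R) := [/\ open D, measurable D,
  (forall n, a n < b n), (forall n t, a n <= t <= b n -> D t) &
  (forall t, D t -> \forall n \near \oo, a n <= t <= b n)].

Lemma patch_cvg D a b (f : R -> R) t : exhausts D a b -> D t ->
  (f \_ `[a n, b n]) t @[n --> \oo] --> f t.
Proof.
move=> [_ _ _ _ h] Dt; apply: (@cvg_near_cst _ _ _ _ _ _); apply: filterS (h t Dt) => n hn.
by rewrite patchE mem_set //= in_itv.
Qed.

Lemma RFTC2 (F f : R -> R) a b : a < b ->
  (forall t, a <= t <= b -> is_derive t 1 F (f t)) ->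
  (forall t, a <= t <= b -> {for t, continuous f}) ->
  Rintegrable `[a, b] f /\ Rintegral mu `[a, b] f = F b - F a.
Proof.
move=> ab hd hc.
have cf : {within `[a, b], continuous f}.
  by apply: continuous_in_subspaceT => t /set_mem; rewrite /= in_itv /= => /hc.
split.
  by apply: continuous_compact_integrable => //; exact: segment_compact.
have cF : {within `[a, b], continuous F}.
  by apply: derivable_within_continuous => t; rewrite in_itv /= => /hd[].
rewrite /Rintegral (@continuous_FTC2 _ f F a b) //.
  have /continuous_within_itvP[//|_ c1 c2] := cF.
  split=> // t; rewrite in_itv /= => /andP[t1 t2].
  by have [] : is_derive t 1 F (f t) by apply: hd; rewrite !ltW.
move=> t; rewrite in_itv /= => /andP[t1 t2]; rewrite derive1E.
by have [] : is_derive t 1 F (f t) by apply: hd; rewrite !ltW.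
Qed.

(** Fatou's lemma: the integrals over [a n, b n] are increments of the bounded
    primitive F. *)
Lemma Rintegrable_primitive D a b (F f : R -> R) M : exhausts D a b ->
  (forall t, D t -> 0 <= f t) ->
  (forall t, D t -> is_derive t 1 F (f t)) ->
  (forall t, D t -> {for t, continuous f}) ->
  (forall t, D t -> `|F t| <= M) -> Rintegrable D f.
Proof.
move=> ex f0 hd hc hM; have [oD mD ab sub lim] := ex.
have mf : measurable_fun D f.
  by apply: open_continuous_measurable_fun => // t /set_mem/hc.
apply/integrableP; split; first exact/measurable_EFinP.
have mitv n : measurable_fun D (f \_ `[a n, b n]).
  apply/(measurable_restrict _ (measurable_itv _) mD).
  by apply: measurable_funS mf => //; exact: subIsetl.
have e : (\int[mu]_(t in D) `|(EFin \o f) t| =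
    \int[mu]_(t in D) limn_einf (fun n => ((f \_ `[a n, b n]) t)%:E))%E.
  apply: eq_integral => t /set_mem Dt.
  have cv : ((f \_ `[a n, b n]) t)%:E @[n --> \oo] --> `|(f t)%:E|%E.
    rewrite /= ger0_norm ?f0 //; apply: cvg_EFin; first exact: nearW.
    exact: patch_cvg ex Dt.
  by rewrite (cvg_limn_einf_sup cv).1.
rewrite e; apply: le_lt_trans (fatou mu mD _ _) _.
- by move=> n; apply/measurable_EFinP; exact: mitv.
- move=> n t Dt; rewrite lee_fin patchE; case: ifP => // _; exact: f0.
have bnd n : (\int[mu]_(t in D) ((f \_ `[a n, b n]) t)%:E <= (2 * M)%:E)%E.
  have [i1 e1] : Rintegrable `[a n, b n] f /\ Rintegral mu `[a n, b n] f = F (b n) - F (a n).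
    by apply: RFTC2 => // t /sub; [exact: hd|exact: hc].
  have -> : (\int[mu]_(t in D) ((f \_ `[a n, b n]) t)%:E =
      \int[mu]_(t in `[a n, b n]) (EFin \o f) t)%E.
    transitivity (\int[mu]_(t in D `&` `[a n, b n]) (EFin \o f) t)%E; last first.
      by rewrite setIidr // => t /=; rewrite in_itv /= => /sub.
    rewrite integral_mkcondr; apply: eq_integral => t _.
    by rewrite /= !patchE; case: ifP.
  rewrite -[X in (X <= _)%E]fineK ?integrable_fin_num // lee_fin.
  move: e1; rewrite /Rintegral /= => ->.
  have Db : D (b n) by apply: (sub n); rewrite lexx (ltW (ab n)).
  have Da : D (a n) by apply: (sub n); rewrite lexx (ltW (ab n)).
  move: (hM _ Da) (hM _ Db); rewrite !ler_norml => /andP[? ?] /andP[? ?]; lra.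
apply: (@le_lt_trans _ _ (2 * M)%:E); last exact: ltry.
rewrite limn_einf_lim; apply: lime_le; first exact: is_cvg_einfs.
apply: nearW => n; apply: le_trans (bnd n).
by apply: ereal_inf_lbound; exists n => /=.
Qed.

(** Since only the limits of F along the exhaustion enter, f may be singular at
    the ends of D and D may be unbounded. *)
Lemma CFTC_exhausts D a b (F f df : R -> C) (A B : C) : exhausts D a b ->
  (forall t, D t -> is_Cder F t (f t)) -> (forall t, D t -> is_Cder f t (df t)) ->
  Cintegrable D f ->
  ((fun n => F (a n)) : nat -> R[i]^o) @ \oo --> (A : R[i]^o) ->
  ((fun n => F (b n)) : nat -> R[i]^o) @ \oo --> (B : R[i]^o) ->
  Cintegral D f = B - A.
Proof.
move=> ex hF hf [i1 i2] /Ccvg_ReIm[a1 a2] /Ccvg_ReIm[b1 b2].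
have [oD mD ab sub lim] := ex.
have key (P : C -> R) : (forall t, D t -> is_derive t 1 (fun s => P (F s)) (P (f t))) ->
    (forall t, D t -> {for t, continuous (fun s => P (f s))}) ->
    Rintegrable D (fun t => P (f t)) ->
    P (F (a n)) @[n --> \oo] --> P A -> P (F (b n)) @[n --> \oo] --> P B ->
    Rintegral mu D (fun t => P (f t)) = P B - P A.
  move=> hP cP iP hA hB.
  have mP : measurable_fun D (fun t => P (f t)).
    by apply/measurable_EFinP; apply: (measurable_int mu).
  have [_ cv] : Rintegrable D (fun t => P (f t)) /\
    Rintegral mu D ((fun t => P (f t)) \_ `[a n, b n]) @[n --> \oo] -->
    Rintegral mu D (fun t => P (f t)).
    apply: (@Rdct D _ _ (fun t => `|P (f t)|)) => //.
    - move=> n; apply/(measurable_restrict _ (measurable_itv _) mD).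
      by apply: measurable_funS mP => //; exact: subIsetl.
    - by move=> t Dt; exact: patch_cvg ex Dt.
    - exact: integrable_norm.
    - by move=> n t Dt; rewrite patchE; case: ifP => // _; rewrite normr0.
  have e n : Rintegral mu D ((fun t => P (f t)) \_ `[a n, b n]) = P (F (b n)) - P (F (a n)).
    rewrite -Rintegral_mkcondr setIidr; last first.
      by move=> t /=; rewrite in_itv /= => /sub.
    have [//|t /sub Dt|t /sub Dt|_ ->//] :=
      @RFTC2 (fun s => P (F s)) (fun s => P (f s)) (a n) (b n).
      exact: hP.
    exact: cP.
  have cv' : P (F (b n)) - P (F (a n)) @[n --> \oo] --> Rintegral mu D (fun t => P (f t)).
    by apply: cvg_trans cv; apply: near_eq_cvg; apply: nearW => n; rewrite -e.
  exact: (cvg_unique (@Rhausdorff R) cv' (cvgB hB hA)).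
apply: eqC; rewrite ?ReD ?ImD ?ReN ?ImN /=; apply: key => // t.
- by move=> /hF[].
- by move=> /hf/is_Cder_continuous[].
- by move=> /hF[].
- by move=> /hf/is_Cder_continuous[].
Qed.

Lemma measurable_mull (k : R) :
  measurable_fun [set: measurableTypeR R]
    (fun t : measurableTypeR R => (k * t : measurableTypeR R)).
Proof. exact: measurable_funM. Qed.

Definition scaled_lebesgue (k : R) (k0 : 0 < k) : {measure set (measurableTypeR R) -> \bar R} :=
  mscale (NngNum (ltW k0))
   (measure_function_pushforward__canonical__measure_function_Measure mu (measurable_mull k)).

(** The two measures agree on half-open intervals. *)
Lemma lebesgue_scale (k : R) (k0 : 0 < k) (A : set R) : measurable A ->
  mu A = scaled_lebesgue k0 A.
Proof.
move=> mA; pose m := scaled_lebesgue k0.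
have h (X : set R) : ocitv X -> mu X = m X.
  move=> [[a b] _ <-] /=.
  have -> : m `]a, b]%classic = (k%:E * mu (`](a / k)%R, (b / k)%R]%classic : set R))%E.
    rewrite /m /scaled_lebesgue /= /mscale /pushforward /=; congr (_ * mu _)%E.
    apply/seteqP; split => t /=; rewrite !in_itv /= => /andP[h1 h2].
      by rewrite ltr_pdivrMr // ler_pdivlMr // ![t * k]mulrC h1.
    by move: h1 h2; rewrite ltr_pdivrMr // ler_pdivlMr // ![t * k]mulrC => -> ->.
  rewrite !lebesgue_measure_itv /= !lte_fin ltr_pM2r ?invr_gt0 //.
  case: ifP => _; last by rewrite mule0.
  rewrite -EFinB -EFinM; congr EFin; field; exact: lt0r_neq0.
rewrite (lebesgue_measure_unique h mA) //.
Qed.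

Local Notation hl := (`]0, +oo[%classic : set R).

Lemma Rscale_ge0 (k : R) (g : R -> R) : 0 < k -> measurable_fun hl g ->
  (forall t, 0 < t -> 0 <= g t) ->
  (\int[mu]_(t in hl) (g t)%:E =
   k%:E * \int[mu]_(t in hl) (g (k * t)%R)%:E)%E.
Proof.
move=> k0 mg g0.
have mk : measurable_fun setT (fun t : R => k * t) by exact: measurable_funM.
have ge0 t : hl t -> (0 <= (g t)%:E)%E.
  by rewrite /= in_itv /= andbT lee_fin => /g0.
have mg' : measurable_fun hl (EFin \o g) by exact/measurable_EFinP.
have mD : measurable hl by exact: measurable_itv.
transitivity (\int[scaled_lebesgue k0]_(t in hl) (g t)%:E)%E.
  apply: eq_measure_integral => A mA _; exact: (lebesgue_scale k0 mA).
have h1 := @ge0_integral_mscale _ _ _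
  (measure_function_pushforward__canonical__measure_function_Measure mu (measurable_mull k))
  hl mD (NngNum (ltW k0)) (EFin \o g) mg' ge0.
apply: (etrans h1); congr (_ * _)%E.
rewrite (@ge0_integral_pushforward _ _ _ _ _ _ (measurable_mull k) mu _ _ mD mg') //; last first.
  by move=> t /set_mem/ge0.
have -> // : (fun t : R => k * t) @^-1` hl = hl.
apply/seteqP; split => t /=; rewrite !in_itv /= !andbT; last exact: mulr_gt0.
by rewrite pmulr_rgt0.
Qed.

Lemma measurable_scale (k : R) (g : R -> R) : 0 < k -> measurable_fun hl g ->
  measurable_fun hl (fun t => g (k * t)).
Proof.
move=> k0 mg; apply: (measurable_comp (F := hl)) => //.
by move=> _ [t + <-]; rewrite /= !in_itv /= !andbT => t0; exact: (mulr_gt0 k0 t0).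
Qed.

Lemma Rscale (k : R) (g : R -> R) : 0 < k -> Rintegrable hl g ->
  Rintegrable hl (fun t => g (k * t)) /\
  Rintegral mu hl g = k * Rintegral mu hl (fun t => g (k * t)).
Proof.
move=> k0 ig.
have mD : measurable hl by exact: measurable_itv.
have int_scale (h : R -> R) : (forall t, 0 <= h t) -> Rintegrable hl h ->
    Rintegrable hl (fun t => h (k * t)).
  move=> h0 /integrableP[/measurable_EFinP mh ih].
  apply/integrableP; split; first by apply/measurable_EFinP; exact: measurable_scale.
  have -> : (\int[mu]_(t in hl) `|(EFin \o (fun t => h (k * t)%R)) t| =
      \int[mu]_(t in hl) (h (k * t)%R)%:E)%E.
    by apply: eq_integral => t _ /=; rewrite ger0_norm.
  rewrite (@Rscale_ge0 k^-1) ?invr_gt0 //; last exact: measurable_scale.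
  have -> : (\int[mu]_(t in hl) (h (k * (k^-1 * t))%R)%:E =
      \int[mu]_(t in hl) `|(EFin \o h) t|)%E.
    by apply: eq_integral => t _ /=; rewrite ger0_norm // mulVKf // gt_eqF.
  by rewrite lte_mul_pinfty // lee_fin invr_ge0 ltW.
have eq_scale (h : R -> R) : (forall t, 0 <= h t) -> Rintegrable hl h ->
    Rintegral mu hl h = k * Rintegral mu hl (fun t => h (k * t)).
  move=> h0 ih; have ihk := int_scale h h0 ih.
  have mh : measurable_fun hl h.
    by apply/measurable_EFinP; apply: (measurable_int mu).
  rewrite /Rintegral (Rscale_ge0 k0 mh) // fineM // integrable_fin_num //.
have ip : Rintegrable hl (g^\+)%R := @integrable_funrpos _ _ _ mu hl g mD ig.
have im : Rintegrable hl (g^\-)%R := @integrable_funrneg _ _ _ mu hl g mD ig.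
have p0 t : 0 <= g^\+%R t by rewrite /funrpos le_max lexx orbT.
have m0 t : 0 <= g^\-%R t by rewrite /funrneg le_max lexx orbT.
have e t : g t = g^\+%R t - g^\-%R t by rewrite -[in LHS](funrposBneg g).
have jp := int_scale _ p0 ip; have jm := int_scale _ m0 im.
split.
  rewrite /Rintegrable; under [X in EFin \o X]eq_fun do rewrite e.
  exact: (@integrableB _ _ _ mu hl mD _ _ jp jm).
have e1 : Rintegral mu hl g = Rintegral mu hl (fun t => (g^\+)%R t - (g^\-)%R t).
  by apply: eq_Rintegral => t _; exact: e.
have e2 : Rintegral mu hl (fun t => g (k * t)) =
    Rintegral mu hl (fun t => (g^\+)%R (k * t) - (g^\-)%R (k * t)).
  by apply: eq_Rintegral => t _; exact: e.
by rewrite e1 e2 !RintegralB // mulrBr -!eq_scale.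
Qed.

Lemma Cscale (k : R) f : 0 < k -> Cintegrable hl f ->
  Cintegrable hl (fun t => f (k * t)) /\
  Cintegral hl f = k%:C * Cintegral hl (fun t => f (k * t)).
Proof.
move=> k0 [h1 h2]; have [i1 e1] := Rscale k0 h1; have [i2 e2] := Rscale k0 h2.
split=> //; apply: eqC; rewrite ?ReM ?ImM /= mul0r ?subr0 ?addr0 //.
Qed.

Lemma Cder_under_integral D (f df : R -> R -> C) (t0 u v : R) (g : R -> R) :
  measurable D -> u < t0 < v ->
  (forall s, u < s < v -> Cintegrable D (f s)) ->
  (forall s y, u < s < v -> D y -> is_Cder (fun x => f x y) s (df s y)) ->
  Rintegrable D g -> (forall y, 0 <= g y) ->
  (forall s y, u < s < v -> D y -> Cabs (df s y) <= g y) ->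
  is_Cder (fun s => Cintegral D (f s)) t0 (Cintegral D (df t0)).
Proof.
move=> mD uv iF hd ig g0 ub.
have key (P : C -> R) : (forall s, u < s < v -> Rintegrable D (fun y => P (f s y))) ->
   (forall s y, u < s < v -> D y -> is_derive s 1 (fun x => P (f x y)) (P (df s y))) ->
   (forall z, `|P z| <= Cabs z) ->
   is_derive t0 1 (fun s => Rintegral mu D (fun y => P (f s y)))
      (Rintegral mu D (fun y => P (df t0 y))).
  move=> iP dP hP.
  have It0 : (`]u, v[%classic : set R) t0 by rewrite /= in_itv.
  have h1 s : (`]u, v[%classic : set R) s -> mu.-integrable D (EFin \o (fun y => P (f s y))).
    by rewrite /= in_itv /=; exact: iP.
  have h2 s y : (`]u, v[%classic : set R) s -> D y -> derivable (fun x => P (f x y)) s 1.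
    by rewrite /= in_itv /= => hs Dy; have [] := dP s y hs Dy.
  have e s y : u < s < v -> D y -> partial1of2 (fun x y => P (f x y)) s y = P (df s y).
    move=> hs Dy; rewrite partial1of2E.
    by have [] := dP s y hs Dy.
  have h3 s y : (`]u, v[%classic : set R) s -> D y ->
      `|partial1of2 (fun x y => P (f x y)) s y| <= g y.
    by rewrite /= in_itv /= => hs Dy; rewrite e //; apply: le_trans (hP _) (ub _ _ hs Dy).
  have d1 := @derivable_under_integral _ _ _ mu _ _ mD _ _ _ It0 h1 h2 _ g0 ig h3.
  have d2 := @differentiation_under_integral _ _ _ mu _ _ mD _ _ _ It0 h1 h2 _ g0 ig h3.
  split; first exact: d1.
  rewrite -derive1E d2; apply: eq_Rintegral => y /set_mem Dy; exact: e.
split; apply: key.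
- by move=> s /iF[].
- by move=> s y hs Dy; case: (hd s y hs Dy).
- exact: Re_le_Cabs.
- by move=> s /iF[].
- by move=> s y hs Dy; case: (hd s y hs Dy).
- exact: Im_le_Cabs.
Qed.

Lemma cvg_inv2 : (fun n => n.+2%:R^-1) @ \oo --> (0 : R).
Proof.
by have := @cvg_harmonic R; rewrite -(cvg_shiftn 1) /harmonic; under eq_fun do rewrite addn1.
Qed.

Lemma cvg_inv3 : (fun n => n.+3%:R^-1) @ \oo --> (0 : R).
Proof.
by have := @cvg_harmonic R; rewrite -(cvg_shiftn 2) /harmonic; under eq_fun do rewrite addn2.
Qed.

(** With n + 3 the left endpoint stays below the right one from n = 0 on. *)
Lemma exhausts_01 : exhausts `]0, 1[ (fun n => n.+3%:R^-1) (fun n => 1 - n.+3%:R^-1).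
Proof.
have inv3 n : 0 < n.+3%:R^-1 :> R by rewrite invr_gt0.
have inv3' n : n.+3%:R^-1 <= 3^-1 :> R.
  by rewrite lef_pV2 ?posrE // ler_nat.
split=> //.
- move=> n /=; move: (n.+3%:R^-1) (inv3' n) => x; lra.
- move=> n t /=; rewrite in_itv /=; move: (n.+3%:R^-1) (inv3 n) => x h1 h2; lra.
move=> t; rewrite /= in_itv /= => /andP[t0 t1].
have cv := cvg_inv3.
have e0 : 0 < Num.min t (1 - t) by rewrite lt_min t0 subr_gt0.
move/cvgrPdist_lt : cv => /(_ _ e0); apply: filterS => n.
rewrite sub0r normrN gtr0_norm // lt_min => /andP[].
move: (n.+3%:R^-1) => x; lra.
Qed.

Lemma exhausts_0y : exhausts `]0, +oo[ (fun n => n.+2%:R^-1) (fun n => n.+2%:R).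
Proof.
have inv2 n : 0 < n.+2%:R^-1 :> R by rewrite invr_gt0.
split=> //.
- move=> n; apply: (@lt_le_trans _ _ 1); last by rewrite ler1n.
  by rewrite invf_lt1 // ltr1n.
- move=> n t /=; rewrite in_itv /= andbT => /andP[h _]; exact: lt_le_trans (inv2 n) h.
move=> t; rewrite /= in_itv /= andbT => t0.
move/cvgrPdist_lt : cvg_inv2 => cv.
have h1 := cv _ t0; have ti : 0 < t^-1 by rewrite invr_gt0.
have h2 := cv _ ti; apply: filterS2 h1 h2 => n.
rewrite sub0r normrN gtr0_norm // => h1.
rewrite ltf_pV2 ?posrE // => h2; rewrite !ltW //.
Qed.

End ComplexIntegral.

Arguments CintegralZ {R D f} z _ _.
Arguments CintegrableZ {R D f} z _ _.
Arguments RintegrableZ {R D f} k _ _.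

(** * Power series and the identity theorem along a segment *)

Section PowerSeries.
Variable R : realType.
Local Notation C := R[i].
Local Notation Re := (@complex.Re R).
Local Notation Im := (@complex.Im R).
Implicit Types (z w l u b : C) (x y r t q : R) (n k N : nat).

Lemma Ccvg_ext (v v' : nat -> C) l l' : (forall n, v n = v' n) -> l = l' ->
  (v : nat -> R[i]^o) @ \oo --> (l : R[i]^o) ->
  (v' : nat -> R[i]^o) @ \oo --> (l' : R[i]^o).
Proof. by move=> /funext -> ->. Qed.

Lemma Ccvg_cst z : ((fun=> z) : nat -> R[i]^o) @ \oo --> (z : R[i]^o).
Proof. exact: cvg_cst. Qed.
Arguments Ccvg_cst z : clear implicits.

Lemma pochhammerS b n : pochhammer b n.+1 = pochhammer b n * (b + n%:R).
Proof. by rewrite /pochhammer big_ord_recr. Qed.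

Lemma pochhammer0 b : pochhammer b 0 = 1.
Proof. by rewrite /pochhammer big_ord0. Qed.

Lemma pochhammerSl b n : pochhammer b n.+1 = b * pochhammer (b + 1) n.
Proof.
rewrite /pochhammer big_ord_recl /= addr0; congr (_ * _); apply: eq_bigr => i _.
by rewrite /bump /= natrD addrA.
Qed.

(** The coefficient of w ^ n in (1 - w) ^ (- b). *)
Definition binc b n : C := pochhammer b n / n`!%:R.

Lemma factC_neq0 n : (n`!%:R : C) != 0.
Proof. by rewrite pnatr_eq0 -lt0n fact_gt0. Qed.

Lemma natC_neq0 n : (n.+1%:R : C) != 0. Proof. by rewrite pnatr_eq0. Qed.

Lemma binc0 b : binc b 0 = 1. Proof. by rewrite /binc pochhammer0 fact0 divr1. Qed.

Lemma bincS b n : n.+1%:R * binc b n.+1 = (b + n%:R) * binc b n.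
Proof.
rewrite /binc pochhammerS factS natrM.
move: (n.+1%:R : C) (natC_neq0 n) (n`!%:R : C) (factC_neq0 n) => x x0 y y0.
by field; rewrite x0 y0.
Qed.

Lemma bincS1 b n : n.+1%:R * binc b n.+1 = b * binc (b + 1) n.
Proof.
rewrite /binc pochhammerSl factS natrM.
move: (n.+1%:R : C) (natC_neq0 n) (n`!%:R : C) (factC_neq0 n) => x x0 y y0.
by field; rewrite x0 y0.
Qed.

(** The ratio of consecutive terms tends to q < 1, so the terms decrease from
    some rank on. *)
Lemma binc_bound b q : 0 <= q < 1 -> exists M, forall n, Cabs (binc b n) * q ^+ n <= M.
Proof.
move=> /andP[q0 q1]; pose v n := Cabs (binc b n) * q ^+ n.
have v0 n : 0 <= v n by rewrite mulr_ge0 ?Cabs_ge0 ?exprn_ge0.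
have q1' : 0 < 1 - q by rewrite subr_gt0.
pose N := Num.truncn (Cabs b / (1 - q)).
have hN n : (N < n)%N -> Cabs b <= n%:R * (1 - q).
  move=> Nn; rewrite -ler_pdivrMr //.
  have := truncnS_gt (Cabs b / (1 - q)) => h; apply: ltW; apply: lt_le_trans h _.
  by rewrite ler_nat.
have dec n : (N < n)%N -> v n.+1 <= v n.
  move=> Nn; have := hN n Nn => hb.
  have n0 : 0 < n.+1%:R :> R by rewrite ltr0n.
  rewrite -(ler_pM2l n0).
  have -> : n.+1%:R * v n.+1 = Cabs (b + n%:R) * q * v n.
    rewrite /v exprS mulrA -[n.+1%:R](Cabs_nat R) -CabsM bincS CabsM; ring.
  apply: ler_wpM2r => //.
  apply: (@le_trans _ _ ((Cabs b + n%:R) * q)).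
    by rewrite ler_wpM2r // (le_trans (CabsD _ _)) // Cabs_nat.
  rewrite -[n.+1%:R]natr1.
  have n0' : 0 <= n%:R :> R by [].
  have b0 := Cabs_ge0 b; nra.
exists (\sum_(i < N.+2) v i) => n; rewrite -/(v n).
elim: n => [|n IH]; first by rewrite (bigD1 ord0) //= lerDl sumr_ge0.
have [h|h] := ltnP n N.+1.
  by rewrite (bigD1 (Ordinal (h : (n.+1 < N.+2)%N))) //= lerDl sumr_ge0.
by apply: le_trans IH; apply: dec.
Qed.

Lemma geometric_sum_le q n : 0 <= q < 1 -> \sum_(0 <= i < n) q ^+ i <= (1 - q)^-1.
Proof.
move=> /andP[q0 q1]; have q1' : 0 < 1 - q by rewrite subr_gt0.
rewrite -(ler_pM2l q1') divff ?lt0r_neq0 //.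
have -> : (1 - q) * \sum_(0 <= i < n) q ^+ i = 1 - q ^+ n.
  elim: n => [|n IH]; first by rewrite big_nil mulr0 expr0 subrr.
  by rewrite big_nat_recr //= mulrDr IH exprS; ring.
by rewrite lerBlDr lerDl exprn_ge0.
Qed.

(** The power is monotone in its base, in a direction given by the sign of p. *)
Lemma powR_between (m x M p : R) : 0 < m -> m <= x <= M -> x `^ p <= m `^ p + M `^ p.
Proof.
move=> m0 /andP[mx xM]; have x0 : 0 < x by exact: lt_le_trans mx.
have M0 : 0 < M by exact: lt_le_trans xM.
have [p0|p0] := leP 0 p.
  apply: (@le_trans _ _ (M `^ p)); last by rewrite lerDr powR_ge0.
  by apply: ge0_ler_powR; rewrite // nnegrE ltW.
apply: (@le_trans _ _ (m `^ p)); last by rewrite lerDl powR_ge0.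
rewrite /powR !gt_eqF // ler_expR ler_nM2l //.
by rewrite ler_ln ?posrE.
Qed.

Lemma Cseries_cvg_ext (u v : nat -> C) l : (forall n, u n = v n) ->
  Cseries_cvg u l -> Cseries_cvg v l.
Proof. by move=> /funext ->. Qed.

Lemma Cseries_cvgZ (v : nat -> C) l z : Cseries_cvg v l ->
  Cseries_cvg (fun n => z * v n) (z * l).
Proof.
rewrite /Cseries_cvg /series => /(Ccvg_Z z).
by under [X in X @ _]eq_fun do rewrite mulr_sumr.
Qed.

Lemma Cseries_cvgB (v v' : nat -> C) l l' : Cseries_cvg v l -> Cseries_cvg v' l' ->
  Cseries_cvg (fun n => v n - v' n) (l - l').
Proof.
rewrite /Cseries_cvg /series => h1 /(Ccvg_Z (-1)) h2.
have := Ccvg_D h1 h2; rewrite mulN1r.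
under [X in X @ _]eq_fun do rewrite mulN1r -sumrB.
by [].
Qed.

(** ** The binomial series *)

(** (1 - w) ^ (- b) solves (1 - w) S' = b S; its truncated series solves this
    equation up to one term of highest order. *)
Lemma binc_ode b w N :
  (1 - w) * \sum_(0 <= n < N) (n%:R * binc b n * w ^+ n.-1)
    - b * \sum_(0 <= n < N) binc b n * w ^+ n = - (N%:R * binc b N * w ^+ N.-1).
Proof.
elim: N => [|N IH]; first by rewrite !big_nil !mul0r !mulr0 subrr oppr0.
rewrite !big_nat_recr //= !mulrDr.
have -> : forall X Y A B : C, A + X - (B + Y) = (A - B) + (X - Y).
  by move=> *; ring.
rewrite IH bincS; case: N {IH} => [|N]; first by rewrite /= expr0; ring.
by rewrite /= exprS; ring.
Qed.

Lemma Re_1subM_gt0 u t : Cabs u < 1 -> 0 <= t <= 1 -> 0 < Re (1 - t%:C * u).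
Proof.
move=> u1 /andP[t0 t1]; rewrite ReD ReN Re_1.
have := Re_le_Cabs (t%:C * u); rewrite CabsM Cabs_real (ger0_norm t0) ler_norml.
move=> /andP[_ h].
have : t * Cabs u <= 1 * Cabs u by rewrite ler_wpM2r ?Cabs_ge0.
lra.
Qed.

(** Let S_N be the truncated series. The product (1 - t u) ^ b * S_N (t u) is 1
    at t = 0, and by [binc_ode] its derivative in t is a single, geometrically
    small term; the mean value inequality gives the value at t = 1. *)
Lemma binomial_series b u : Cabs u < 1 ->
  Cseries_cvg (fun n => binc b n * u ^+ n) (Cpow (1 - u) (- b)).
Proof.
move=> u1; have u0 := Cabs_ge0 u.
(* between |u| and 1: the coefficients are controlled on the circle of radius q,
   and |u| / q < 1 is the ratio of the estimate *)
pose q := (1 + Cabs u) / 2.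
have q01 : 0 <= q < 1 by rewrite /q; lra.
have q0 : 0 < q by rewrite /q; lra.
have uq : Cabs u / q < 1 by rewrite ltr_pdivrMr // /q; lra.
have [M hM] := binc_bound (b + 1) q01.
pose S N t : C := \sum_(0 <= n < N) binc b n * (t%:C * u) ^+ n.
pose g N t := Cpow (1 - t%:C * u) b * S N t.
pose dg N t := - (N%:R * binc b N * (t%:C * u) ^+ N.-1) * u
               * (Cpow (1 - t%:C * u) b / (1 - t%:C * u)).
have nz t : 0 <= t <= 1 -> 1 - t%:C * u != 0.
  by move=> ht; apply: Re_gt0_neq0; exact: Re_1subM_gt0.
have hd N t : 0 <= t <= 1 -> is_Cder (g N) t (dg N t).
  move=> ht; have nzt := nz t ht.
  have dl : is_Cder (fun s => s%:C * u) t u.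
    have := is_Cder_lin 0 u t; apply: is_Cder_ext => s; by rewrite add0r.
  have d1 : is_Cder (fun s => 1 - s%:C * u) t (- u).
    by apply: is_Cder_eq (is_CderB (is_Cder_cst 1 t) dl) _; rewrite sub0r.
  have d2 := is_Cder_Cpow b d1 (log_plane_Re (Re_1subM_gt0 u1 ht)).
  have d3 := is_Cder_sum (index_iota 0 N) xpredT
    (fun n => is_CderZ (binc b n) (is_CderX n dl)).
  apply: is_Cder_eq (is_CderM d2 d3) _.
  rewrite /dg -binc_ode -/(S N t) mulrBl mulrBl -/(S N t).
  have -> : \sum_(i <- index_iota 0 N) binc b i * (i%:R * (t%:C * u) ^+ i.-1 * u) =
     u * \sum_(0 <= n < N) (n%:R * binc b n * (t%:C * u) ^+ n.-1).
    by rewrite mulr_sumr; apply: eq_bigr => i _; ring.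
  by field.
pose m := 1 - Cabs u; have m0 : 0 < m by rewrite subr_gt0.
pose K := expR (`|Im b| * pi) * (m `^ Re b + 2 `^ Re b) / m.
have hK t : 0 <= t <= 1 -> Cabs (Cpow (1 - t%:C * u) b / (1 - t%:C * u)) <= K.
  move=> ht; have nzt := nz t ht; case/andP: (ht) => t0 t1.
  have tu : Cabs (t%:C * u) <= Cabs u.
    by rewrite CabsM Cabs_real ger0_norm // ler_piMl.
  have b1 : m <= Cabs (1 - t%:C * u).
    by have := CabsB_ge 1 (t%:C * u); rewrite Cabs1 /m; lra.
  have b2 : Cabs (1 - t%:C * u) <= 2.
    by have := CabsD 1 (- (t%:C * u)); rewrite CabsN Cabs1; lra.
  rewrite CabsM CabsV /K; apply: ler_pM; rewrite ?invr_ge0 ?Cabs_ge0 //.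
    apply: le_trans (Cabs_Cpow_le _ nzt) _; rewrite ler_wpM2l ?expR_ge0 //.
    by apply: powR_between => //; rewrite b1.
  by rewrite lef_pV2 ?posrE // Cabs_gt0.
have K0 : 0 <= K by rewrite !mulr_ge0 ?expR_ge0 ?addr_ge0 ?powR_ge0 ?invr_ge0 // ltW.
pose A := 2 * (Cabs b * M * Cabs u * K).
have bnd N : Cabs (Cpow (1 - u) b * S N.+1 1 - 1) <= A * (Cabs u / q) ^+ N.
  have e1 : g N.+1 1 = Cpow (1 - u) b * S N.+1 1.
    by rewrite /g /= mul1r.
  have e0 : g N.+1 0 = 1.
    rewrite /g /= mul0r subr0 Cpow_base1 mul1r /S big_nat_recl //= mul0r expr0.
    rewrite binc0 mulr1 big1 ?addr0 // => i _.
    by rewrite expr0n /= mulr0.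
  rewrite -e1 -[X in _ - X]e0.
  have -> : A * (Cabs u / q) ^+ N = 2 * (Cabs b * M * Cabs u * K * (Cabs u / q) ^+ N) * (1 - 0).
    by rewrite /A; ring.
  apply: (@Cder_mean_value _ _ (dg N.+1)) => // t ht; first exact: hd.
  case/andP: (ht) => t0 t1.
  have hKt := hK t ht; rewrite /dg bincS1.
  move: (Cpow (1 - t%:C * u) b / (1 - t%:C * u)) hKt => Q hQ.
  rewrite CabsM [X in X <= _]mulrC CabsM CabsN CabsM CabsM CabsX /=.
  have tu : Cabs (t%:C * u) <= Cabs u.
    by rewrite CabsM Cabs_real ger0_norm // ler_piMl.
  have tuN : Cabs (t%:C * u) ^+ N <= Cabs u ^+ N by rewrite lerXn2r ?nnegrE ?Cabs_ge0.
  have e : (Cabs u / q) ^+ N * q ^+ N = Cabs u ^+ N.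
    by rewrite -exprMn divfK // lt0r_neq0.
  have h1 : Cabs (binc (b + 1) N) * Cabs u ^+ N <= M * (Cabs u / q) ^+ N.
    rewrite -e mulrCA [M * _]mulrC ler_wpM2l ?hM // exprn_ge0 // divr_ge0 // ltW //.
  have h2 : Cabs (binc (b + 1) N) * Cabs (t%:C * u) ^+ N <= M * (Cabs u / q) ^+ N.
    by apply: le_trans h1; rewrite ler_wpM2l ?Cabs_ge0.
  have -> : Cabs b * M * Cabs u * K * (Cabs u / q) ^+ N =
     K * (Cabs b * (M * (Cabs u / q) ^+ N) * Cabs u) by ring.
  apply: ler_pM; rewrite ?Cabs_ge0 ?mulr_ge0 ?Cabs_ge0 ?exprn_ge0 ?Cabs_ge0 //.
  by rewrite ler_wpM2r // -mulrA ler_wpM2l ?Cabs_ge0.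
have cv : (fun N => A * (Cabs u / q) ^+ N) @ \oo --> (0 : R).
  rewrite -(mulr0 A); apply: cvgM; first exact: cvg_cst.
  by apply: cvg_expr; rewrite ger0_norm // divr_ge0 // ltW.
have n1 : 1 - u != 0 by rewrite -[u]mul1r; apply: (nz 1); rewrite ler01 lexx.
have cS : ((fun N => S N.+1 1) : nat -> R[i]^o) @ \oo --> (Cpow (1 - u) (- b) : R[i]^o).
  have cB : ((fun N => Cpow (1 - u) b * S N.+1 1) : nat -> R[i]^o) @ \oo --> (1 : R[i]^o).
    by apply: Ccvg_le cv; apply: nearW => N; exact: bnd.
  have := Ccvg_Z (Cpow (1 - u) (- b)) cB; rewrite mulr1.
  under [X in X @ _]eq_fun do rewrite mulrA -CpowD // addNr Cpow0 mul1r.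
  by [].
rewrite /Cseries_cvg -(cvg_shiftS (series _)) /series.
by move: cS; rewrite /S; under [X in X @ _]eq_fun do under eq_bigr do rewrite mul1r.
Qed.

(** ** Zeros of power series *)

Lemma Cseries_terms_bounded (v : nat -> C) l : Cseries_cvg v l ->
  exists M, forall n, Cabs (v n) <= M.
Proof.
move=> h; have /Ccvg_Cabs c : ((series v : nat -> C) : nat -> R[i]^o) @ \oo --> (l : R[i]^o) by exact: h.
have [M0 hM0] : exists M, forall n, Cabs (series v n - l) <= M.
  move/cvgrPdist_lt : c => /(_ 1 ltr01)[N _ hN].
  exists (1 + \sum_(i < N) Cabs (series v i - l)) => n.
  have [Nn|nN] := leqP N n.
    have := hN n Nn; rewrite sub0r normrN ger0_norm ?Cabs_ge0 // => /ltW h1.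
    by apply: le_trans h1 _; rewrite lerDl sumr_ge0 // => i _; exact: Cabs_ge0.
  rewrite (bigD1 (Ordinal nN)) //= addrCA lerDl addr_ge0 // sumr_ge0 // => i _.
  exact: Cabs_ge0.
exists (M0 + M0) => n.
have -> : v n = (series v n.+1 - l) - (series v n - l).
  by rewrite /series /= big_nat_recr //=; ring.
by apply: le_trans (CabsD _ _) _; rewrite CabsN lerD.
Qed.

Lemma Ccvg_Cabs_le (v : nat -> C) l (B : R) :
  (v : nat -> R[i]^o) @ \oo --> (l : R[i]^o) ->
  (\forall n \near \oo, Cabs (v n) <= B) -> Cabs l <= B.
Proof.
move=> /Ccvg_Cabs/cvgrPdist_lt h hB; rewrite leNgt; apply/negP => Bl.
have e0 : 0 < Cabs l - B by rewrite subr_gt0.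
have [n [h1 h2]] := filter_ex (filterI (h _ e0) hB).
move: h1; rewrite sub0r normrN ger0_norm ?Cabs_ge0 // CabsB => h1.
have := CabsD (l - v n) (v n); rewrite subrK; lra.
Qed.

(** Once the lower coefficients vanish, d n * z ^ n is minus the tail of the
    series at a zero z of h; hence |d n| <= B |z| for arbitrarily small z. *)
Lemma power_series_zeros (d : nat -> C) (h : C -> C) r : 0 < r ->
  (forall z, Cabs z < r -> Cseries_cvg (fun n => d n * z ^+ n) (h z)) ->
  (forall e, 0 < e -> exists z, [/\ z != 0, Cabs z < e & h z = 0]) ->
  forall n, d n = 0.
Proof.
move=> r0 hs hz; elim/ltn_ind => n IH.
pose p := r / 2; have p0 : 0 < p by rewrite /p; lra.
have pr : Cabs (p%:C : C) < r by rewrite Cabs_real gtr0_norm // /p; lra.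
have [M hM] := Cseries_terms_bounded (hs _ pr).
have {}hM k : Cabs (d k) * p ^+ k <= M.
  by have := hM k; rewrite CabsM CabsX Cabs_real gtr0_norm.
have M0 : 0 <= M by apply: le_trans (hM 0%N); rewrite mulr_ge0 ?Cabs_ge0.
pose B := M / p ^+ n.+1 * 2.
have key z : z != 0 -> Cabs z < p / 2 -> h z = 0 -> Cabs (d n) <= Cabs z * B.
  move=> z0 zp hz0; have za : 0 < Cabs z by rewrite Cabs_gt0.
  have zr : Cabs z < r by rewrite /p in zp; lra.
  pose v k := d k * z ^+ k.
  have cv : ((fun N => d n * z ^+ n - series v N) : nat -> R[i]^o) @ \oo
     --> (d n * z ^+ n : R[i]^o).
    apply: Ccvg_ext _ _ (Ccvg_D (Ccvg_cst (d n * z ^+ n)) (Ccvg_Z (-1) (hs z zr))).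
      by move=> N; rewrite mulN1r.
    by rewrite hz0 mulr0 addr0.
  have bnd m : Cabs (d n * z ^+ n - series v (n.+1 + m)%N) <=
      Cabs z ^+ n.+1 * (M / p ^+ n.+1) * \sum_(0 <= j < m) 2^-1 ^+ j.
    elim: m => [|m IHm].
      have vz : \sum_(0 <= k < n) v k = 0.
        rewrite big_nat_cond big1 // => i /andP[/andP[_ i_n] _].
        by rewrite /v IH // mul0r.
      by rewrite addn0 /series /= big_nat_recr //= vz add0r subrr Cabs0 big_nil mulr0.
    rewrite addnS /series /= big_nat_recr //= [X in _ <= _ * X]big_nat_recr //= mulrDr opprD addrA.
    apply: le_trans (CabsD _ _) _; apply: lerD; first exact: IHm.
    rewrite CabsN /v CabsM CabsX exprD.
    have e : Cabs z ^+ m <= p ^+ m * 2^-1 ^+ m.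
      by rewrite -exprMn lerXn2r ?nnegrE ?Cabs_ge0 // ?ltW // divr_gt0.
    have -> : Cabs z ^+ n.+1 * (M / p ^+ n.+1) * 2^-1 ^+ m =
        M / p ^+ (n.+1 + m)%N * (Cabs z ^+ n.+1 * (p ^+ m * 2^-1 ^+ m)).
      by rewrite exprD; field; rewrite !expf_neq0 // lt0r_neq0.
    apply: ler_pM; rewrite ?mulr_ge0 ?exprn_ge0 ?Cabs_ge0 //.
      by rewrite ler_pdivlMr ?exprn_gt0.
    by rewrite ler_wpM2l ?exprn_ge0 ?Cabs_ge0.
  have : Cabs (d n * z ^+ n) <= Cabs z ^+ n.+1 * B.
    apply: Ccvg_Cabs_le cv _; exists n.+1 => // N /= nN.
    rewrite -(subnKC nN); apply: le_trans (bnd _) _.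
    rewrite /B [X in _ <= X]mulrA; apply: ler_wpM2l.
      by rewrite mulr_ge0 ?exprn_ge0 ?Cabs_ge0 // divr_ge0 // exprn_ge0 // ltW.
    have h2 : 0 <= (2^-1 : R) < 1 by lra.
    have e2 : (1 - 2^-1 : R)^-1 = 2 by field.
    by apply: le_trans (@geometric_sum_le _ _ h2) _; rewrite e2.
  rewrite CabsM CabsX exprS mulrC -mulrA [X in _ <= X]mulrC -[X in _ <= X]mulrA.
  by rewrite ler_pM2l ?exprn_gt0 // mulrC.
apply/eqP; rewrite -Cabs_eq0 eq_le Cabs_ge0 andbT; apply/ler_addgt0Pl => e e0.
have B0 : 0 <= B by rewrite /B mulr_ge0 // divr_ge0 // exprn_ge0 // ltW.
have B1 : 0 < B + 1 by lra.
have e1 : 0 < Num.min (p / 2) (e / (B + 1)) by rewrite lt_min !divr_gt0.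
have [z [z0 + hz0]] := hz _ e1; rewrite lt_min => /andP[z1 z2].
apply: le_trans (key z z0 z1 hz0) _; rewrite addr0.
move: z2; rewrite ltr_pdivlMr //; have := Cabs_ge0 z; nra.
Qed.

(** ** Identity theorem *)

(** The difference of the two power series has zeros accumulating at z0. *)
Lemma analytic_agree (D : set C) (f g : C -> C) z0 : D z0 ->
  analytic_on D f -> analytic_on D g ->
  (forall e, 0 < e -> exists z, [/\ z != z0, Cabs (z - z0) < e & f z = g z]) ->
  exists2 r, 0 < r & forall z, Cabs (z - z0) < r -> f z = g z.
Proof.
move=> D0 /(_ _ D0)[r1 [u1 [r10 h1]]] /(_ _ D0)[r2 [u2 [r20 h2]]] acc.
pose r := Num.min r1 r2; have r0 : 0 < r by rewrite lt_min r10.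
have hs z : Cabs z < r -> Cseries_cvg (fun n => (u1 n - u2 n) * z ^+ n) (f (z0 + z) - g (z0 + z)).
  rewrite lt_min => /andP[zr1 zr2].
  have e : z0 + z - z0 = z by rewrite addrC addKr.
  have := Cseries_cvgB (h1 (z0 + z) _) (h2 (z0 + z) _); rewrite e => /(_ zr1 zr2).
  by apply: Cseries_cvg_ext => n; rewrite mulrBl.
have d0 := power_series_zeros r0 hs.
have eK w : z0 + (w - z0) = w by rewrite addrC subrK.
exists r => // z zr.
have := hs _ zr; rewrite eK => hz; apply/eqP; rewrite -subr_eq0; apply/eqP.
apply: (Ccvg_unique hz); rewrite (_ : series _ = fun=> 0); first exact: cvg_cst.
apply/funext => N; rewrite /series /= big1 // => i _; rewrite d0 ?mul0r //.
move=> e e0; have [w [w0 we wE]] := acc e e0.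
exists (w - z0); rewrite subr_eq0 w0 we eK wE subrr; split=> //.
Qed.

(** The parameters up to which f = g near the segment form an interval which is
    closed by [analytic_agree] and open because agreement holds on discs.
    Following a segment makes connectedness arguments in D unnecessary. *)
Lemma analytic_segment (D : set C) (f g : C -> C) z0 v :
  analytic_on D f -> analytic_on D g -> v != 0 ->
  (forall s, 0 <= s <= 1 -> D (z0 + s%:C * v)) ->
  (forall e, 0 < e -> exists z, [/\ z != z0, Cabs (z - z0) < e & f z = g z]) ->
  f (z0 + v) = g (z0 + v).
Proof.
move=> af ag v0 hD acc.
have va : 0 < Cabs v by rewrite Cabs_gt0.
pose c s := z0 + s%:C * v.
have cB s s' : Cabs (c s - c s') = `|s - s'| * Cabs v.
  have -> : c s - c s' = (s - s')%:C * v by rewrite /c rmorphB /=; ring.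
  by rewrite CabsM Cabs_real.
pose P s := exists2 r, 0 < r & forall z, Cabs (z - c s) < r -> f z = g z.
have P0 : P 0.
  have c0 : c 0 = z0 by rewrite /c mul0r addr0.
  rewrite /P c0; apply: (analytic_agree (D := D)) => //.
  by rewrite -c0; apply: hD; rewrite lexx ler01.
pose A := [set s | 0 <= s <= 1 /\ forall s', 0 <= s' <= s -> P s'].
have A0 : A 0.
  split=> [|s' /andP[h1 h2]]; first by rewrite lexx ler01.
  by have -> : s' = 0 by apply/eqP; rewrite eq_le h1 h2.
have ubA : ubound A 1 by move=> s [/andP[]].
have sA : has_sup A by split; [exists 0|exists 1].
pose m := sup A.
have m0 : 0 <= m by apply: ub_le_sup => //; exists 1.
have m1 : m <= 1 by apply: ge_sup => //; exists 0.
have Plt s : 0 <= s < m -> P s.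
  move=> /andP[s0 sm]; have e0 : 0 < m - s by rewrite subr_gt0.
  have [y [_ Ay] ys] := sup_adherent e0 sA; apply: Ay; rewrite s0 /=.
  by move: ys; rewrite -/m; lra.
have Pm : P m.
  have [m00|mn0] := eqVneq m 0; first by rewrite m00.
  have {}m0 : 0 < m by rewrite lt_def mn0.
  apply: (analytic_agree (D := D)) => //; first by apply: hD; rewrite (ltW m0).
  move=> e e0; pose s := m - Num.min m (e / Cabs v) / 2.
  have mn : 0 < Num.min m (e / Cabs v) by rewrite lt_min m0 divr_gt0.
  have mnm : Num.min m (e / Cabs v) <= m by rewrite ge_min lexx.
  have mne : Num.min m (e / Cabs v) <= e / Cabs v by rewrite ge_min lexx orbT.
  have sm : 0 <= s < m by rewrite /s; lra.
  have [r r0 hr] := Plt s sm.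
  exists (c s); split.
  - rewrite -subr_eq0 -Cabs_gt0 cB mulr_gt0 // normr_gt0 subr_eq0 lt_eqF //.
    by case/andP: sm.
  - rewrite cB distrC ger0_norm; last by rewrite /s; lra.
    by rewrite -ltr_pdivlMr // /s; lra.
  - by apply: hr; rewrite subrr Cabs0.
have [r r0 hr] := Pm.
have near s : `|s - m| < r / Cabs v -> P s.
  rewrite ltr_pdivlMr // -cB => hs; exists (r - Cabs (c s - c m)); first by rewrite subr_gt0.
  move=> z hz; apply: hr.
  have -> : z - c m = (z - c s) + (c s - c m) by ring.
  by apply: le_lt_trans (CabsD _ _) _; lra.
have [m1'|m1'] := eqVneq m 1.
  have [r' r0' hr'] := Pm; have -> : z0 + v = c m by rewrite m1' /c mul1r.
  by apply: hr'; rewrite subrr Cabs0.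
have {}m1 : m < 1 by rewrite lt_neqAle m1'.
pose d := Num.min (1 - m) (r / Cabs v) / 2.
have dm : 0 < Num.min (1 - m) (r / Cabs v) by rewrite lt_min subr_gt0 m1 divr_gt0.
have d1 : Num.min (1 - m) (r / Cabs v) <= 1 - m by rewrite ge_min lexx.
have d2 : Num.min (1 - m) (r / Cabs v) <= r / Cabs v by rewrite ge_min lexx orbT.
have Amd : A (m + d).
  split=> [|s' /andP[s1 s2]]; first by rewrite /d; lra.
  have [sm|sm] := ltP s' m; first by apply: Plt; rewrite s1.
  by apply: near; rewrite ger0_norm ?subr_ge0 //; rewrite /d in s2; lra.
have : m + d <= m by apply: ub_le_sup => //; exists 1.
by rewrite gerDl leNgt divr_gt0.
Qed.

End PowerSeries.

Arguments Ccvg_cst {R} z.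
Arguments Cseries_cvgZ {R v l} z _.
Arguments binomial_series {R} b {u} _.
Arguments binc_bound {R} b {q} _.
Arguments geometric_sum_le {R q} n _.

(** * Analytic powers, products and parameter integrals *)

Section Analytic.
Variable R : realType.
Local Notation C := R[i].
Local Notation Re := (@complex.Re R).
Local Notation Im := (@complex.Im R).
Implicit Types (z w l b : C) (x y t q : R) (n k N : nat) (D : set C).

Lemma Cpow_add_near z h w : log_plane z -> Cabs h < cut_dist z ->
  Cpow (z + h) w = Cpow z w * Cpow (1 + h / z) w.
Proof.
move=> hz hh; have [e p0] := Clog_near hz hh; have z0 := log_plane_neq0 hz.
have e1 : z * (1 + h / z) = z + h by field.
by rewrite -e1; apply: Cpow_mul => //; [exact: Re_gt0_neq0 | rewrite e1].
Qed.

(** z + h = z * (1 + h / z) without crossing the cut, followed by the binomial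
    series. *)
Lemma Cpow_taylor z h w : log_plane z -> Cabs h < cut_dist z ->
  Cseries_cvg (fun n => Cpow z w * binc (- w) n * (- z^-1) ^+ n * h ^+ n) (Cpow (z + h) w).
Proof.
move=> hz hh; rewrite Cpow_add_near //; have z0 := log_plane_neq0 hz.
have u1 : Cabs (- (h / z)) < 1.
  rewrite CabsN CabsM CabsV ltr_pdivrMr ?Cabs_gt0 // mul1r.
  exact: lt_le_trans (cut_dist_le z).
have := Cseries_cvgZ (Cpow z w) (binomial_series (- w) u1).
rewrite !opprK; apply: Cseries_cvg_ext => n.
have -> : - (h / z) = - z^-1 * h by rewrite mulNr mulrC.
by rewrite exprMn; ring.
Qed.

Lemma analytic_Cpow w : analytic_on (@log_plane R) (fun z => Cpow z w).
Proof.
move=> z0 hz; exists (cut_dist z0), (fun n => Cpow z0 w * binc (- w) n * (- z0^-1) ^+ n).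
split; first exact: cut_dist_gt0.
move=> z hh; have {2}-> : z = z0 + (z - z0) by ring.
exact: Cpow_taylor.
Qed.

(** The Cauchy product. The product of the two partial sums is a product of
    polynomials P N * Q N; it differs from the truncated Cauchy product by its
    coefficients of index at least N, which are geometrically small. *)
Lemma analytic_onM D (f g : C -> C) : analytic_on D f -> analytic_on D g ->
  analytic_on D (fun z => f z * g z).
Proof.
move=> af ag z0 Dz; have [r1 [u [r10 h1]]] := af _ Dz; have [r2 [v [r20 h2]]] := ag _ Dz.
pose p := Num.min r1 r2 / 2.
have m0 : 0 < Num.min r1 r2 by rewrite lt_min r10.
have p0 : 0 < p by rewrite /p; lra.
have p1 : p < r1.
  have : Num.min r1 r2 <= r1 by rewrite ge_min lexx.
  by rewrite /p; lra.
have p2 : p < r2.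
  have : Num.min r1 r2 <= r2 by rewrite ge_min lexx orbT.
  by rewrite /p; lra.
have bnd (uu : nat -> C) (ff : C -> C) rr : p < rr -> (forall z, Cabs (z - z0) < rr ->
    Cseries_cvg (fun n => uu n * (z - z0) ^+ n) (ff z)) ->
    exists M, forall n, Cabs (uu n) * p ^+ n <= M.
  move=> prr hh; have := hh (z0 + p%:C); rewrite [z0 + _ - z0]addrC addKr.
  rewrite Cabs_real gtr0_norm // => /(_ prr)/Cseries_terms_bounded[M hM].
  by exists M => n; have := hM n; rewrite CabsM CabsX Cabs_real gtr0_norm.
have [M hM] := bnd _ _ _ p1 h1; have [M' hM'] := bnd _ _ _ p2 h2.
have M0 : 0 <= M by apply: le_trans (hM 0%N); rewrite mulr_ge0 ?Cabs_ge0.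
have M0' : 0 <= M' by apply: le_trans (hM' 0%N); rewrite mulr_ge0 ?Cabs_ge0.
(* the n-th Cauchy coefficient has n + 1 <= 2 ^ n terms, and 2 ^ n / 4 ^ n is
   still geometric *)
exists (p / 4), (fun n => \sum_(i < n.+1) u i * v (n - i)%N); split; first lra.
move=> z; set w := z - z0 => wp.
pose a i := u i * w ^+ i; pose b i := v i * w ^+ i.
have small (uu : nat -> C) K : (forall n, Cabs (uu n) * p ^+ n <= K) ->
    forall n, Cabs (uu n * w ^+ n) <= K * 4^-1 ^+ n.
  move=> hK n; rewrite CabsM CabsX.
  have e : Cabs w ^+ n <= p ^+ n * 4^-1 ^+ n.
    by rewrite -exprMn lerXn2r ?nnegrE ?Cabs_ge0 ?ltW // divr_gt0.
  apply: (@le_trans _ _ (Cabs (uu n) * (p ^+ n * 4^-1 ^+ n))).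
    by rewrite ler_wpM2l ?Cabs_ge0.
  by rewrite mulrA ler_wpM2r ?exprn_ge0.
have ha := small _ _ hM; have hb := small _ _ hM'.
have cS : ((fun N => series a N * series b N) : nat -> R[i]^o) @ \oo --> (f z * g z : R[i]^o).
  by apply: Ccvg_M; [apply: h1|apply: h2]; rewrite -/w; lra.
pose c n := \sum_(i < n.+1) a i * b (n - i)%N.
have cE n : (\sum_(i < n.+1) u i * v (n - i)%N) * w ^+ n = c n.
  rewrite mulr_suml; apply: eq_bigr => i _.
  have e : w ^+ n = w ^+ i * w ^+ (n - i) by rewrite -exprD subnKC // -ltnS.
  by rewrite e /a /b; ring.
apply: (Cseries_cvg_ext (fun n => esym (cE n))).
pose P N := \poly_(i < N) a i; pose Q N := \poly_(i < N) b i.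
have PQ N : series a N * series b N = series c N + \sum_(0 <= m < N) (P N * Q N)`_(N + m).
  have eh (s : nat -> C) : (\poly_(i < N) s i).[1] = series s N.
    by rewrite horner_poly /series /= big_mkord; apply: eq_bigr => i _; rewrite expr1n mulr1.
  rewrite -(eh a) -(eh b) -hornerM -/(P N) -/(Q N).
  have sz : (size (P N * Q N)%R <= N + N)%N.
    apply: leq_trans (size_polyMleq _ _) _; apply: leq_trans (leq_pred _) _.
    by apply: leq_add; exact: size_poly.
  rewrite (horner_coef_wide _ sz) big_split_ord /=; congr (_ + _).
    rewrite /series /= big_mkord; apply: eq_bigr => n _; rewrite expr1n mulr1 coefM.
    apply: eq_bigr => i _; rewrite !coef_poly.
    have iN : (i < N)%N by apply: leq_ltn_trans (ltn_ord n); rewrite -ltnS.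
    by rewrite iN (leq_ltn_trans (leq_subr _ _) (ltn_ord n)).
  by rewrite big_mkord; apply: eq_bigr => i _; rewrite expr1n mulr1.
have cf N n : Cabs (P N * Q N)`_n <= M * M' * 2^-1 ^+ n.
  rewrite coefM; apply: le_trans (Cabs_sum _ _ _) _.
  apply: (@le_trans _ _ (\sum_(i < n.+1) M * M' * 4^-1 ^+ n)).
    apply: ler_sum => i _; rewrite !coef_poly CabsM.
    have -> : M * M' * 4^-1 ^+ n = (M * 4^-1 ^+ i) * (M' * 4^-1 ^+ (n - i)).
      have e : 4^-1 ^+ n = 4^-1 ^+ i * 4^-1 ^+ (n - i) :> R.
        by rewrite -exprD subnKC // -ltnS.
      by rewrite e; ring.
    apply: ler_pM; rewrite ?Cabs_ge0 //; case: ifP => _;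
      first [exact: ha | exact: hb | by rewrite Cabs0 mulr_ge0 ?exprn_ge0].
  rewrite sumr_const card_ord -[X in X <= _]mulr_natr -mulrA ler_wpM2l ?mulr_ge0 //.
  have -> : 4^-1 = 2^-1 * 2^-1 :> R by field.
  rewrite exprMn -mulrA ler_piMr ?exprn_ge0 // exprVn mulrC ler_pdivrMr ?exprn_gt0 //.
  by rewrite mul1r -natrX ler_nat ltn_expl.
have tail N : Cabs (\sum_(0 <= m < N) (P N * Q N)`_(N + m)) <= M * M' * 2 * 2^-1 ^+ N.
  apply: le_trans (Cabs_sum _ _ _) _.
  apply: (@le_trans _ _ (\sum_(0 <= m < N) M * M' * 2^-1 ^+ N * 2^-1 ^+ m)).
    by apply: ler_sum => m _; rewrite -mulrA -exprD cf.
  rewrite -mulr_sumr -[M * M' * 2 * _]mulrA [2 * _]mulrC mulrA.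
  rewrite ler_wpM2l ?mulr_ge0 ?exprn_ge0 //.
  have h2' : 0 <= (2^-1 : R) < 1 by lra.
  have e2 : (1 - 2^-1 : R)^-1 = 2 by field.
  by apply: le_trans (geometric_sum_le _ h2') _; rewrite e2.
have ct : ((fun N => \sum_(0 <= m < N) (P N * Q N)`_(N + m)) : nat -> R[i]^o) @ \oo
    --> (0 : R[i]^o).
  apply: (@Ccvg_le _ _ _ (fun N => M * M' * 2 * 2^-1 ^+ N)).
    by apply: nearW => N; rewrite subr0; exact: tail.
  rewrite -(mulr0 (M * M' * 2)); apply: cvgM; first exact: cvg_cst.
  by apply: cvg_expr; rewrite ger0_norm //; lra.
apply: Ccvg_ext _ _ (Ccvg_D cS (Ccvg_Z (-1) ct)).
  by move=> N; rewrite PQ mulN1r addrK.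
by rewrite mulr0 addr0.
Qed.

Lemma analytic_cst D z : analytic_on D (fun=> z).
Proof.
move=> z0 _; exists 1, (fun n => if n == 0%N then z else 0); split=> // w _.
rewrite /Cseries_cvg -(cvg_shiftS (series _)).
apply: Ccvg_ext _ _ (Ccvg_cst z) => // N.
rewrite /series /= big_nat_recl //= expr0 mulr1 big1 ?addr0 // => i _.
by rewrite mul0r.
Qed.

(** The Taylor series of the kernel, dominated by an integrable function on a
    common disc, is integrated termwise; halving the radius provides the
    geometric factor. *)
Lemma analytic_integral (T : set R) D (k : C -> R -> C) : measurable T ->
  (forall z0, D z0 -> exists r (c : nat -> R -> C) (M : R -> R),
     [/\ 0 < r, (forall n, Cmeasurable T (c n)), Rintegrable T M,
      (forall n t, T t -> Cabs (c n t) * r ^+ n <= M t) &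
      forall z, Cabs (z - z0) < r -> Cmeasurable T (k z) /\
        forall t, T t -> Cseries_cvg (fun n => c n t * (z - z0) ^+ n) (k z t)]) ->
  analytic_on D (fun z => Cintegral T (k z)).
Proof.
move=> mT H z0 /H[r [c [M [r0 mc iM bM hk]]]].
exists (r / 2), (fun n => Cintegral T (c n)); split; first lra.
move=> z zr; have zr' : Cabs (z - z0) < r by lra.
have [mk ck] := hk z zr'; set w := z - z0 in zr zr' ck *.
have ic n : Cintegrable T (c n).
  apply: (@Cintegrable_le _ _ _ (fun t => (r ^+ n)^-1 * M t)) => //.
    exact: RintegrableZ.
  by move=> t Tt; rewrite mulrC ler_pdivlMr ?exprn_gt0 // bM.
have h2 : 0 <= (2^-1 : R) < 1 by lra.
have e2 : (1 - 2^-1 : R)^-1 = 2 by field.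
have cvI : Cseries_cvg (fun n => Cintegral T (fun t => c n t * w ^+ n)) (Cintegral T (k z)).
  apply: (@Cseries_integral _ T (fun n t => c n t * w ^+ n) _ M (fun n => 2^-1 ^+ n) 2) => //.
  - by move=> n; apply: CmeasurableM => //; exact: Cmeasurable_cst.
  - move=> n t Tt; rewrite CabsM CabsX.
    have e : Cabs w ^+ n <= r ^+ n * 2^-1 ^+ n.
      by rewrite -exprMn lerXn2r ?nnegrE ?Cabs_ge0 ?ltW // divr_gt0.
    apply: (@le_trans _ _ (Cabs (c n t) * (r ^+ n * 2^-1 ^+ n))).
      by rewrite ler_wpM2l ?Cabs_ge0.
    by rewrite mulrA ler_wpM2r ?exprn_ge0 // bM.
  - by move=> t Tt; apply: le_trans (bM 0%N t Tt); rewrite mulr_ge0 ?Cabs_ge0.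
  - by move=> n; apply: le_trans (geometric_sum_le _ h2) _; rewrite e2.
apply: Cseries_cvg_ext cvI => n.
by rewrite mulrC -CintegralZ //; apply: eq_Cintegral => t _; rewrite mulrC.
Qed.

(** The way to compute a value of a continuation: exhibit one analytic extension
    f, and join the point by a segment in D to the closure of D0. *)
Lemma continuation_segment (D0 D : set C) (f0 f : C -> C) z0 v :
  analytic_on D f -> (forall z, D0 z -> f z = f0 z) -> v != 0 ->
  (forall s, 0 <= s <= 1 -> D (z0 + s%:C * v)) ->
  (forall e, 0 < e -> exists z, [/\ D0 z, z != z0 & Cabs (z - z0) < e]) ->
  continuation D0 f0 D (z0 + v) = f (z0 + v).
Proof.
move=> af ef v0 hD acc.
have ex : [set g | analytic_on D g /\ forall z, D0 z -> g z = f0 z] f by [].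
have [ag eg] := xgetPex (fun=> 0 : C) (ex_intro _ f ex).
apply: (analytic_segment ag af v0 hD) => e e0.
by have [z [Dz zz ze]] := acc e e0; exists z; split=> //; rewrite eg // ef.
Qed.

End Analytic.

Arguments Cpow_taylor {R z h} w _ _.
Arguments Cpow_add_near {R z h} w _ _.

(** * Integrable majorants *)

Section Majorants.
Variable R : realType.
Local Notation C := R[i].
Local Notation Re := (@complex.Re R).
Local Notation Im := (@complex.Im R).
Local Notation mu := (@lebesgue_measure R).
Local Notation hl := (`]0, +oo[%classic : set R).
Local Notation ui := (`]0, 1[%classic : set R).
Implicit Types (z w l b : C) (x y t p e : R) (n k N : nat).

Lemma hlP t : hl t <-> 0 < t. Proof. by rewrite /= in_itv /= andbT. Qed.
Lemma uiP t : ui t <-> 0 < t < 1. Proof. by rewrite /= in_itv /=. Qed.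

Lemma measurable_hl : measurable hl. Proof. exact: measurable_itv. Qed.
Lemma measurable_ui : measurable ui. Proof. exact: measurable_itv. Qed.
Lemma open_hl : open hl. Proof. exact: rray_open. Qed.
Lemma open_ui : open ui. Proof. exact: interval_open. Qed.

Lemma powRDp x p q : 0 < x -> x `^ (p + q) = x `^ p * x `^ q.
Proof. by move=> x0; rewrite /powR gt_eqF // mulrDl expRD. Qed.

Lemma powR_pos x p : 0 < x -> x `^ p = expR (p * ln x).
Proof. by move=> x0; rewrite /powR gt_eqF. Qed.

Lemma powR_nat x n : 0 < x -> x `^ n%:R = x ^+ n.
Proof. by move=> x0; rewrite powR_mulrn // ltW. Qed.

Lemma derivable_pow_pos p t : 0 < t -> is_derive t 1 (fun s : R => s `^ p) (p * t `^ (p - 1)).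
Proof. exact: is_derive1_powR. Qed.

Lemma is_derive_continuous (f : R -> R) t (l : R) : is_derive t 1 f l -> {for t, continuous f}.
Proof.
by move=> [h _]; apply: differentiable_continuous; apply/derivable1_diffP.
Qed.

(** From y ^ n / n! <= exp y with y = e (1 + t). *)
Lemma powR_expR_bound p e : 0 < e ->
  exists2 K, 0 < K & forall t, 0 <= t -> (1 + t) `^ p <= K * expR (e * t).
Proof.
move=> e0; pose n := Num.truncn `|p|.
have pn : p <= n.+1%:R by apply: le_trans (ler_norm p) _; exact: ltW (truncnS_gt _).
exists (n.+1`!%:R / e ^+ n.+1 * expR e).
  by rewrite mulr_gt0 ?expR_gt0 // divr_gt0 ?exprn_gt0 // ltr0n fact_gt0.
move=> t t0; have t1 : 0 < 1 + t by lra.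
apply: (@le_trans _ _ ((1 + t) ^+ n.+1)).
  rewrite -powR_nat // !powR_pos // ler_expR ler_wpM2r //.
  by apply: ln_ge0; lra.
have et : 0 <= e * (1 + t) by rewrite mulr_ge0 // ltW.
have f0 : 0 < n.+1`!%:R :> R by rewrite ltr0n fact_gt0.
have e1 : 0 < e ^+ n.+1 by rewrite exprn_gt0.
have h : (e * (1 + t)) ^+ n.+1 <= expR (e * (1 + t)) * n.+1`!%:R.
  by rewrite -ler_pdivrMr //; have := expR_ge1Dxn n et; lra.
have eE : e * (1 + t) = e + e * t by ring.
rewrite [in X in _ <= X]eE expRD exprMn -ler_pdivlMl // in h.
apply: le_trans h _; rewrite le_eqVlt; apply/orP; left; apply/eqP; ring.
Qed.

Lemma Rintegrable_ext (D : set R) (f g : R -> R) : measurable D ->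
  (forall t, D t -> f t = g t) -> Rintegrable D f -> Rintegrable D g.
Proof. by move=> mD e; apply: eq_integrable => // t /set_mem/e /= ->. Qed.

(** A majorant for integrands on the half line: a power at 0, polynomial growth
    and exponential decay at infinity. *)
Definition gmaj x p e t : R := t `^ (x - 1) * (1 + t) `^ p * expR (- (e * t)).

Lemma gmaj_ge0 x p e t : 0 <= gmaj x p e t.
Proof. by rewrite !mulr_ge0 ?powR_ge0 ?expR_ge0. Qed.

Lemma is_derive_1Dpow p t : 0 < t -> is_derive t 1 (fun s : R => (1 + s) `^ p) (p * (1 + t) `^ (p - 1)).
Proof.
move=> t0; have t1 : 0 < 1 + t by lra.
have d1 : is_derive t 1 (fun s : R => 1 + s) 1.
  by apply: is_derive_eq; ring.
have := @is_derive1_comp _ (fun s => s `^ p) _ t _ _ (derivable_pow_pos p t1) d1.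
by rewrite mulr1.
Qed.

Lemma gmaj_continuous x p e t : 0 < t -> {for t, continuous (gmaj x p e)}.
Proof.
move=> t0.
have c1 := is_derive_continuous (derivable_pow_pos (x - 1) t0).
have c2 := is_derive_continuous (is_derive_1Dpow p t0).
have c3 : {for t, continuous (fun s : R => expR (- (e * s)))}.
  have d1 : is_derive t 1 (fun s : R => - (e * s)) (- e).
    by apply: is_derive_eq; rewrite /GRing.scale /=; ring.
  exact: is_derive_continuous (@is_derive1_comp _ expR _ t _ _ (is_derive_expR _) d1).
exact: cvgM (cvgM c1 c2) c3.
Qed.

Lemma measurable_gmaj x p e : measurable_fun hl (gmaj x p e).
Proof.
apply: open_continuous_measurable_fun; first exact: open_hl.
by move=> t /set_mem/hlP; exact: gmaj_continuous.
Qed.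

(** Comparison with t ^ (x - 1) * (1 + t) ^ (- x - 1), the derivative of the
    bounded function (t / (1 + t)) ^ x / x. *)
Lemma Rintegrable_gmaj x p e : 0 < x -> 0 < e -> Rintegrable hl (gmaj x p e).
Proof.
move=> x0 e0.
pose m t : R := t `^ (x - 1) * (1 + t) `^ (- x - 1).
have im : Rintegrable hl m.
  pose F t : R := x^-1 * (t `^ x * (1 + t) `^ (- x)).
  apply: (@Rintegrable_primitive _ _ _ _ F m (x^-1) (exhausts_0y R)).
  - by move=> t _; rewrite mulr_ge0 ?powR_ge0.
  - move=> t /hlP t0; have t1 : 0 < 1 + t by lra.
    have d := is_deriveZ x^-1 (is_deriveM (derivable_pow_pos x t0) (is_derive_1Dpow (- x) t0)).
    apply: is_derive_eq d _; rewrite /GRing.scale /= /m.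
    have -> : t `^ x = t `^ (x - 1) * t.
      by rewrite -[in LHS](subrK 1 x) (powRDp (x - 1) 1 t0) powRr1 // ltW.
    have -> : (1 + t) `^ (- x) = (1 + t) `^ (- x - 1) * (1 + t).
      by rewrite -[in LHS](subrK 1 (- x)) (powRDp (- x - 1) 1 t1) powRr1 // ltW.
    by field; exact: lt0r_neq0.
  - move=> t /hlP t0.
    exact: cvgM (is_derive_continuous (derivable_pow_pos (x - 1) t0))
                (is_derive_continuous (is_derive_1Dpow (- x - 1) t0)).
  - move=> t /hlP t0; have t1 : 0 < 1 + t by lra.
    rewrite ger0_norm; last by rewrite !mulr_ge0 ?powR_ge0 // invr_ge0 ltW.
    rewrite ler_piMr ?invr_ge0 ?(ltW x0) //.
    have -> : t `^ x * (1 + t) `^ (- x) = expR (x * (ln t - ln (1 + t))).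
      by rewrite !powR_pos // -expRD; congr expR; ring.
    rewrite -[leRHS]expR0 ler_expR pmulr_rle0 // subr_le0 ler_ln ?posrE //; lra.
have [K K0 hK] := powR_expR_bound (p + x + 1) e0.
apply: (@Rintegrable_le _ _ _ (fun t => K * m t) measurable_hl (@measurable_gmaj x p e)).
  exact: RintegrableZ measurable_hl im.
move=> t /hlP t0; rewrite ger0_norm ?gmaj_ge0 // /gmaj /m.
have t1 : 0 < 1 + t by lra.
have h := hK t (ltW t0).
have -> : (1 + t) `^ p = (1 + t) `^ (p + x + 1) * (1 + t) `^ (- x - 1).
  by rewrite -powRDp //; congr powR; ring.
rewrite expRN -mulrA -[X in _ <= X]mulrCA.
apply: ler_wpM2l; first exact: powR_ge0.
rewrite mulrAC ler_wpM2r ?powR_ge0 // ler_pdivrMr ?expR_gt0 //.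
Qed.

Lemma Cintegrable_gmaj f K x p e : 0 < x -> 0 < e -> Cmeasurable hl f ->
  (forall t, 0 < t -> Cabs (f t) <= K * gmaj x p e t) -> Cintegrable hl f.
Proof.
move=> x0 e0 mf h.
apply: (@Cintegrable_le _ _ _ (fun t => K * gmaj x p e t)) => //.
  exact: (RintegrableZ K measurable_hl (@Rintegrable_gmaj x p e x0 e0)).
by move=> t /hlP; exact: h.
Qed.

(** A sum rather than the Beta integrand t ^ (x - 1) * (1 - t) ^ (y - 1), because
    both summands have elementary primitives; [powM_bmaj] compares the two. *)
Definition bmaj x y t : R := t `^ (x - 1) + (1 - t) `^ (y - 1).

Lemma is_derive_1Bpow p t : t < 1 ->
  is_derive t 1 (fun s : R => (1 - s) `^ p) (- (p * (1 - t) `^ (p - 1))).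
Proof.
move=> t0; have t1 : 0 < 1 - t by lra.
have d1 : is_derive t 1 (fun s : R => 1 - s) (- 1).
  by apply: is_derive_eq; ring.
have := @is_derive1_comp _ (fun s => s `^ p) _ t _ _ (derivable_pow_pos p t1) d1.
by rewrite mulrN1.
Qed.

Lemma Rintegrable_bmaj x y : 0 < x -> 0 < y -> Rintegrable ui (bmaj x y).
Proof.
move=> x0 y0; apply: RintegrableD; first exact: measurable_ui.
- apply: (@Rintegrable_primitive _ _ _ _ (fun t => x^-1 * t `^ x) _ x^-1 (exhausts_01 R)).
  + by move=> t _; rewrite powR_ge0.
  + move=> t /uiP/andP[t0 t1].
    apply: is_derive_eq (is_deriveZ x^-1 (derivable_pow_pos x t0)) _.
    by rewrite /GRing.scale /= mulrA mulVf ?mul1r // lt0r_neq0.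
  + move=> t /uiP/andP[t0 t1]; exact: is_derive_continuous (derivable_pow_pos (x - 1) t0).
  + move=> t /uiP/andP[t0 t1]; rewrite ger0_norm; last by rewrite mulr_ge0 ?powR_ge0 ?invr_ge0 ?ltW.
    rewrite ler_piMr ?invr_ge0 ?(ltW x0) // powR_pos // -[leRHS]expR0 ler_expR pmulr_rle0 //.
    by apply: ln_le0; exact: ltW.
- apply: (@Rintegrable_primitive _ _ _ _ (fun t => - y^-1 * (1 - t) `^ y) _ y^-1 (exhausts_01 R)).
  + by move=> t _; rewrite powR_ge0.
  + move=> t /uiP/andP[t0 t1].
    apply: is_derive_eq (is_deriveZ (- y^-1) (is_derive_1Bpow y t1)) _.
    by rewrite /GRing.scale /=; field; exact: lt0r_neq0.
  + move=> t /uiP/andP[t0 t1]; exact: is_derive_continuous (is_derive_1Bpow (y - 1) t1).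
  + move=> t /uiP/andP[t0 t1]; have s0 : 0 < 1 - t by lra.
    rewrite mulNr normrN ger0_norm; last by rewrite mulr_ge0 ?powR_ge0 ?invr_ge0 ?ltW.
    rewrite ler_piMr ?invr_ge0 ?(ltW y0) // powR_pos // -[leRHS]expR0 ler_expR pmulr_rle0 //.
    by apply: ln_le0; lra.
Qed.

Lemma powM_bmaj x y : exists2 K, 0 < K & forall t, 0 < t < 1 ->
  t `^ (x - 1) * (1 - t) `^ (y - 1) <= K * bmaj x y t.
Proof.
pose h : R := 2^-1.
have h0 : 0 < h by rewrite /h; lra.
pose A p : R := h `^ p + 1 `^ p.
have A0 p : 0 < A p by rewrite addr_gt0 // powR_gt0.
exists (A (x - 1) + A (y - 1)); first by rewrite addr_gt0.
move=> t /andP[t0 t1]; have s0 : 0 < 1 - t by lra.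
have := powR_gt0 (x - 1) t0; have := powR_gt0 (y - 1) s0.
have a1 := A0 (x - 1); have a2 := A0 (y - 1).
rewrite /bmaj; have [th|th] := leP t h.
  have : (1 - t) `^ (y - 1) <= A (y - 1) by apply: powR_between => //; rewrite /h in th *; lra.
  move: (t `^ _) ((1 - t) `^ _) (A (x - 1)) (A (y - 1)) a1 a2 => X Y B D; nra.
have : t `^ (x - 1) <= A (x - 1) by apply: powR_between => //; rewrite /h in th *; lra.
move: (t `^ _) ((1 - t) `^ _) (A (x - 1)) (A (y - 1)) a1 a2 => X Y B D; nra.
Qed.

Lemma Cintegrable_bmaj f K x y : 0 < x -> 0 < y -> Cmeasurable ui f ->
  (forall t, 0 < t < 1 -> Cabs (f t) <= K * (t `^ (x - 1) * (1 - t) `^ (y - 1))) ->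
  Cintegrable ui f.
Proof.
move=> x0 y0 mf h; have [K' K0' hK'] := powM_bmaj x y.
apply: (@Cintegrable_le _ _ _ (fun t => `|K| * (K' * bmaj x y t))) => //.
  by do 2 apply: (RintegrableZ _ measurable_ui); exact: Rintegrable_bmaj.
move=> t /uiP tt; apply: le_trans (h t tt) _.
apply: (@le_trans _ _ (`|K| * (t `^ (x - 1) * (1 - t) `^ (y - 1)))).
  by rewrite ler_wpM2r ?ler_norm // mulr_ge0 ?powR_ge0.
by rewrite ler_wpM2l // hK'.
Qed.

End Majorants.

Arguments Cintegrable_gmaj {R f} K x p e _ _ _ _.
Arguments Cintegrable_bmaj {R f} K x y _ _ _ _.

(** * The Gamma and Beta functions *)

Section GammaBeta.
Variable R : realType.
Local Notation C := R[i].
Local Notation Re := (@complex.Re R).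
Local Notation Im := (@complex.Im R).
Local Notation mu := (@lebesgue_measure R).
Local Notation hl := (`]0, +oo[%classic : set R).
Local Notation ui := (`]0, 1[%classic : set R).
Implicit Types (z w l a b : C) (x y t p e k : R) (n N : nat).

(** ** Differentiability and measurability of integrands *)

Lemma Rcvg_near (u v : nat -> R) x : (\forall n \near \oo, u n = v n) ->
  u @ \oo --> x -> v @ \oo --> x.
Proof.
move=> h /cvgrPdist_lt c; apply/cvgrPdist_lt => e e0.
by apply: filterS2 h (c e e0) => n <-.
Qed.

Lemma Ccvg_near (u v : nat -> C) l : (\forall n \near \oo, u n = v n) ->
  (u : nat -> R[i]^o) @ \oo --> (l : R[i]^o) ->
  (v : nat -> R[i]^o) @ \oo --> (l : R[i]^o).
Proof.
move=> h /Ccvg_Cabs c; apply/Ccvg_Cabs; apply: Rcvg_near c.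
by apply: filterS h => n ->.
Qed.

(** Continuity and measurability of an integrand ask for a derivative to exist,
    not for its value. *)
Definition Cdiff (f : R -> C) t := exists l, is_Cder f t l.

Lemma Cdiff_cst z t : Cdiff (fun=> z) t.
Proof. by exists 0; exact: is_Cder_cst. Qed.

Lemma CdiffM f g t : Cdiff f t -> Cdiff g t -> Cdiff (fun s => f s * g s) t.
Proof. by move=> [l h] [l' h']; exists (l * g t + f t * l'); exact: is_CderM. Qed.

Lemma CdiffD f g t : Cdiff f t -> Cdiff g t -> Cdiff (fun s => f s + g s) t.
Proof. by move=> [l h] [l' h']; exists (l + l'); exact: is_CderD. Qed.

Lemma Cdiff_lin z w t : Cdiff (fun s => z + s%:C * w) t.
Proof. by exists w; exact: is_Cder_lin. Qed.

Lemma Cdiff_Cexp f t : Cdiff f t -> Cdiff (fun s => Cexp (f s)) t.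
Proof. by move=> [l h]; exists (l * Cexp (f t)); exact: is_Cder_Cexp. Qed.

Lemma Cdiff_Cpow f t w : log_plane (f t) -> Cdiff f t -> Cdiff (fun s => Cpow (f s) w) t.
Proof. by move=> fp [l h]; exists (w * l / f t * Cpow (f t) w); exact: is_Cder_Cpow. Qed.

Lemma Cdiff_X f t n : Cdiff f t -> Cdiff (fun s => f s ^+ n) t.
Proof. by move=> [l h]; exists (n%:R * f t ^+ n.-1 * l); exact: is_CderX. Qed.

Lemma Cmeasurable_diff (D : set R) f : open D -> (forall t, D t -> Cdiff f t) ->
  Cmeasurable D f.
Proof.
by move=> oD h; split; apply: open_continuous_measurable_fun => // t /set_mem /h[l];
  move/is_Cder_continuous => [].
Qed.

Lemma CdiffN f t : Cdiff f t -> Cdiff (fun s => - f s) t.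
Proof. by move=> [l h]; exists (- l); exact: is_CderN. Qed.

Lemma Cdiff_ext f g t : (forall s, f s = g s) -> Cdiff f t -> Cdiff g t.
Proof. by move=> h [l hl']; exists l; exact: is_Cder_ext hl'. Qed.

Lemma Cdiff_inv f t : log_plane (f t) -> Cdiff f t -> Cdiff (fun s => (f s)^-1 : C) t.
Proof.
move=> hp hf; have [l hl'] : Cdiff (fun s => Cpow (f s) (- 1)) t by exact: Cdiff_Cpow.
exists l; apply: is_Cder_near hl'.
have [l' h'] := hf; have e0 : 0 < Cabs (f t) by rewrite Cabs_gt0 log_plane_neq0.
apply: filterS (is_Cder_near_small h' e0) => s hs.
have sn : f s != 0 by apply/eqP => e; move: hs; rewrite e sub0r CabsN ltxx.
by rewrite CpowN // Cpow1.
Qed.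

Lemma CFTC_Cdiff (D : set R) (u v : nat -> R) (F f : R -> C) (A B : C) :
  exhausts D u v ->
  (forall t, D t -> is_Cder F t (f t)) -> (forall t, D t -> Cdiff f t) ->
  Cintegrable D f ->
  ((fun n => F (u n)) : nat -> R[i]^o) @ \oo --> (A : R[i]^o) ->
  ((fun n => F (v n)) : nat -> R[i]^o) @ \oo --> (B : R[i]^o) ->
  Cintegral D f = B - A.
Proof.
move=> ex hF hf; pose df t := xget (0 : C) [set l | is_Cder f t l].
apply: (CFTC_exhausts (df := df) ex hF) => t Dt.
by have [l h] := hf t Dt; rewrite /df; case: xgetP => [_ ->//|/(_ l)].
Qed.

Lemma is_Cder_Cpow_lin z v w t : log_plane (z + t%:C * v) ->
  is_Cder (fun s => Cpow (z + s%:C * v) w) t (w * v * Cpow (z + t%:C * v) (w - 1)).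
Proof.
move=> h; apply: is_Cder_eq (is_Cder_Cpow w (is_Cder_lin z v t) h) _.
have h0 := log_plane_neq0 h.
by rewrite CpowB1 //; field.
Qed.

Lemma is_Cder_Cpow_real w t : 0 < t ->
  is_Cder (fun s => Cpow s%:C w) t (w * Cpow t%:C (w - 1)).
Proof.
move=> t0; have hp : log_plane (0 + t%:C * 1 : C).
  by rewrite add0r mulr1; exact: log_plane_Re.
have := is_Cder_Cpow_lin w hp; rewrite add0r !mulr1.
by apply: is_Cder_ext => s; rewrite add0r mulr1.
Qed.

Lemma is_Cder_Cpow_1B w t : t < 1 ->
  is_Cder (fun s => Cpow (1 - s)%:C w) t (- (w * Cpow (1 - t)%:C (w - 1))).
Proof.
move=> t0; have e s : 1 + s%:C * -1 = (1 - s)%:C :> C.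
  by rewrite mulrN1 rmorphB rmorph1.
have hp : log_plane (1 + t%:C * -1 : C).
  by rewrite e; apply: log_plane_Re => /=; rewrite subr_gt0.
have := is_Cder_Cpow_lin w hp; rewrite e mulrN1 mulNr.
by apply: is_Cder_ext => s; rewrite e.
Qed.

Lemma Cdiff_Cpow_real w t : 0 < t -> Cdiff (fun s => Cpow s%:C w) t.
Proof. by move=> t0; eexists; exact: is_Cder_Cpow_real. Qed.

Lemma Cdiff_Cpow_1B w t : t < 1 -> Cdiff (fun s => Cpow (1 - s)%:C w) t.
Proof. by move=> t0; eexists; exact: is_Cder_Cpow_1B. Qed.

Lemma Cdiff_Cexp_scale k t : Cdiff (fun s => Cexp (- (k * s)%:C)) t.
Proof.
apply: Cdiff_Cexp; have := Cdiff_lin 0 (- k%:C) t.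
by congr (Cdiff _ _); apply/funext => s; rewrite add0r rmorphM /=; ring.
Qed.

(** ** Gamma and Beta integrals *)

Lemma Cintegrable_gamma z k : 0 < Re z -> 0 < k ->
  Cintegrable hl (fun t => Cpow t%:C (z - 1) * Cexp (- (k * t)%:C)).
Proof.
move=> z0 k0; apply: (Cintegrable_gmaj 1 (Re z) 0 k) => //.
  apply: Cmeasurable_diff; first exact: open_hl.
  move=> t /hlP t0; apply: CdiffM; first exact: Cdiff_Cpow_real.
  exact: Cdiff_Cexp_scale.
move=> t t0; rewrite CabsM Cabs_Cpow_real // Cabs_Cexp ReD !ReN Re_1 /= /gmaj.
by rewrite powRr0 mulr1 mul1r.
Qed.

Lemma Cintegral_gamma z k : 0 < Re z -> 0 < k ->
  Cintegral hl (fun t => Cpow t%:C (z - 1) * Cexp (- (k * t)%:C))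
  = Cpow k%:C (- z) * CGamma z.
Proof.
move=> z0 k0; have kn : k%:C != 0 :> C by exact: Re_gt0_neq0.
have i1 := Cintegrable_gamma z0 ltr01; have [i2 e] := Cscale k0 i1.
have -> : CGamma z = Cintegral hl (fun t => Cpow t%:C (z - 1) * Cexp (- (1 * t)%:C)).
  by apply: eq_Cintegral => t _; rewrite mul1r.
rewrite e mulrA.
have -> : Cpow k%:C (- z) * k%:C = Cpow k%:C (1 - z).
  by rewrite -[X in _ * X]Cpow1 // -CpowD //; congr Cpow; ring.
rewrite -CintegralZ //.
apply: eq_Cintegral => t /hlP t0; rewrite Cpow_mulrr // mul1r !mulrA -CpowD //.
have e0 : 1 - z + (z - 1) = 0 by ring.
by rewrite e0 Cpow0 mul1r.
Qed.

Definition CBeta a b : C :=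
  Cintegral ui (fun t => Cpow t%:C (a - 1) * Cpow (1 - t)%:C (b - 1)).

Lemma Cintegrable_beta a b : 0 < Re a -> 0 < Re b ->
  Cintegrable ui (fun t => Cpow t%:C (a - 1) * Cpow (1 - t)%:C (b - 1)).
Proof.
move=> a0 b0; apply: (Cintegrable_bmaj 1 (Re a) (Re b)) => //.
  apply: Cmeasurable_diff; first exact: open_ui.
  move=> t /uiP/andP[t0 t1]; apply: CdiffM; first exact: Cdiff_Cpow_real.
  exact: Cdiff_Cpow_1B.
move=> t /andP[t0 t1]; rewrite CabsM !Cabs_Cpow_real ?subr_gt0 //.
by rewrite !ReD !ReN Re_1 mul1r.
Qed.

Lemma cvg_powR0 (u : nat -> R) p : 0 < p -> (forall n, 0 < u n) -> u @ \oo --> (0 : R) ->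
  u n `^ p @[n --> \oo] --> (0 : R).
Proof.
move=> p0 u0 /cvgrPdist_lt h; apply/cvgrPdist_lt => e e0.
have d0 : 0 < e `^ (p^-1) by rewrite powR_gt0.
apply: filterS (h _ d0) => n; rewrite !sub0r !normrN !gtr0_norm ?powR_gt0 //.
move=> hu; have -> : e = (e `^ (p^-1)) `^ p by rewrite -powRrM mulVf ?powRr1 ?ltW // gt_eqF.
by apply: gt0_ltr_powR => //; rewrite nnegrE ltW.
Qed.

Lemma powR_le1 x p : 0 < x -> x <= 1 -> 0 <= p -> x `^ p <= 1.
Proof.
move=> x0 x1 p0; rewrite powR_pos // -[leRHS]expR0 ler_expR mulr_ge0_le0 //.
exact: ln_le0.
Qed.

Lemma inv3_lt1 n : n.+3%:R^-1 < 1 :> R.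
Proof. by rewrite invf_lt1 // ltr1n. Qed.

(** The integral of the derivative of t ^ a * (1 - t) ^ b, which vanishes at both
    ends, combined with t + (1 - t) = 1. *)
Lemma CBetaS a b : 0 < Re a -> 0 < Re b -> (a + b) * CBeta a (b + 1) = b * CBeta a b.
Proof.
move=> a0 b0.
have a1 : 0 < Re (a + 1) by rewrite ReD Re_1; lra.
have b1 : 0 < Re (b + 1) by rewrite ReD Re_1; lra.
pose F t := Cpow t%:C a * Cpow (1 - t)%:C b.
pose f1 t := Cpow t%:C (a - 1) * Cpow (1 - t)%:C (b + 1 - 1).
pose f2 t := Cpow t%:C (a + 1 - 1) * Cpow (1 - t)%:C (b - 1).
have i1 : Cintegrable ui f1 := Cintegrable_beta a0 b1.
have i2 : Cintegrable ui f2 := Cintegrable_beta a1 b0.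
pose f t := a * f1 t - b * f2 t.
have mU := @measurable_ui R.
have dF t : 0 < t < 1 -> is_Cder F t (f t).
  move=> /andP[t0 t1]; apply: is_Cder_eq (is_CderM (is_Cder_Cpow_real a t0) (is_Cder_Cpow_1B b t1)) _.
  by rewrite /f /f1 /f2 !addrK; ring.
have df t : 0 < t < 1 -> Cdiff f t.
  move=> /andP[t0 t1]; apply: CdiffD.
    apply: CdiffM; first exact: Cdiff_cst.
    by apply: CdiffM; [exact: Cdiff_Cpow_real|exact: Cdiff_Cpow_1B].
  have -> : (fun s => - (b * f2 s)) = (fun s => (- b) * f2 s) by apply/funext => s; rewrite mulNr.
  apply: CdiffM; first exact: Cdiff_cst.
    by apply: CdiffM; [exact: Cdiff_Cpow_real|exact: Cdiff_Cpow_1B].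
have Fle1 t : 0 < t < 1 -> Cabs (F t) <= t `^ Re a.
  move=> /andP[t0 t1]; rewrite CabsM !Cabs_Cpow_real ?subr_gt0 //.
  by rewrite ler_piMr ?powR_ge0 // powR_le1 ?subr_gt0 ?ltW //; lra.
have Fle2 t : 0 < t < 1 -> Cabs (F t) <= (1 - t) `^ Re b.
  move=> /andP[t0 t1]; rewrite CabsM !Cabs_Cpow_real ?subr_gt0 //.
  by rewrite ler_piMl ?powR_ge0 // powR_le1 ?ltW //; lra.
have inv3 n : 0 < n.+3%:R^-1 :> R by rewrite invr_gt0.
have i3 : Cintegrable ui f by apply: CintegrableB => //; apply: CintegrableZ.
have I0 : Cintegral ui f = 0 - 0.
  apply: (@CFTC_Cdiff ui _ _ F f 0 0 (exhausts_01 R)) => //.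
  - apply: (Ccvg_le _ (cvg_powR0 a0 inv3 (@cvg_inv3 R))); apply: nearW => n.
    by rewrite subr0; apply: Fle1; rewrite inv3 inv3_lt1.
  - apply: (Ccvg_le _ (cvg_powR0 b0 inv3 (@cvg_inv3 R))); apply: nearW => n.
    rewrite subr0; have := Fle2 (1 - n.+3%:R^-1); rewrite opprB addrCA subrr addr0; apply.
    by rewrite subr_gt0 inv3_lt1 gtrBl inv3.
have j1 := CintegrableZ a mU i1; have j2 := CintegrableZ b mU i2.
move: I0; rewrite (CintegralB mU j1 j2) (CintegralZ a mU i1) (CintegralZ b mU i2).
have e12 : CBeta a b = Cintegral ui f1 + Cintegral ui f2.
  rewrite -CintegralD //; apply: eq_Cintegral => t /uiP/andP[t0 t1].
  have t1' : 0 < 1 - t by rewrite subr_gt0.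
  have tn : t%:C != 0 :> C by exact: Re_gt0_neq0.
  have tn' : (1 - t)%:C != 0 :> C by exact: Re_gt0_neq0.
  rewrite /f1 /f2 !addrK (CpowB1 a tn) (CpowB1 b tn').
  move: (Cpow t%:C a) (Cpow (1 - t)%:C b) => X Y.
  have e : (1 - t)%:C = 1 - t%:C :> C by rewrite rmorphB rmorph1.
  rewrite e; rewrite e in tn'.
  by field; rewrite tn tn'.
rewrite e12 -/(CBeta a (b + 1)) -/(Cintegral ui f2) => /eqP; rewrite subrr subr_eq0 => /eqP h.
by rewrite mulrDr mulrDl h addrC.
Qed.

Lemma Re_addn a n : 0 < Re a -> 0 < Re (a + n%:R).
Proof. by move=> a0; rewrite ReD Re_nat ltr_pwDl. Qed.

Lemma pochhammer_neq0 a n : 0 < Re a -> pochhammer a n != 0.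
Proof.
move=> a0; apply/prodf_neq0 => i _; apply: Re_gt0_neq0; exact: Re_addn.
Qed.

Lemma CBetaDn a b n : 0 < Re a -> 0 < Re b ->
  pochhammer (a + b) n * CBeta a (b + n%:R) = pochhammer b n * CBeta a b.
Proof.
move=> a0 b0; elim: n => [|n IH]; first by rewrite !pochhammer0 addr0.
rewrite !pochhammerS -natr1 [b + (_ + 1)]addrA -mulrA -[a + b + n%:R]addrA.
by rewrite CBetaS // ?Re_addn // mulrCA IH; ring.
Qed.

Lemma CBeta1 a : 0 < Re a -> a * CBeta a 1 = 1.
Proof.
move=> a0; have mU := @measurable_ui R.
have r1 : 0 < Re (1 : C) by rewrite Re_1.
have i1 := Cintegrable_beta a0 r1.
pose f t := Cpow t%:C (a - 1) * Cpow (1 - t)%:C (1 - 1 : C).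
have fE t : f t = Cpow t%:C (a - 1) by rewrite /f subrr Cpow0 mulr1.
have i2 : Cintegrable ui (fun t => a * f t) := CintegrableZ a mU i1.
rewrite /CBeta -(CintegralZ a mU i1).
have inv3 n : 0 < n.+3%:R^-1 :> R by rewrite invr_gt0.
have e : Cintegral ui (fun t => a * f t) = 1 - 0.
  apply: (CFTC_exhausts (exhausts_01 R) (F := fun t => Cpow t%:C a)
    (df := fun t => a * ((a - 1) * Cpow t%:C (a - 1 - 1)))) => //.
  - move=> t /uiP/andP[t0 t1]; rewrite fE; exact: is_Cder_Cpow_real.
  - move=> t /uiP/andP[t0 t1].
    apply: (is_Cder_ext (f := fun t => a * Cpow t%:C (a - 1))).
      by move=> s; rewrite fE.
    by apply: is_CderZ; exact: is_Cder_Cpow_real.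
  - apply: (Ccvg_le _ (cvg_powR0 a0 inv3 (@cvg_inv3 R))); apply: nearW => n.
    by rewrite subr0 Cabs_Cpow_real.
  - have d1 := is_Cder_Cpow_real a (@ltr01 R).
    have c1 : (fun n => 1 - n.+3%:R^-1) @ \oo --> (1 : R).
      by rewrite -[X in _ --> X](subr0 (1 : R)); apply: cvgB; [exact: cvg_cst|exact: (@cvg_inv3 R)].
    by have := is_Cder_cvg d1 c1; rewrite (Cpow_base1 a).
by rewrite e subr0.
Qed.

(** Brings integrals over a bounded interval to the half line, where dominated
    convergence is applied in [CBeta_cvg_Gamma]. *)
Lemma Cintegral_if (f : R -> C) : Cintegrable ui f ->
  Cintegrable hl (fun t => if t < 1 then f t else 0) /\
  Cintegral hl (fun t => if t < 1 then f t else 0) = Cintegral ui f.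
Proof.
move=> [i1 i2].
have hu : hl `&` ui = ui.
  by apply: setIidr => t /uiP/andP[t0 _]; apply/hlP.
have eP (P : C -> R) : P 0 = 0 -> forall t, hl t ->
   P (if t < 1 then f t else 0) = ((fun s => P (f s)) \_ ui) t.
  move=> P0 t /hlP t0; rewrite patchE; case: ifPn => t1.
    by rewrite mem_set //; apply/uiP; rewrite t0.
  by rewrite memNset // => /uiP/andP[_ h]; rewrite h in t1.
have mH := @measurable_hl R; have mU := @measurable_ui R.
have key (P : C -> R) : P 0 = 0 -> Rintegrable ui (fun s => P (f s)) ->
   Rintegrable hl (fun t => P (if t < 1 then f t else 0)) /\
   Rintegral mu hl (fun t => P (if t < 1 then f t else 0)) = Rintegral mu ui (fun s => P (f s)).
  move=> P0 iP; split.
    apply: (Rintegrable_ext mH (fun t ht => esym (eP P P0 t ht))).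
    rewrite /Rintegrable.
    have -> : EFin \o ((fun s => P (f s)) \_ ui) = (EFin \o (fun s => P (f s))) \_ ui.
      by rewrite restrict_EFin.
    by apply: (@integrable_restrict _ _ _ mu ui mU hl mH _).1; rewrite hu.
  rewrite -[X in _ = Rintegral mu X _]hu Rintegral_mkcondr.
  by apply: eq_Rintegral => t /set_mem; exact: eP.
have [j1 e1] := key Re (Re_0 R) i1; have [j2 e2] := key Im (Im_0 R) i2.
by split=> //; apply: eqC.
Qed.

(** ** Gamma as a limit of Beta *)

Lemma Ccvg_Cexp (u : nat -> C) l : (u : nat -> R[i]^o) @ \oo --> (l : R[i]^o) ->
  ((fun n => Cexp (u n)) : nat -> R[i]^o) @ \oo --> (Cexp l : R[i]^o).
Proof.
move=> /Ccvg_ReIm[h1 h2]; apply/Ccvg_ReIm.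
have c1 := cvg_comp _ _ h1 (@continuous_expR R (Re l)).
split=> /=; apply: cvgM c1 _.
  exact: cvg_comp _ _ h2 (@continuous_cos R (Im l)).
exact: cvg_comp _ _ h2 (@continuous_sin R (Im l)).
Qed.

Lemma ln_1B_bounds x : 0 < x < 1 -> - (x / (1 - x)) <= ln (1 - x) <= - x.
Proof.
move=> /andP[x0 x1]; have y0 : 0 < 1 - x by lra.
have yn : 1 - x != 0 by exact: lt0r_neq0.
have -> : ln (1 - x) <= - x by apply: (@le_ln1Dx _ (- x)); lra.
rewrite andbT lerNl -lnV ?posrE //.
have e : (1 - x)^-1 = 1 + x / (1 - x) by field.
rewrite [X in ln X]e; apply: le_ln1Dx; apply: (@lt_le_trans _ _ 0); first by lra.
by rewrite divr_ge0 // ltW.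
Qed.

Lemma cvg_Nln s : 0 < s ->
  (fun n => n.+2%:R * ln (1 - s / n.+2%:R)) @ \oo --> (- s : R).
Proof.
move=> s0.
have c0 : (fun n => s / n.+2%:R) @ \oo --> (0 : R).
  by rewrite -(mulr0 s); apply: cvgM; [exact: cvg_cst|exact: (@cvg_inv2 R)].
have c1 : (fun n => - (s / (1 - s / n.+2%:R))) @ \oo --> (- s : R).
  apply: cvgN; rewrite -[X in _ --> X]divr1 -[X in _ / X](subr0 (1 : R)).
  apply: cvgM; first exact: cvg_cst.
  apply: cvgV; first by rewrite subr0 oner_neq0.
  by apply: cvgB c0; exact: cvg_cst.
have near1 : \forall n \near \oo, s / n.+2%:R < 1.
  move/cvgrPdist_lt : c0 => /(_ 1 ltr01); apply: filterS => n.
  by rewrite sub0r normrN ger0_norm // divr_ge0 // ltW.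
apply: squeeze_cvgr c1 (cvg_cst (- s)).
apply: filterS near1 => n n1.
have n0 : 0 < n.+2%:R :> R by [].
have nn : n.+2%:R != 0 :> R by exact: lt0r_neq0.
have u0 : 0 < s / n.+2%:R by rewrite divr_gt0.
have u01 : 0 < s / n.+2%:R < 1 by rewrite u0.
have /andP[h1 h2] := ln_1B_bounds u01.
have nu : n.+2%:R * (s / n.+2%:R) = s by rewrite mulrC divfK.
apply/andP; split.
  have -> : - (s / (1 - s / n.+2%:R)) = n.+2%:R * - (s / n.+2%:R / (1 - s / n.+2%:R)).
    by rewrite mulrN mulrA nu.
  by rewrite ler_pM2l.
by rewrite -[X in _ <= - X]nu -(mulrN n.+2%:R) ler_pM2l.
Qed.

Lemma cvg_Cpow_1B s b : 0 < s ->
  ((fun n => Cpow (1 - s / n.+2%:R)%:C (b + n.+2%:R)) : nat -> R[i]^o) @ \oo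
    --> (Cexp (- s%:C) : R[i]^o).
Proof.
move=> s0.
have near1 : \forall n \near \oo, s / n.+2%:R < 1.
  have c0 : (fun n => s / n.+2%:R) @ \oo --> (0 : R).
    by rewrite -(mulr0 s); apply: cvgM; [exact: cvg_cst|exact: (@cvg_inv2 R)].
  move/cvgrPdist_lt : c0 => /(_ 1 ltr01); apply: filterS => n.
  by rewrite sub0r normrN ger0_norm // divr_ge0 // ltW.
pose L n := ln (1 - s / n.+2%:R).
have cL : L @ \oo --> (0 : R).
  have eL : L = (fun n => n.+2%:R^-1 * (n.+2%:R * ln (1 - s / n.+2%:R))).
    by apply/funext => n; rewrite mulrA mulVf ?mul1r.
  by rewrite eL -(mul0r (- s)); exact: cvgM (@cvg_inv2 R) (cvg_Nln s0).
have cE : ((fun n => Cexp ((b + n.+2%:R) * (L n)%:C)) : nat -> R[i]^o) @ \oo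
    --> (Cexp (- s%:C) : R[i]^o).
  apply: Ccvg_Cexp; apply/Ccvg_ReIm; split.
    have -> : Re (- s%:C) = Re b * 0 + - s by rewrite mulr0 add0r.
    apply: Rcvg_near (cvgD (cvgM (cvg_cst (Re b)) cL) (cvg_Nln s0)).
    apply: nearW => n; rewrite !fctE ReM ReD Re_nat /=.
    by rewrite mulr0 subr0 [RHS]mulrDl.
  have -> : Im (- s%:C) = Im b * 0 by rewrite mulr0 /= oppr0.
  apply: Rcvg_near (cvgM (cvg_cst (Im b)) cL).
  apply: nearW => n; rewrite ImM ImD Im_nat /=.
  by rewrite mulr0 add0r addr0.
apply: Ccvg_near cE; apply: filterS near1 => n n1.
have u0 : 0 < 1 - s / n.+2%:R by rewrite subr_gt0.
by rewrite CpowE ?Re_gt0_neq0 // Clog_real.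
Qed.

Lemma Cintegral_scaled_beta a b N : 0 < Re a -> 0 < Re b -> (0 < N)%N ->
  Cintegral hl (fun s => if s < N%:R then
      Cpow s%:C (a - 1) * Cpow (1 - s / N%:R)%:C (b - 1) else 0)
  = Cpow N%:R a * CBeta a b.
Proof.
move=> a0 b0 N0; have Np : 0 < N%:R :> R by rewrite ltr0n.
have Ni : 0 < N%:R^-1 :> R by rewrite invr_gt0.
have [i1 e1] := Cintegral_if (Cintegrable_beta a0 b0).
have [i2 e2] := Cscale Ni i1.
rewrite /CBeta -e1 e2.
have NC : (N%:R : C) = (N%:R : R)%:C by rewrite rmorph_nat.
have Nn : (N%:R : R)%:C != 0 :> C by exact: Re_gt0_neq0.
rewrite NC mulrA.
have -> : Cpow (N%:R)%:C a * (N%:R^-1)%:C = Cpow (N%:R)%:C (a - 1).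
  by rewrite CpowB1 // fmorphV.
rewrite -CintegralZ //; apply: eq_Cintegral => t /hlP t0.
rewrite ltr_pdivrMl // mulr1; case: ifP => _; last by rewrite mulr0.
rewrite [_ * t]mulrC Cpow_mulrr // Cpow_invr // mulrA mulrA [_ * Cpow t%:C _]mulrC.
by rewrite mulfK // Cpow_neq0.
Qed.

(** With m = n + 2, the substitution t = s / m turns m ^ a * B (a, b + m) into the
    integral over ]0, m[ of s ^ (a - 1) * (1 - s / m) ^ (b + m - 1). The second
    factor tends to exp (- s), and its modulus is at most exp (- s / 2). *)
Lemma CBeta_cvg_Gamma a b : 0 < Re a -> 0 < Re b ->
  ((fun n => Cpow n.+2%:R a * CBeta a (b + n.+2%:R)) : nat -> R[i]^o) @ \oo
    --> (CGamma a : R[i]^o).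
Proof.
move=> a0 b0.
pose u n s := if s < n.+2%:R then
      Cpow s%:C (a - 1) * Cpow (1 - s / n.+2%:R)%:C (b + n.+2%:R - 1) else 0.
have uE n : Cintegral hl (u n) = Cpow n.+2%:R a * CBeta a (b + n.+2%:R).
  by apply: Cintegral_scaled_beta => //; exact: Re_addn.
have [||||||_] := @Cdct _ hl u (fun t => Cpow t%:C (a - 1) * Cexp (- t%:C))
   (gmaj (Re a) 0 2^-1).
- exact: measurable_hl.
- move=> n; have Ni : 0 < n.+2%:R^-1 :> R by rewrite invr_gt0.
  have [i1 e1] := Cintegral_if (Cintegrable_beta a0 (Re_addn n.+2 b0)).
  have [i2 _] := Cscale Ni i1.
  have := Cintegrable_meas (CintegrableZ (Cpow (n.+2%:R)%:C (a - 1)) (@measurable_hl R) i2).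
  apply: Cmeasurable_ext => t /hlP t0; rewrite /u.
  rewrite ltr_pdivrMl // mulr1; case: ifP => _; last by rewrite mulr0.
  rewrite [_ * t]mulrC Cpow_mulrr // Cpow_invr // mulrA mulrA [_ * Cpow t%:C _]mulrC.
  by rewrite mulfK // Cpow_neq0 // Re_gt0_neq0.
- have := Cintegrable_meas (Cintegrable_gamma a0 ltr01).
  by apply: Cmeasurable_ext => t _; rewrite mul1r.
- move=> t /hlP t0.
  have cv := Ccvg_Z (Cpow t%:C (a - 1)) (cvg_Cpow_1B (b - 1) t0).
  apply: Ccvg_near cv.
  have near1 : \forall n \near \oo, t / n.+2%:R < 1.
    have c0 : (fun n => t / n.+2%:R) @ \oo --> (0 : R).
      by rewrite -(mulr0 t); apply: cvgM; [exact: cvg_cst|exact: (@cvg_inv2 R)].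
    move/cvgrPdist_lt : c0 => /(_ 1 ltr01); apply: filterS => n.
    by rewrite sub0r normrN ger0_norm // divr_ge0 // ltW.
  apply: filterS near1 => n; rewrite ltr_pdivrMr // mul1r /u => ->.
  by rewrite addrAC.
- by apply: Rintegrable_gmaj => //; rewrite invr_gt0.
- move=> n t /hlP t0; rewrite /u; case: ifP => tn; last by rewrite Cabs0 gmaj_ge0.
  have n0 : 0 < n.+2%:R :> R by [].
  have t1 : t / n.+2%:R < 1 by rewrite ltr_pdivrMr // mul1r.
  have s0 : 0 < 1 - t / n.+2%:R by rewrite subr_gt0.
  have eb : Re (b + n.+2%:R - 1) = Re b + n.+2%:R - 1 by rewrite ReD ReD Re_nat ReN Re_1.
  have ea : Re (a - 1) = Re a - 1 by rewrite ReD ReN Re_1.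
  rewrite CabsM !Cabs_Cpow_real // /gmaj powRr0 mulr1 eb ea.
  rewrite ler_wpM2l ?powR_ge0 // powR_pos // ler_expR.
  have u01 : 0 < t / n.+2%:R < 1 by rewrite divr_gt0.
  have /andP[_ h] := ln_1B_bounds u01.
  (* the exponent b + m - 1 has real part at least m / 2: this is where the
     rate 1 / 2 of the majorant comes from *)
  have c : 2^-1 * n.+2%:R <= Re b + n.+2%:R - 1.
    have -> : n.+2%:R = n%:R + 2 :> R by rewrite -addn2 natrD.
    by move: (n%:R) (ler0n R n) => x x0; lra.
  have c0 : 0 <= Re b + n.+2%:R - 1 by apply: le_trans c; rewrite mulr_ge0.
  have d0 : 0 <= t / n.+2%:R by rewrite divr_ge0 // ltW.
  apply: (@le_trans _ _ ((Re b + n.+2%:R - 1) * - (t / n.+2%:R))); first by rewrite ler_wpM2l.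
  have -> : 2^-1 * t = 2^-1 * n.+2%:R * (t / n.+2%:R).
    by rewrite mulrA -[2^-1 * _ * t]mulrA [n.+2%:R * t]mulrC mulrA mulfK // lt0r_neq0.
  by rewrite mulrN lerN2 ler_wpM2r.
by apply: Ccvg_ext => // n; rewrite uE.
Qed.

(** With m = n + 2 this is m ^ a * m! / (a * (a + 1) * ... * (a + m)), see
    [euler_gamma_seqE]: Euler's limit for Gamma. *)
Definition euler_gamma_seq a n : C := Cpow n.+2%:R a * CBeta a (1 + n.+2%:R).

Lemma euler_gamma_cvg a : 0 < Re a ->
  ((fun n => euler_gamma_seq a n) : nat -> R[i]^o) @ \oo --> (CGamma a : R[i]^o).
Proof. by move=> a0; apply: CBeta_cvg_Gamma => //; rewrite Re_1. Qed.

Lemma pochhammer1 n : pochhammer (1 : C) n = n`!%:R.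
Proof.
elim: n => [|n IH]; first by rewrite pochhammer0.
by rewrite pochhammerS IH factS natrM -natr1 mulrC addrC.
Qed.

Lemma euler_gamma_seqE a n : 0 < Re a ->
  euler_gamma_seq a n * pochhammer a n.+3 = Cpow n.+2%:R a * n.+2`!%:R.
Proof.
move=> a0; have r1 : 0 < Re (1 : C) by rewrite Re_1.
have e := CBetaDn n.+2 a0 r1; rewrite pochhammer1 in e.
rewrite /euler_gamma_seq pochhammerSl.
move: e; move: (CBeta a (1 + n.+2%:R)) (pochhammer (a + 1) n.+2) (Cpow n.+2%:R a) => X Y Z e.
have -> : Z * X * (a * Y) = Z * (a * (Y * X)) by ring.
by rewrite e [a * _]mulrCA CBeta1 // mulr1.
Qed.

Lemma ratio_cvg1 z w : 0 < Re w ->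
  ((fun n => (z + n.+2%:R) / (w + n.+2%:R)) : nat -> R[i]^o) @ \oo --> (1 : R[i]^o).
Proof.
move=> w0.
apply: (@Ccvg_le _ _ _ (fun n => Cabs (z - w) * n.+2%:R^-1)).
  apply: nearW => n; have wn : w + n.+2%:R != 0 by apply: Re_gt0_neq0; exact: Re_addn.
  have -> : (z + n.+2%:R) / (w + n.+2%:R) - 1 = (z - w) / (w + n.+2%:R).
    by move: (n.+2%:R : C) wn => N wn; field.
  rewrite CabsM CabsV; apply: ler_wpM2l; first exact: Cabs_ge0.
  rewrite lef_pV2 ?posrE ?Cabs_gt0 //.
  apply: le_trans (Re_le_Cabs _); apply: le_trans (ler_norm _).
  by rewrite ReD Re_nat lerDr ltW.
by rewrite -(mulr0 (Cabs (z - w))); apply: cvgM; [exact: cvg_cst|exact: (@cvg_inv2 R)].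
Qed.

(** Euler's sequences for a + 1 and a differ by the factor a * m / (a + 1 + m). *)
Lemma CGamma_recursion a : 0 < Re a -> CGamma (a + 1) = a * CGamma a.
Proof.
move=> a0; have a1 : 0 < Re (a + 1) by rewrite ReD Re_1; lra.
have h1 := euler_gamma_cvg a1.
have h2 := Ccvg_M (Ccvg_Z a (euler_gamma_cvg a0)) (ratio_cvg1 0 a1).
rewrite mulr1 in h2; apply: (Ccvg_unique h1); apply: Ccvg_ext _ _ h2 => // n.
have p1 := pochhammer_neq0 n.+3 a1.
apply: (mulIf p1); rewrite euler_gamma_seqE // add0r.
have wn : a + 1 + n.+2%:R != 0 by apply: Re_gt0_neq0; exact: Re_addn.
have Nn : (n.+2%:R : C) != 0 by rewrite pnatr_eq0.
have := euler_gamma_seqE n a0; rewrite pochhammerSl (@pochhammerS _ (a + 1) n.+2) CpowD // Cpow1 //.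
move: (pochhammer (a + 1) n.+2) (euler_gamma_seq a n) wn => Y X wn e.
have -> : a * X * (n.+2%:R / (a + 1 + n.+2%:R)) * (Y * (a + 1 + n.+2%:R)) =
   (X * (a * Y)) * n.+2%:R.
  by move: (n.+2%:R : C) wn => N wn; field.
by rewrite e; ring.
Qed.

Lemma CGamma_addn a n : 0 < Re a -> CGamma (a + n%:R) = pochhammer a n * CGamma a.
Proof.
move=> a0; elim: n => [|n IH]; first by rewrite addr0 pochhammer0 mul1r.
by rewrite -natr1 addrA CGamma_recursion ?Re_addn // IH pochhammerS; ring.
Qed.

(** Euler's sequences satisfy this identity up to the factor
    (b + m) / (a + b + m), which tends to 1; no double integral is involved. *)
Lemma CBeta_Gamma a b : 0 < Re a -> 0 < Re b ->
  CGamma (a + b) * CBeta a b = CGamma a * CGamma b.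
Proof.
move=> a0 b0; have ab0 : 0 < Re (a + b) by rewrite ReD addr_gt0.
have h1 := Ccvg_M (euler_gamma_cvg ab0) (Ccvg_cst (CBeta a b)).
have h2 := Ccvg_M (Ccvg_M (CBeta_cvg_Gamma a0 b0) (euler_gamma_cvg b0)) (ratio_cvg1 b ab0).
rewrite mulr1 in h2; apply: (Ccvg_unique h1); apply: Ccvg_ext _ _ h2 => // n.
have wn : a + b + n.+2%:R != 0 by apply: Re_gt0_neq0; exact: Re_addn.
have bn : b + n.+2%:R != 0 by apply: Re_gt0_neq0; exact: Re_addn.
have Nn : (n.+2%:R : C) != 0 by rewrite pnatr_eq0.
have p1 := pochhammer_neq0 n.+2 ab0; have p2 := pochhammer_neq0 n.+2 b0.
have e1 := euler_gamma_seqE n ab0; have e2 := euler_gamma_seqE n b0.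
have e3 := CBetaDn n.+2 a0 b0.
rewrite (@pochhammerS _ _ n.+2) in e1; rewrite (@pochhammerS _ _ n.+2) in e2.
rewrite CpowD // in e1.
move: (pochhammer (a + b) n.+2) (pochhammer b n.+2) p1 p2 e1 e2 e3 => P Q p1 p2 e1 e2 e3.
move: (euler_gamma_seq (a + b) n) (euler_gamma_seq b n) e1 e2 => X Y e1 e2.
move: (CBeta a (b + n.+2%:R)) (CBeta a b) e3 => U V e3.
move: (Cpow n.+2%:R a) (Cpow n.+2%:R b) (n.+2`!%:R) e1 e2 => S T F e1 e2.
have e4 : T * F = Y * (Q * (b + n.+2%:R)) by rewrite e2.
have e5 : X * (P * (a + b + n.+2%:R)) = S * (Y * (Q * (b + n.+2%:R))).
  by rewrite -e4 e1; ring.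
apply: (mulIf (mulf_neq0 p1 wn)).
have -> : X * V * (P * (a + b + n.+2%:R)) = X * (P * (a + b + n.+2%:R)) * V by ring.
have -> : S * U * Y * ((b + n.+2%:R) / (a + b + n.+2%:R)) * (P * (a + b + n.+2%:R)) =
  S * Y * (b + n.+2%:R) * (P * U).
  by move: (n.+2%:R : C) wn => N wn; field.
by rewrite e5 e3; ring.
Qed.

(** ** Gamma has no zeros *)

(** |a + i| / (Re a + i) <= exp (Im a ^ 2 / (Re a + i) ^ 2), and the series of
    these exponents converges. *)
Lemma pochhammer_le_real a : 0 < Re a -> exists2 D : R, 0 < D &
  forall n, Cabs (pochhammer a n) <= D * Cabs (pochhammer (Re a)%:C n).
Proof.
move=> x0; set x := Re a in x0 *; set y := Im a.
pose S n : R := \sum_(0 <= i < n) (x + i%:R)^-1 ^+ 2.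
have xi i : 0 < x + i%:R by rewrite ltr_pwDl.
(* 1 / (x + m + 1) ^ 2 is at most the difference 1 / (x + m) - 1 / (x + m + 1),
   which telescopes *)
have hS m : S m.+1 <= x^-1 ^+ 2 + x^-1 - (x + m%:R)^-1.
  elim: m => [|m IHm].
    by rewrite /S big_nat1 addr0; lra.
  rewrite /S big_nat_recr //= -/(S m.+1); apply: le_trans (lerD IHm (lexx _)) _.
  have h1 := xi m; have h2 := xi m.+1.
  have e : (x + m%:R)^-1 - (x + m.+1%:R)^-1 = (x + m%:R)^-1 * (x + m.+1%:R)^-1.
    rewrite -natr1; rewrite -natr1 in h2; move: (m%:R) h1 h2 => r h1 h2; field.
    by rewrite !lt0r_neq0 //; move: h2; rewrite addrA.
  have le : (x + m.+1%:R)^-1 <= (x + m%:R)^-1.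
    by rewrite lef_pV2 ?posrE // lerD2l ler_nat.
  have i0 : 0 <= (x + m.+1%:R)^-1 by rewrite invr_ge0 ltW.
  move: e le i0; move: ((x + m%:R)^-1) ((x + m.+1%:R)^-1) => p q e le i0.
  rewrite expr2; nra.
have hS' m : S m <= x^-1 ^+ 2 + x^-1.
  case: m => [|m].
    by rewrite /S big_nil addr_ge0 ?exprn_ge0 ?invr_ge0 ?ltW.
  apply: le_trans (hS m) _; rewrite gerDl oppr_le0 invr_ge0 ltW //.
have key m : Cabs (pochhammer a m) <= expR (y ^+ 2 * S m) * Cabs (pochhammer x%:C m).
  elim: m => [|m IHm].
    by rewrite !pochhammer0 /S big_nil mulr0 expR0 mul1r.
  rewrite !pochhammerS !CabsM /S big_nat_recr //= mulrDr expRD -/(S m).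
  have -> : x%:C + m%:R = (x + m%:R)%:C :> C by rewrite rmorphD /= rmorph_nat.
  rewrite Cabs_real gtr0_norm //.
  have h : Cabs (a + m%:R) <= expR (y ^+ 2 * (x + m%:R)^-1 ^+ 2) * (x + m%:R).
    set v := y ^+ 2 * _; have h1 := xi m.
    have v0 : 0 <= v by rewrite mulr_ge0 // ?sqr_ge0 // exprn_ge0 // invr_ge0 ltW.
    rewrite -ler_sqr ?nnegrE ?Cabs_ge0 ?mulr_ge0 ?expR_ge0 ?(ltW h1) //.
    rewrite sqr_Cabs ReD ImD Re_nat Im_nat addr0 -/x -/y exprMn.
    have -> : (x + m%:R) ^+ 2 + y ^+ 2 = (1 + v) * (x + m%:R) ^+ 2.
      by rewrite /v; move: (m%:R) h1 => r h1; field; exact: lt0r_neq0.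
    rewrite ler_wpM2r ?sqr_ge0 //.
    have e1 := expR_ge1Dx v; have : 1 <= expR v by lra.
    nra.
  have -> : forall A B G H : R, A * B * (G * H) = (A * G) * (B * H) by move=> *; ring.
  by apply: ler_pM; rewrite ?Cabs_ge0.
exists (expR (y ^+ 2 * (x^-1 ^+ 2 + x^-1))); first exact: expR_gt0.
move=> m; apply: le_trans (key m) _; rewrite ler_wpM2r ?Cabs_ge0 // ler_expR.
by rewrite ler_wpM2l ?sqr_ge0.
Qed.

(** The integrand is positive, and bounded below on [1, 2]. *)
Lemma CGamma_real_neq0 x : 0 < x -> CGamma x%:C != 0.
Proof.
move=> x0; suff h : 0 < Re (CGamma x%:C) by exact: Re_gt0_neq0.
pose f t : R := t `^ (x - 1) * expR (- t).
have rE : Re (CGamma x%:C) = Rintegral mu hl f.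
  apply: eq_Rintegral => t /set_mem/hlP t0.
  rewrite CpowE ?Re_gt0_neq0 // Clog_real // -CexpD /f powR_pos // -expRD /=.
  by rewrite !(mulr0, mul0r, subr0, addr0, oppr0, cos0, mulr1).
have iF : Rintegrable hl f.
  apply: (Rintegrable_ext (@measurable_hl R) _ (Rintegrable_gmaj 0 x0 (@ltr01 R))).
  by move=> t /hlP t0; rewrite /gmaj powRr0 mulr1 mul1r.
(* a lower bound of t ^ (x - 1) * exp (- t) on [1, 2] *)
pose c := expR (- (`|x - 1| * ln 2) - 2); have c0 : 0 < c by exact: expR_gt0.
pose I := `[1, 2]%classic : set R.
have mI : measurable I by exact: measurable_itv.
have hI : hl `&` I = I.
  by apply: setIidr => t; rewrite /I /= in_itv /= => /andP[t1 _]; apply/hlP; lra.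
have iI : Rintegrable I f.
  apply: (@integrableS _ _ _ mu hl I) iF => //.
  by rewrite -hI; exact: subIsetl.
have e1 : Rintegral mu I f <= Rintegral mu hl f.
  rewrite -[X in Rintegral mu X _ <= _]hI Rintegral_mkcondr; apply: le_Rintegral => //.
  - have -> : EFin \o (f \_ I) = (EFin \o f) \_ I by rewrite restrict_EFin.
    by apply: (@integrable_restrict _ _ _ mu I mI hl (@measurable_hl R) _).1; rewrite hI.
  - move=> t /hlP t0; rewrite patchE; case: ifP => // _.
    by rewrite mulr_ge0 ?powR_ge0 ?expR_ge0.
have e2 : Rintegral mu I (fun=> c) <= Rintegral mu I f.
  apply: le_Rintegral => //.
    apply: continuous_compact_integrable; first exact: segment_compact.
    by apply: continuous_subspaceT => t; exact: cvg_cst.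
  move=> t; rewrite /I /= in_itv /= => /andP[t1 t2].
  have t0 : 0 < t by exact: lt_le_trans ltr01 t1.
  rewrite /c /f powR_pos // -expRD ler_expR.
  have l0 : 0 <= ln t by exact: ln_ge0.
  have l1 : ln t <= ln 2 by rewrite ler_ln ?posrE.
  have h1 : `|x - 1| * ln t <= `|x - 1| * ln 2 by rewrite ler_wpM2l.
  have h2 : - (`|x - 1| * ln t) <= (x - 1) * ln t.
    by rewrite -mulNr ler_wpM2r //; have := lerNnormlW (lexx `|x - 1|).
  move: h1 h2; move: (`|x - 1| * ln t) (`|x - 1| * ln 2) ((x - 1) * ln t) => A B D h1 h2.
  clear -h1 h2 t2; lra.
have e3 : Rintegral mu I (fun=> c) = c.
  have m1 : mu I = (2 - 1)%:E.
    by rewrite /I lebesgue_measure_itv /= lte_fin ltr1n /= EFinB.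
  have h := @Rintegral_cst _ _ _ mu I mI c; apply: (etrans h).
  rewrite [X in fine X]m1 /=.
  ring.
by rewrite rE; apply: lt_le_trans e1; apply: lt_le_trans e2; rewrite e3.
Qed.

(** In Euler's sequence, replacing a by Re a changes the modulus of the
    Pochhammer symbol only; hence |Gamma (Re a)| <= D * |Gamma a|. *)
Lemma CGamma_neq0 a : 0 < Re a -> CGamma a != 0.
Proof.
move=> a0; have [D D0 hD] := pochhammer_le_real a0.
have x0 : 0 < Re ((Re a)%:C : C) by [].
have /Ccvg_Cabs_le h := Ccvg_M (Ccvg_cst D%:C) (euler_gamma_cvg a0).
apply/eqP => e.
have : Cabs (CGamma (Re a)%:C) <= 0.
  have bnd n : Cabs (euler_gamma_seq (Re a)%:C n) <= D * Cabs (euler_gamma_seq a n).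
    have p1 : 0 < Cabs (pochhammer (Re a)%:C n.+3) by rewrite Cabs_gt0 pochhammer_neq0.
    rewrite -(ler_pM2r p1) -CabsM (euler_gamma_seqE n x0) CabsM.
    have NC : (n.+2%:R : C) = (n.+2%:R : R)%:C by rewrite rmorph_nat.
    have -> : Cabs (Cpow n.+2%:R (Re a)%:C) = Cabs (Cpow n.+2%:R a).
      by rewrite NC !Cabs_Cpow_real.
    rewrite -CabsM -(euler_gamma_seqE n a0) CabsM.
    by rewrite -[X in _ <= X]mulrA mulrCA ler_wpM2l ?Cabs_ge0.
  apply/ler_addgt0Pl => r r0; rewrite addr0.
  have /Ccvg_Cabs/cvgrPdist_lt c := euler_gamma_cvg a0; rewrite e in c.
  apply: (Ccvg_Cabs_le (euler_gamma_cvg x0)).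
  have rD : 0 < r / D by rewrite divr_gt0.
  apply: filterS (c _ rD) => n; rewrite subr0 sub0r normrN ger0_norm ?Cabs_ge0 // => hn.
  by apply: le_trans (bnd n) _; rewrite mulrC -ler_pdivlMr // ltW.
by rewrite leNgt Cabs_gt0 CGamma_real_neq0.
Qed.

Lemma CBeta_neq0 a b : 0 < Re a -> 0 < Re b -> CBeta a b != 0.
Proof.
move=> a0 b0; apply/eqP => e; have := CBeta_Gamma a0 b0; rewrite e mulr0 => /esym/eqP.
by rewrite mulf_eq0 (negbTE (CGamma_neq0 a0)) (negbTE (CGamma_neq0 b0)).
Qed.

End GammaBeta.

Arguments ratio_cvg1 {R} z {w} _.

(** * Euler's integral for 2F1 and an integral for Phi_1 *)

Section EulerIntegral.
Variable R : realType.
Local Notation C := R[i].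
Local Notation Re := (@complex.Re R).
Local Notation Im := (@complex.Im R).
Local Notation mu := (@lebesgue_measure R).
Local Notation hl := (`]0, +oo[%classic : set R).
Local Notation ui := (`]0, 1[%classic : set R).
Implicit Types (z w l a b c y u : C) (x t p e k : R) (n N : nat).

(** As for the binomial series: the derivative in t of exp (- t w) times the
    truncated series at t w is a single small term. *)
Lemma exp_series w : Cseries_cvg (fun n => w ^+ n / n`!%:R) (Cexp w).
Proof.
pose S N t : C := \sum_(0 <= n < N) (t%:C * w) ^+ n / n`!%:R.
pose g N t := Cexp (t%:C * - w) * S N.+1 t.
pose dg N t := - w * Cexp (t%:C * - w) * ((t%:C * w) ^+ N / N`!%:R).
have dl t : is_Cder (fun s => s%:C * w) t w.
  by have := is_Cder_lin 0 w t; apply: is_Cder_ext => s; rewrite add0r.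
have dl' t : is_Cder (fun s => s%:C * - w) t (- w).
  by have := is_Cder_lin 0 (- w) t; apply: is_Cder_ext => s; rewrite add0r.
have dS N t : is_Cder (S N.+1) t (w * S N t).
  elim: N => [|N IH].
    apply: (is_Cder_ext (f := fun=> 1)).
      by move=> s; rewrite /S big_nat1 expr0 fact0 divr1.
    by rewrite /S big_nil mulr0; exact: is_Cder_cst.
  have e s : S N.+1 s + (N.+1`!%:R)^-1 * (s%:C * w) ^+ N.+1 = S N.+2 s.
    by rewrite /S [RHS]big_nat_recr //=; congr (_ + _); rewrite mulrC.
  apply: (is_Cder_ext e); apply: is_Cder_eq (is_CderD IH (is_CderZ _ (is_CderX N.+1 (dl t)))) _.
  rewrite [in RHS]/S big_nat_recr //= -/(S N t) mulrDr; congr (_ + _).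
  rewrite factS natrM; have := natC_neq0 R N; have := factC_neq0 R N.
  move: (N.+1%:R : C) (N`!%:R : C) => p q p0 q0; field.
  by rewrite p0 q0.
have dgP N t : is_Cder (g N) t (dg N t).
  apply: is_Cder_eq (is_CderM (is_Cder_Cexp (dl' t)) (dS N t)) _.
  by rewrite /dg /S big_nat_recr //=; ring.
have K0 := expR_ge0 (Cabs w).
have bnd N : Cabs (g N 1 - g N 0) <= 2 * (Cabs w * expR (Cabs w)) * exp_coeff (Cabs w) N.
  have -> : 2 * (Cabs w * expR (Cabs w)) * exp_coeff (Cabs w) N =
    2 * (Cabs w * expR (Cabs w) * exp_coeff (Cabs w) N) * (1 - 0) by ring.
  apply: (Cder_mean_value (df := dg N)) => // t /andP[t0 t1].
  rewrite /dg (CabsM (- w * _)) (CabsM (- w)) CabsN (CabsM (_ ^+ N)) CabsX CabsV Cabs_nat.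
  apply: ler_pM; rewrite ?mulr_ge0 ?Cabs_ge0 ?invr_ge0 ?exprn_ge0 ?Cabs_ge0 //.
    rewrite ler_wpM2l ?Cabs_ge0 // Cabs_Cexp ler_expR.
    apply: le_trans (ler_norm _) _; apply: le_trans (Re_le_Cabs _) _.
    by rewrite CabsM CabsN Cabs_real ger0_norm // ler_piMl ?Cabs_ge0.
  rewrite /exp_coeff /= ler_wpM2r ?invr_ge0 // lerXn2r ?nnegrE ?Cabs_ge0 //.
  by rewrite CabsM Cabs_real ger0_norm // ler_piMl ?Cabs_ge0.
have cv : (fun N => 2 * (Cabs w * expR (Cabs w)) * exp_coeff (Cabs w) N) @ \oo --> (0 : R).
  rewrite -(mulr0 (2 * (Cabs w * expR (Cabs w)))); apply: cvgM; first exact: cvg_cst.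
  exact: cvg_exp_coeff.
have g0 N : g N 0 = 1.
  rewrite /g /= mul0r Cexp0 mul1r /S big_nat_recl //= mul0r expr0 fact0 divr1.
  by rewrite big1 ?addr0 // => i _; rewrite expr0n /= mul0r.
have cg : ((fun N => g N 1) : nat -> R[i]^o) @ \oo --> (1 : R[i]^o).
  by apply: Ccvg_le cv; apply: nearW => N; rewrite -[X in _ - X](g0 N).
rewrite /Cseries_cvg -(cvg_shiftS (series _)).
apply: Ccvg_ext _ _ (Ccvg_Z (Cexp w) cg); last by rewrite mulr1.
move=> N; rewrite /g mul1r mulrA -CexpD subrr Cexp0 mul1r /S /series /=.
by apply: eq_bigr => i _; rewrite mul1r.
Qed.

Arguments exp_series w : clear implicits.

Lemma sum_exp_le x n : 0 <= x -> \sum_(0 <= i < n) x ^+ i / i`!%:R <= expR x.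
Proof.
move=> x0; have := exp_series x%:C => h.
have hr : series (exp_coeff x) @ \oo --> expR x.
  have /Ccvg_ReIm[h1 _] : ((series (fun n => (x%:C : C) ^+ n / n`!%:R)) : nat -> R[i]^o) @ \oo
    --> (Cexp x%:C : R[i]^o) by exact: h.
  rewrite Cexp_real in h1; apply: Rcvg_near h1; apply: nearW => N.
  rewrite /series /=; elim: N => [|N IH]; first by rewrite !big_nil.
  rewrite !big_nat_recr //= ReD IH; congr (_ + _); rewrite /exp_coeff /=.
  by rewrite -(rmorph_nat (real_complex R)) -fmorphV -rmorphXn -rmorphM.
rewrite -(cvg_lim (@Rhausdorff R) hr); apply: (nondecreasing_cvgn_le _ _ n).
  apply: nondecreasing_series => i _ _; rewrite /exp_coeff /=.
  by rewrite divr_ge0 ?exprn_ge0.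
by apply/cvg_ex; exists (expR x).
Qed.

Lemma CBetaE a b : 0 < Re a -> 0 < Re b -> CBeta a b = CGamma a * CGamma b / CGamma (a + b).
Proof.
move=> a0 b0; have ab : CGamma (a + b) != 0 by rewrite CGamma_neq0 // ReD addr_gt0.
by rewrite -CBeta_Gamma // mulrC mulKf.
Qed.

Lemma CBeta_addl a b n : 0 < Re a -> 0 < Re b ->
  pochhammer (a + b) n * CBeta (a + n%:R) b = pochhammer a n * CBeta a b.
Proof.
move=> a0 b0; have ab0 : 0 < Re (a + b) by rewrite ReD addr_gt0.
rewrite !CBetaE ?Re_addn // addrAC !CGamma_addn //.
have h1 := CGamma_neq0 ab0; have h2 := pochhammer_neq0 n ab0.
by field; rewrite h1 h2.
Qed.

(** ** Euler's integral *)

(** The integrand of Euler's integral for 2F1 [a, b; c; z]. *)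
Definition euler_kernel a b c z t : C :=
  Cpow t%:C (a - 1) * Cpow (1 - t)%:C (c - a - 1) * Cpow (1 - z * t%:C) (- b).

Lemma cut_dist_log_plane z : 0 < cut_dist z -> log_plane z.
Proof.
rewrite /cut_dist; case: ifPn => [h _|_]; first exact: log_plane_Re.
by rewrite normr_gt0; exact: log_plane_Im.
Qed.

Lemma log_plane_add z h : log_plane z -> Cabs h < cut_dist z -> log_plane (z + h).
Proof.
move=> hz hh [e1 e2].
have e1' : Im h = - Im z by move: e1; rewrite ImD; lra.
have i1 : `|Im z| < cut_dist z.
  by apply: le_lt_trans hh; rewrite -normrN -e1' Im_le_Cabs.
move: hh i1; rewrite /cut_dist; case: ifPn => [r0 hh _|_ _]; last by rewrite ltxx.
have : Cabs h ^+ 2 < Cabs z ^+ 2 by rewrite ltr_sqr ?nnegrE ?Cabs_ge0.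
rewrite !sqr_Cabs e1' sqrrN ltrD2r; move: e2; rewrite ReD => e2.
nra.
Qed.

Lemma Im_le_cut_dist z : `|Im z| <= cut_dist z.
Proof. by rewrite /cut_dist; case: ifP => // _; exact: Im_le_Cabs. Qed.

(** Near t = 0 the point 1 - z t is close to 1; away from t = 0 its imaginary
    part is bounded below, unless z is real, and then z < 1. *)
Lemma hyp_plane_cut_dist z : hyp_plane z -> exists2 d, 0 < d &
  forall t, 0 <= t <= 1 -> d <= cut_dist (1 - z * t%:C).
Proof.
move=> hz; have ReE t : Re (1 - z * t%:C) = 1 - Re z * t.
  by rewrite ReD ReN ReM Re_1 /= mulr0 subr0.
have ImE t : Im (1 - z * t%:C) = - (Im z * t).
  by rewrite ImD ImN ImM Im_1 /= mulr0 !add0r.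
have [I0|I0] := eqVneq (Im z) 0.
  have r1 : Re z < 1 by rewrite ltNge; apply/negP => h; apply: hz.
  exists (Num.min 1 (1 - Re z)); first by rewrite lt_min ltr01 subr_gt0.
  move=> t /andP[t0 t1].
  have h1 : Num.min 1 (1 - Re z) <= 1 by rewrite ge_min lexx.
  have h2 : Num.min 1 (1 - Re z) <= 1 - Re z by rewrite ge_min lexx orbT.
  have h3 : Num.min 1 (1 - Re z) <= 1 - Re z * t by nra.
  have h4 : 0 < 1 - Re z * t by apply: lt_le_trans h3; rewrite lt_min ltr01 subr_gt0.
  rewrite /cut_dist ReE h4; apply: le_trans h3 _; rewrite -ReE.
  exact: le_trans (ler_norm _) (Re_le_Cabs _).
have z0 : 0 < Cabs z by rewrite Cabs_gt0; apply/eqP => e; rewrite e Im_0 eqxx in I0.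
have I1 : 0 < `|Im z| by rewrite normr_gt0.
pose d := Num.min 2^-1 (`|Im z| / (2 * Cabs z)).
exists d; first by rewrite lt_min invr_gt0 ltr0n divr_gt0 // mulr_gt0.
move=> t /andP[t0 t1].
have [h|h] := leP (t * Cabs z) 2^-1.
  have hr : 2^-1 <= Re (1 - z * t%:C).
    rewrite ReE; have := Re_le_Cabs z; rewrite ler_norml => /andP[_ h2].
    have : t * Re z <= t * Cabs z by rewrite ler_wpM2l.
    by lra.
  apply: (@le_trans _ _ 2^-1); first by rewrite ge_min lexx.
  rewrite /cut_dist ifT; last by apply: lt_le_trans hr; rewrite invr_gt0.
  apply: le_trans hr _; exact: le_trans (ler_norm _) (Re_le_Cabs _).
apply: le_trans (Im_le_cut_dist _); rewrite ImE normrN normrM (ger0_norm t0).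
apply: (@le_trans _ _ (`|Im z| / (2 * Cabs z))); first by rewrite ge_min lexx orbT.
rewrite ler_wpM2l // invfM ler_pdivrMr // ltW //.
Qed.

Lemma hyp_plane_kernel_bound z b : hyp_plane z -> exists2 K, 0 < K &
  forall t, 0 < t < 1 -> Cabs (Cpow (1 - z * t%:C) b) <= K.
Proof.
move=> hz; have [d d0 hd] := hyp_plane_cut_dist hz.
exists (expR (`|Im b| * pi) * (d `^ Re b + (1 + Cabs z) `^ Re b)).
  by rewrite mulr_gt0 ?expR_gt0 // ltr_pwDl ?powR_ge0 // powR_gt0.
move=> t /andP[t0 t1]; have ht : 0 <= t <= 1 by rewrite !ltW.
have lp : log_plane (1 - z * t%:C).
  by apply: cut_dist_log_plane; apply: lt_le_trans (hd t ht).
apply: le_trans (Cabs_Cpow_le _ (log_plane_neq0 lp)) _.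
rewrite ler_wpM2l ?expR_ge0 //; apply: powR_between => //.
rewrite (le_trans (hd t ht) (cut_dist_le _)) /=.
apply: le_trans (CabsD _ _) _; rewrite Cabs1 lerD2l CabsN CabsM Cabs_real gtr0_norm //.
by rewrite ler_piMr ?Cabs_ge0 // ltW.
Qed.

Lemma Cdiff_1subZ z t : Cdiff (fun s => 1 - z * s%:C) t.
Proof.
have := Cdiff_lin 1 (- z) t; congr (Cdiff _ _).
by apply/funext => s; rewrite mulrN mulrC.
Qed.

Lemma Cdiff_kernel a b c z t : hyp_plane z -> 0 < t < 1 -> Cdiff (euler_kernel a b c z) t.
Proof.
move=> hz /andP[t0 t1]; have [d d0 hd] := hyp_plane_cut_dist hz.
apply: CdiffM; first by apply: CdiffM; [exact: Cdiff_Cpow_real|exact: Cdiff_Cpow_1B].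
apply: Cdiff_Cpow; last exact: Cdiff_1subZ.
by apply: cut_dist_log_plane; apply: lt_le_trans (hd t _); rewrite // !ltW.
Qed.

Lemma Cmeasurable_kernel a b c z : hyp_plane z -> Cmeasurable ui (euler_kernel a b c z).
Proof.
move=> hz; apply: Cmeasurable_diff; first exact: open_ui.
by move=> t /uiP; exact: Cdiff_kernel.
Qed.

Lemma beta_abs a c t : 0 < t < 1 -> Cabs (Cpow t%:C (a - 1) * Cpow (1 - t)%:C (c - a - 1))
  = t `^ (Re a - 1) * (1 - t) `^ (Re (c - a) - 1).
Proof.
move=> /andP[t0 t1]; rewrite CabsM !Cabs_Cpow_real ?subr_gt0 //.
by congr (_ `^ _ * _ `^ _); rewrite ReD ReN Re_1.
Qed.

(** [Cpow_taylor] expands (1 - z t) ^ (- b) around z0, on a disc that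
    [hyp_plane_cut_dist] makes independent of t; a Beta integrand dominates. *)
Lemma analytic_euler a b c : 0 < Re a -> 0 < Re (c - a) ->
  analytic_on (@hyp_plane R) (fun z => Cintegral ui (euler_kernel a b c z)).
Proof.
move=> a0 c0; apply: analytic_integral; first exact: measurable_ui.
move=> z0 hz; have [d d0 hd] := hyp_plane_cut_dist hz.
have [K K0 hK] := hyp_plane_kernel_bound (- b) hz.
have q01 : 0 <= (2^-1 : R) < 1 by lra.
have [M hM] := binc_bound (- - b) q01.
have [B B0 hB] := powM_bmaj (Re a) (Re (c - a)).
pose cf n t := Cpow t%:C (a - 1) * Cpow (1 - t)%:C (c - a - 1) *
   (Cpow (1 - z0 * t%:C) (- b) * binc (- - b) n * (t%:C * (1 - z0 * t%:C)^-1) ^+ n).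
have lp t : 0 < t < 1 -> log_plane (1 - z0 * t%:C).
  move=> /andP[t0 t1]; apply: cut_dist_log_plane; apply: lt_le_trans (hd t _) => //.
  by rewrite !ltW.
exists (d / 2), cf, (fun t => K * M * (B * bmaj (Re a) (Re (c - a)) t)); split.
- by rewrite divr_gt0.
- move=> n; apply: Cmeasurable_diff; first exact: open_ui.
  move=> t /uiP ht; case/andP: (ht) => t0 t1.
  have hl0 := lp t ht.
  apply: CdiffM; first by apply: CdiffM; [exact: Cdiff_Cpow_real|exact: Cdiff_Cpow_1B].
  apply: CdiffM; first by apply: CdiffM; [apply: Cdiff_Cpow => //; exact: Cdiff_1subZ|exact: Cdiff_cst].
  apply: Cdiff_X; apply: CdiffM.
    by have := Cdiff_lin 0 1 t; congr (Cdiff _ _); apply/funext => s; rewrite add0r mulr1.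
  by apply: Cdiff_inv => //; exact: Cdiff_1subZ.
- have mU := @measurable_ui R.
  exact: (RintegrableZ (K * M) mU (RintegrableZ B mU (Rintegrable_bmaj a0 c0))).
- move=> n t /uiP ht; case/andP: (ht) => t0 t1.
  rewrite /cf CabsM beta_abs // CabsM CabsM CabsX.
  have dt : d <= Cabs (1 - z0 * t%:C).
    by apply: le_trans (hd t _) (cut_dist_le _); rewrite !ltW.
  have e1 : Cabs (t%:C * (1 - z0 * t%:C)^-1) * (d / 2) <= 2^-1.
    rewrite CabsM CabsV Cabs_real gtr0_norm //.
    have A0 : 0 < Cabs (1 - z0 * t%:C) by exact: lt_le_trans dt.
    rewrite mulrAC ler_pdivrMr //; nra.
  have -> : forall A E G H I : R, A * (E * G * H ^+ n) * I ^+ n = (E * (G * (H * I) ^+ n)) * A.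
    by move=> A E G H I; rewrite exprMn; ring.
  have b0 : 0 <= t `^ (Re a - 1) * (1 - t) `^ (Re (c - a) - 1) by rewrite mulr_ge0 ?powR_ge0.
  move: (hK t ht) (hM n) (hB t ht) e1.
  move: (Cabs (Cpow (1 - z0 * t%:C) (- b))) (Cabs_ge0 (Cpow (1 - z0 * t%:C) (- b))) => E E0.
  move: (Cabs (binc (- - b) n)) (Cabs_ge0 (binc (- - b) n)) => G G0.
  move: (Cabs (t%:C / (1 - z0 * t%:C))) (Cabs_ge0 (t%:C / (1 - z0 * t%:C))) => H H0.
  move=> h1 h2 h3 e1.
  have e2 : (H * (d / 2)) ^+ n <= 2^-1 ^+ n.
    by rewrite lerXn2r ?nnegrE // mulr_ge0 // ltW // divr_gt0.
  have e3 : 0 <= (H * (d / 2)) ^+ n by rewrite exprn_ge0 // mulr_ge0 // ltW // divr_gt0.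
  have h4 : G * (H * (d / 2)) ^+ n <= M by apply: le_trans h2; rewrite ler_wpM2l.
  by apply: ler_pM => //; [rewrite !mulr_ge0|apply: ler_pM => //; rewrite mulr_ge0].
move=> z zr.
have rec t : 0 < t < 1 -> Cseries_cvg (fun n => cf n t * (z - z0) ^+ n) (euler_kernel a b c z t).
  move=> ht; case/andP: (ht) => t0 t1; have hlp := lp t ht.
  have hh : Cabs (- ((z - z0) * t%:C)) < cut_dist (1 - z0 * t%:C).
    rewrite CabsN CabsM Cabs_real gtr0_norm //.
    apply: lt_le_trans (hd t _); last by rewrite !ltW.
    by have := Cabs_ge0 (z - z0); nra.
  have e1 : 1 - z0 * t%:C + - ((z - z0) * t%:C) = 1 - z * t%:C by ring.
  have := Cseries_cvgZ (Cpow t%:C (a - 1) * Cpow (1 - t)%:C (c - a - 1)) (Cpow_taylor (- b) hlp hh).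
  rewrite e1; apply: Cseries_cvg_ext => n.
  rewrite /cf; have -> : - ((z - z0) * t%:C) = (- t%:C) * (z - z0) by ring.
  have -> : t%:C / (1 - z0 * t%:C) = (- (1 - z0 * t%:C)^-1) * (- t%:C) by ring.
  by rewrite !exprMn; ring.
split; last by move=> t /uiP; exact: rec.
apply: Cmeasurable_diff; first exact: open_ui.
move=> t /uiP ht; case/andP: (ht) => t0 t1.
apply: CdiffM; first by apply: CdiffM; [exact: Cdiff_Cpow_real|exact: Cdiff_Cpow_1B].
apply: Cdiff_Cpow; last exact: Cdiff_1subZ.
have -> : 1 - z * t%:C = 1 - z0 * t%:C + - ((z - z0) * t%:C) by ring.
apply: log_plane_add; first exact: lp.
rewrite CabsN CabsM Cabs_real gtr0_norm //.
apply: lt_le_trans (hd t _); last by rewrite !ltW.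
by have := Cabs_ge0 (z - z0); nra.
Qed.

Lemma Cintegrable_kernel a b c z : 0 < Re a -> 0 < Re (c - a) -> hyp_plane z ->
  Cintegrable ui (euler_kernel a b c z).
Proof.
move=> a0 c0 hz; have [K K0 hK] := hyp_plane_kernel_bound (- b) hz.
apply: (Cintegrable_bmaj K (Re a) (Re (c - a))) => //; first exact: Cmeasurable_kernel.
move=> t ht; rewrite CabsM beta_abs // mulrC ler_wpM2r ?hK // mulr_ge0 ?powR_ge0 //.
Qed.

(** Termwise integration of the binomial series of (1 - z t) ^ (- b): each term
    is a Beta integral. *)
Lemma gauss_series_euler a b c z : 0 < Re a -> 0 < Re (c - a) -> Cabs z < 1 ->
  Cseries_cvg (gauss_term a b c z) ((CBeta a (c - a))^-1 * Cintegral ui (euler_kernel a b c z)).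
Proof.
move=> a0 c0 z1; have z0 := Cabs_ge0 z.
have hz : hyp_plane z.
  by move=> [_ h]; have := le_trans (ler_norm _) (Re_le_Cabs z); rewrite leNgt; nra.
have B0 := CBeta_neq0 a0 c0.
have cc : 0 < Re c by have := addr_gt0 a0 c0; rewrite -ReD addrC subrK.
pose q := (1 + Cabs z) / 2.
have q01 : 0 <= q < 1 by rewrite /q; lra.
have q0 : 0 < q by rewrite /q; lra.
have [M hM] := binc_bound b q01.
have M0 : 0 <= M by apply: le_trans (hM 0%N); rewrite mulr_ge0 ?Cabs_ge0.
have zq : 0 <= Cabs z / q < 1 by rewrite divr_ge0 ?(ltW q0) //= ltr_pdivrMr // /q; lra.
pose bk t := Cpow t%:C (a - 1) * Cpow (1 - t)%:C (c - a - 1).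
have mb : Cmeasurable ui bk := Cintegrable_meas (Cintegrable_beta a0 c0).
have mT n : Cmeasurable ui (fun t => binc b n * (z * t%:C) ^+ n).
  apply: CmeasurableM; first exact: Cmeasurable_cst.
  apply: Cmeasurable_diff; first exact: open_ui.
  move=> t _; apply: Cdiff_X.
  by have := Cdiff_lin 0 z t; congr (Cdiff _ _); apply/funext => s; rewrite add0r mulrC.
have [B Bp hB] := powM_bmaj (Re a) (Re (c - a)).
pose u n t := bk t * (binc b n * (z * t%:C) ^+ n).
have cv : Cseries_cvg (fun n => Cintegral ui (u n)) (Cintegral ui (euler_kernel a b c z)).
  apply: (@Cseries_integral _ ui u _ (fun t => B * bmaj (Re a) (Re (c - a)) t)
    (fun n => M * (Cabs z / q) ^+ n) (M * (1 - Cabs z / q)^-1)).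
  - exact: measurable_ui.
  - by move=> n; exact: CmeasurableM.
  - exact: Cmeasurable_kernel.
  - move=> t /uiP/andP[t0 t1].
    have zt : Cabs (z * t%:C) < 1.
      by rewrite CabsM Cabs_real gtr0_norm //; nra.
    exact: Cseries_cvgZ (binomial_series b zt).
  - exact: (RintegrableZ B (@measurable_ui R) (Rintegrable_bmaj a0 c0)).
  - move=> n t /uiP ht; case/andP: (ht) => t0 t1.
    rewrite /u CabsM /bk beta_abs // (CabsM (binc b n)) CabsX.
    apply: ler_pM; rewrite ?mulr_ge0 ?powR_ge0 ?Cabs_ge0 ?exprn_ge0 ?Cabs_ge0 ?hB //.
    have e : (Cabs z / q) ^+ n * q ^+ n = Cabs z ^+ n.
      by rewrite -exprMn divfK // lt0r_neq0.
    have h1 : Cabs (z * t%:C) ^+ n <= Cabs z ^+ n.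
      rewrite lerXn2r ?nnegrE ?Cabs_ge0 // CabsM Cabs_real gtr0_norm //.
      by rewrite ler_piMr // ltW.
    apply: (@le_trans _ _ (Cabs (binc b n) * Cabs z ^+ n)); first by rewrite ler_wpM2l ?Cabs_ge0.
    rewrite -e mulrCA [M * _]mulrC ler_wpM2l ?exprn_ge0 //; by case/andP: zq.
  - move=> t /uiP/andP[t0 t1]; rewrite mulr_ge0 ?(ltW Bp) // /bmaj addr_ge0 // powR_ge0 //.
  - by move=> n; rewrite -mulr_sumr ler_wpM2l // geometric_sum_le.
apply: Cseries_cvg_ext (Cseries_cvgZ (CBeta a (c - a))^-1 cv) => n.
have -> : Cintegral ui (u n) = binc b n * z ^+ n * CBeta (a + n%:R) (c - a).
  rewrite /CBeta -CintegralZ //; last by apply: Cintegrable_beta => //; exact: Re_addn.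
  apply: eq_Cintegral => t /uiP/andP[t0 t1].
  have tn : t%:C != 0 :> C by exact: Re_gt0_neq0.
  rewrite /u /bk exprMn [a + n%:R - 1]addrAC (@CpowD _ _ (a - 1) n%:R tn) Cpow_nat //; ring.
have e := CBeta_addl n a0 c0; rewrite addrC subrK in e.
have pc := pochhammer_neq0 n cc.
rewrite /gauss_term /binc.
have -> : CBeta (a + n%:R) (c - a) = pochhammer a n * CBeta a (c - a) / pochhammer c n.
  by rewrite -e mulrC mulKf.
by have := factC_neq0 R n; move: (n`!%:R : C) => f f0; field; rewrite f0 pc B0.
Qed.

(** Euler's integral is analytic in the cut plane and equals Gauss's series in
    the unit disc; the segment from 0 to - x avoids the cut. *)
Lemma hyp2F1_euler a b c x : 0 < Re a -> 0 < Re (c - a) -> 0 < x ->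
  CBeta a (c - a) * hyp2F1 a b c (- x%:C) = Cintegral ui (euler_kernel a b c (- x%:C)).
Proof.
move=> a0 c0 x0; have B0 := CBeta_neq0 a0 c0.
pose f z := (CBeta a (c - a))^-1 * Cintegral ui (euler_kernel a b c z).
have hs s : 0 <= s -> hyp_plane (0 + s%:C * - x%:C : C).
  move=> s0 [_]; rewrite add0r mulrN -rmorphM ReN /=.
  have : 0 <= s * x by rewrite mulr_ge0 // ltW.
  lra.
suff -> : hyp2F1 a b c (- x%:C) = f (- x%:C) by rewrite /f mulrA divff // mul1r.
rewrite -[- x%:C]add0r; apply: continuation_segment.
- by apply: analytic_onM; [exact: analytic_cst|exact: analytic_euler].
- move=> z z1; apply/esym/Cseries_sumE; exact: gauss_series_euler.
- by rewrite oppr_eq0 Re_gt0_neq0.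
- by move=> s /andP[s0 _]; exact: hs.
- move=> e e0; pose r := Num.min e 1 / 2.
  have m0 : 0 < Num.min e 1 by rewrite lt_min e0 ltr01.
  have h1 : Num.min e 1 <= e by rewrite ge_min lexx.
  have h2 : Num.min e 1 <= 1 by rewrite ge_min lexx orbT.
  have r0 : 0 < r by rewrite /r; lra.
  exists r%:C; rewrite subr0 /unit_disc /= Cabs_real gtr0_norm // /r.
  split; [lra|by apply: Re_gt0_neq0|lra].
Qed.

(** Euler's kernel for (a + n, c + n) is t ^ n times the one for (a, c), and the
    resulting factors (t y) ^ n / n! sum to exp (t y). *)
Lemma humbert_Phi1_integral a b c x y : 0 < Re a -> 0 < Re (c - a) -> 0 < x ->
  humbert_Phi1 a b c (- x%:C) y =
  (CBeta a (c - a))^-1 * Cintegral ui (fun t => euler_kernel a b c (- x%:C) t * Cexp (t%:C * y)).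
Proof.
move=> a0 c0 x0; have B0 := CBeta_neq0 a0 c0.
have cc : 0 < Re c by have := addr_gt0 a0 c0; rewrite -ReD addrC subrK.
have hx : hyp_plane (- x%:C : C) by move=> [_]; rewrite ReN /=; lra.
apply: Cseries_sumE.
have [K K0 hK] := hyp_plane_kernel_bound (- b) hx.
have [B Bp hB] := powM_bmaj (Re a) (Re (c - a)).
pose u n t := euler_kernel a b c (- x%:C) t * ((t%:C * y) ^+ n / n`!%:R).
have mk := Cmeasurable_kernel a b c hx.
have dy t : Cdiff (fun s => s%:C * y) t.
  by have := Cdiff_lin 0 y t; congr (Cdiff _ _); apply/funext => s; rewrite add0r.
have cv : Cseries_cvg (fun n => Cintegral ui (u n))
   (Cintegral ui (fun t => euler_kernel a b c (- x%:C) t * Cexp (t%:C * y))).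
  apply: (@Cseries_integral _ ui u _ (fun t => K * B * bmaj (Re a) (Re (c - a)) t)
    (fun n => Cabs y ^+ n / n`!%:R) (expR (Cabs y))).
  - exact: measurable_ui.
  - move=> n; apply: CmeasurableM => //; apply: CmeasurableM; last exact: Cmeasurable_cst.
    by apply: Cmeasurable_diff => [|t _]; [exact: open_ui|exact: Cdiff_X].
  - apply: CmeasurableM => //.
    by apply: Cmeasurable_diff => [|t _]; [exact: open_ui|exact: Cdiff_Cexp].
  - by move=> t _; exact: Cseries_cvgZ (exp_series _).
  - exact: (RintegrableZ _ (@measurable_ui R) (Rintegrable_bmaj a0 c0)).
  - move=> n t /uiP ht; case/andP: (ht) => t0 t1.
    rewrite /u CabsM (CabsM (_ ^+ n)) CabsX CabsV Cabs_nat.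
    apply: ler_pM; rewrite ?mulr_ge0 ?invr_ge0 ?exprn_ge0 ?Cabs_ge0 //.
      rewrite CabsM beta_abs // mulrC -mulrA; apply: ler_pM; rewrite ?Cabs_ge0 ?hK ?hB //.
      by rewrite mulr_ge0 ?powR_ge0.
    rewrite ler_wpM2r ?invr_ge0 // lerXn2r ?nnegrE ?Cabs_ge0 // CabsM Cabs_real gtr0_norm //.
    by rewrite ler_piMl ?Cabs_ge0 // ltW.
  - by move=> t _; rewrite !mulr_ge0 ?(ltW K0) ?(ltW Bp) // addr_ge0 // powR_ge0.
  - by move=> n; apply: sum_exp_le; exact: Cabs_ge0.
apply: Cseries_cvg_ext (Cseries_cvgZ (CBeta a (c - a))^-1 cv) => n.
have an := Re_addn n a0.
have can : c + n%:R - (a + n%:R) = c - a by ring.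
have can0 : 0 < Re (c + n%:R - (a + n%:R)) by rewrite can.
have ke t : 0 < t -> euler_kernel (a + n%:R) b (c + n%:R) (- x%:C) t =
    euler_kernel a b c (- x%:C) t * t%:C ^+ n.
  move=> t0; have tn : t%:C != 0 :> C by exact: Re_gt0_neq0.
  by rewrite /euler_kernel can [a + n%:R - 1]addrAC (@CpowD _ _ (a - 1) n%:R tn) Cpow_nat //; ring.
have -> : Cintegral ui (u n) = y ^+ n / n`!%:R *
   Cintegral ui (euler_kernel (a + n%:R) b (c + n%:R) (- x%:C)).
  rewrite -CintegralZ //; last exact: Cintegrable_kernel.
  apply: eq_Cintegral => t /uiP/andP[t0 t1]; rewrite ke // /u exprMn.
  by move: (n`!%:R : C) => f; ring.
rewrite -hyp2F1_euler // can.
have e := CBeta_addl n a0 c0; rewrite [a + (c - a)]addrC subrK in e.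
have pc := pochhammer_neq0 n cc.
have -> : CBeta (a + n%:R) (c - a) = pochhammer a n * CBeta a (c - a) / pochhammer c n.
  by rewrite -e mulrC mulKf.
move: (hyp2F1 _ _ _ _) => F.
by have := factC_neq0 R n; move: (n`!%:R : C) => f f0; field; rewrite f0 pc B0.
Qed.

End EulerIntegral.

(** * Kummer's U on the imaginary axis *)

Section Kummer.
Variable R : realType.
Local Notation C := R[i].
Local Notation Re := (@complex.Re R).
Local Notation Im := (@complex.Im R).
Local Notation mu := (@lebesgue_measure R).
Local Notation hl := (`]0, +oo[%classic : set R).
Implicit Types (z w l a b c u A B q : C) (x t s p e k r : R) (n N : nat).

Lemma analytic_onS (D D' : set C) (f : C -> C) : D' `<=` D -> analytic_on D f -> analytic_on D' f.
Proof. by move=> s h z /s; exact: h. Qed.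

Lemma powR_growth d L p (y r : R) : 0 < d -> 0 < L -> 0 <= r -> d <= y <= L * (1 + r) ->
  y `^ p <= (d `^ p + L `^ p) * (1 + r) `^ `|p|.
Proof.
move=> d0 L0 r0 h; have r1 : 0 < 1 + r by lra.
apply: le_trans (powR_between p d0 h) _.
have h1 : 1 <= (1 + r) `^ `|p|.
  by rewrite powR_pos // -[leLHS]expR0 ler_expR mulr_ge0 // ln_ge0 // lerDl.
have h2 : (1 + r) `^ p <= (1 + r) `^ `|p|.
  by rewrite !powR_pos // ler_expR ler_wpM2r ?ler_norm // ln_ge0 // lerDl.
rewrite mulrDl; apply: lerD; first by rewrite ler_peMr // powR_ge0.
by rewrite (powRM _ (ltW L0) (ltW r1)) ler_wpM2l // powR_ge0.
Qed.

(** The substitution r = z t in the Laplace integral of U (A, B, z) gives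
    z ^ (- A - q) / Gamma A times the integral of this kernel in r, where
    q = B - A - 1. In this form z may be any point of the cut plane. *)
Definition kummer_kernel A q z t : C := Cpow t%:C (A - 1) * Cexp (- t%:C) * Cpow (z + t%:C) q.

(** A shift to the right moves z away from the cut. *)
Lemma cut_dist_addr z t : 0 <= t -> cut_dist z <= cut_dist (z + t%:C).
Proof.
move=> t0; have [z0|z0] := ltP 0 (Re z).
  rewrite /cut_dist z0 ReD /= ifT; last by lra.
  rewrite -ler_sqr ?nnegrE ?Cabs_ge0 // !sqr_Cabs ReD ImD /= addr0 lerD2r.
  by rewrite ler_sqr ?nnegrE; lra.
rewrite {1}/cut_dist ifN -?leNgt //.
by apply: le_trans (Im_le_cut_dist _); rewrite ImD /= addr0.
Qed.

Lemma Cpow_addr_bound z q : log_plane z -> exists2 K, 0 < K & forall t, 0 <= t ->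
  Cabs (Cpow (z + t%:C) q) <= K * (1 + t) `^ `|Re q|.
Proof.
move=> hz; have d0 := cut_dist_gt0 hz; have z0 := Cabs_ge0 z.
have L0 : 0 < 1 + Cabs z by lra.
exists (expR (`|Im q| * pi) * (cut_dist z `^ Re q + (1 + Cabs z) `^ Re q)).
  by rewrite mulr_gt0 ?expR_gt0 // ltr_pwDl ?powR_ge0 // powR_gt0.
move=> t t0; have h := cut_dist_addr z t0.
have zt : z + t%:C != 0.
  by rewrite -Cabs_gt0; apply: lt_le_trans (cut_dist_le _); apply: lt_le_trans h.
apply: le_trans (Cabs_Cpow_le _ zt) _; rewrite -mulrA ler_wpM2l ?expR_ge0 //.
apply: powR_growth => //; rewrite (le_trans h (cut_dist_le _)) /=.
apply: le_trans (CabsD _ _) _; rewrite Cabs_real ger0_norm //.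
have : 0 <= Cabs z * t by rewrite mulr_ge0.
lra.
Qed.

Lemma Cdiff_addr z t : Cdiff (fun s => z + s%:C) t.
Proof. by have := Cdiff_lin z 1 t; congr (Cdiff _ _); apply/funext => s; rewrite mulr1. Qed.

Lemma Cdiff_Cexp_opp t : Cdiff (fun s => Cexp (- s%:C : C)) t.
Proof.
by have := Cdiff_Cexp_scale (1 : R) t; congr (Cdiff _ _); apply/funext => s; rewrite mul1r.
Qed.

Lemma log_plane_addr z t : log_plane z -> 0 <= t -> log_plane (z + t%:C).
Proof.
move=> hz t0; apply: cut_dist_log_plane; apply: lt_le_trans (cut_dist_addr z t0).
exact: cut_dist_gt0.
Qed.

Lemma kummer_weight_abs A t : 0 < t ->
  Cabs (Cpow t%:C (A - 1) * Cexp (- t%:C)) = t `^ (Re A - 1) * expR (- (1 * t)).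
Proof.
by move=> t0; rewrite CabsM Cabs_Cpow_real // Cabs_Cexp ReD !ReN Re_1 mul1r.
Qed.

Lemma Cmeasurable_kummer A q z : log_plane z -> Cmeasurable hl (kummer_kernel A q z).
Proof.
move=> hz; apply: Cmeasurable_diff; first exact: open_hl.
move=> t /hlP t0; apply: CdiffM.
  by apply: CdiffM; [exact: Cdiff_Cpow_real|exact: Cdiff_Cexp_opp].
by apply: Cdiff_Cpow; [apply: log_plane_addr => //; exact: ltW|exact: Cdiff_addr].
Qed.

Lemma Cintegrable_kummer A q z : 0 < Re A -> log_plane z ->
  Cintegrable hl (kummer_kernel A q z).
Proof.
move=> A0 hz; have [K K0 hK] := Cpow_addr_bound q hz.
apply: (Cintegrable_gmaj K (Re A) `|Re q| 1) => //; first exact: Cmeasurable_kummer.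
move=> t t0; rewrite CabsM kummer_weight_abs // /gmaj.
have h := hK t (ltW t0).
have -> : forall X1 X2 X3 : R, K * (X1 * X2 * X3) = X1 * X3 * (K * X2) by move=> *; ring.
by rewrite ler_wpM2l // mulr_ge0 ?powR_ge0 ?expR_ge0.
Qed.

(** Taylor expansion of (z + t) ^ q around z0, within half the distance to the
    cut, dominated by a Gamma integrand. *)
Lemma analytic_kummer_kernel A q : 0 < Re A ->
  analytic_on (@log_plane R) (fun z => Cintegral hl (kummer_kernel A q z)).
Proof.
move=> A0; apply: analytic_integral; first exact: measurable_hl.
move=> z0 hz; have [K K0 hK] := Cpow_addr_bound q hz.
have d0 := cut_dist_gt0 hz; set d := cut_dist z0 in d0.
have q01 : 0 <= (2^-1 : R) < 1 by lra.
have [M hM] := binc_bound (- q) q01.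
pose cf n t := Cpow t%:C (A - 1) * Cexp (- t%:C) *
  (Cpow (z0 + t%:C) q * binc (- q) n * (- (z0 + t%:C)^-1) ^+ n).
exists (d / 2), cf, (fun t => K * M * gmaj (Re A) `|Re q| 1 t); split.
- by rewrite divr_gt0.
- move=> n; apply: Cmeasurable_diff; first exact: open_hl.
  move=> t /hlP t0; have lp := log_plane_addr hz (ltW t0).
  apply: CdiffM; first by apply: CdiffM; [exact: Cdiff_Cpow_real|exact: Cdiff_Cexp_opp].
  apply: CdiffM.
    by apply: CdiffM; [apply: Cdiff_Cpow => //; exact: Cdiff_addr|exact: Cdiff_cst].
  apply: Cdiff_X; have [l hl'] : Cdiff (fun s => (z0 + s%:C)^-1) t.
    by apply: Cdiff_inv => //; exact: Cdiff_addr.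
  by exists (- l); exact: is_CderN.
- exact: (RintegrableZ _ (@measurable_hl R) (@Rintegrable_gmaj R _ _ _ A0 ltr01)).
- move=> n t /hlP t0; have h := hK t (ltW t0).
  have dt : d <= Cabs (z0 + t%:C).
    by apply: le_trans (cut_dist_le _); exact: cut_dist_addr (ltW t0).
  have At : 0 < Cabs (z0 + t%:C) by exact: lt_le_trans dt.
  rewrite /cf CabsM kummer_weight_abs // CabsM (CabsM (Cpow _ _)) CabsX CabsN CabsV /gmaj.
  have e1 : (Cabs (z0 + t%:C))^-1 * (d / 2) <= 2^-1.
    by rewrite mulrA ler_piMl ?invr_ge0 // mulrC ler_pdivrMr // mul1r.
  move: e1; have : 0 <= (Cabs (z0 + t%:C))^-1 by rewrite invr_ge0 ltW.
  move: ((Cabs (z0 + t%:C))^-1) => H H0 e1.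
  have e2 : (H * (d / 2)) ^+ n <= 2^-1 ^+ n.
    by rewrite lerXn2r ?nnegrE // mulr_ge0 // ltW // divr_gt0.
  have e3 : 0 <= (H * (d / 2)) ^+ n by rewrite exprn_ge0 // mulr_ge0 // ltW // divr_gt0.
  have h4 : Cabs (binc (- q) n) * (H * (d / 2)) ^+ n <= M.
    by apply: le_trans (hM n); rewrite ler_wpM2l ?Cabs_ge0.
  have h5 : Cabs (Cpow (z0 + t%:C) q) * (Cabs (binc (- q) n) * (H * (d / 2)) ^+ n) <=
     K * (1 + t) `^ `|Re q| * M.
    by apply: ler_pM; rewrite ?mulr_ge0 ?Cabs_ge0.
  have w0 : 0 <= t `^ (Re A - 1) * expR (- (1 * t)) by rewrite mulr_ge0 ?powR_ge0 ?expR_ge0.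
  have := ler_wpM2l w0 h5; rewrite exprMn.
  move: (t `^ _) (expR _) (Cabs (Cpow _ _)) (Cabs (binc _ _)) (H ^+ n) ((d / 2) ^+ n)
    ((1 + t) `^ _) => X1 X2 X3 X4 X5 X6 X7 hh.
  have -> : X1 * X2 * (X3 * X4 * X5) * X6 = X1 * X2 * (X3 * (X4 * (X5 * X6))) by ring.
  by have -> : K * M * (X1 * X7 * X2) = X1 * X2 * (K * X7 * M) by ring.
move=> z zr.
have zd : Cabs (z - z0) < d by lra.
have hzz : log_plane z by have := log_plane_add hz zd; rewrite addrC subrK.
split; first exact: Cmeasurable_kummer.
move=> t /hlP t0; have lp := log_plane_addr hz (ltW t0).
have hh : Cabs (z - z0) < cut_dist (z0 + t%:C).
  by apply: lt_le_trans (cut_dist_addr z0 (ltW t0)).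
have := Cseries_cvgZ (Cpow t%:C (A - 1) * Cexp (- t%:C)) (Cpow_taylor q lp hh).
have -> : z0 + t%:C + (z - z0) = z + t%:C by ring.
by apply: Cseries_cvg_ext => n; rewrite /cf; ring.
Qed.

Lemma Re_1Dr t : 0 <= t -> 0 < Re (1 + t%:C : C).
Proof. by move=> t0; rewrite ReD Re_1 /=; lra. Qed.

(** The integrand of [kummerU_integral], where q = B - A - 1. *)
Definition kummer_laplace A q z t : C :=
  Cexp (- (z * t%:C)) * Cpow t%:C (A - 1) * Cpow (1 + t%:C) q.

Lemma kummer_laplace_abs A q z t : 0 < t -> Cabs (kummer_laplace A q z t) = gmaj (Re A) (Re q) (Re z) t.
Proof.
move=> t0; have e : 1 + t%:C = (1 + t)%:C :> C by rewrite rmorphD rmorph1.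
rewrite /kummer_laplace CabsM CabsM Cabs_Cexp Cabs_Cpow_real // e Cabs_Cpow_real; last by lra.
by rewrite /gmaj ReD !ReN ReM Re_1 /= mulr0 subr0; ring.
Qed.

Lemma Cdiff_Cexp_mul z t : Cdiff (fun s => Cexp (- (z * s%:C))) t.
Proof.
apply: Cdiff_Cexp; have := Cdiff_lin 0 (- z) t; congr (Cdiff _ _).
by apply/funext => s; rewrite add0r mulrN mulrC.
Qed.

Lemma Cmeasurable_laplace A q z : Cmeasurable hl (kummer_laplace A q z).
Proof.
apply: Cmeasurable_diff; first exact: open_hl.
move=> t /hlP t0; apply: CdiffM.
  by apply: CdiffM; [exact: Cdiff_Cexp_mul|exact: Cdiff_Cpow_real].
apply: Cdiff_Cpow; last exact: Cdiff_addr.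
by apply: log_plane_Re; exact: Re_1Dr (ltW t0).
Qed.

(** Half of the decay exp (- z0 t) absorbs the expansion of
    exp (- (z - z0) t). *)
Lemma analytic_laplace A q : 0 < Re A ->
  analytic_on (@right_half_plane R) (fun z => Cintegral hl (kummer_laplace A q z)).
Proof.
move=> A0; apply: analytic_integral; first exact: measurable_hl.
move=> z0 hz; rewrite /right_half_plane /= in hz.
pose r := Re z0 / 2; have r0 : 0 < r by rewrite divr_gt0.
pose cf n t := kummer_laplace A q z0 t * ((- t%:C) ^+ n / n`!%:R).
exists r, cf, (gmaj (Re A) (Re q) r); split => //.
- move=> n; apply: CmeasurableM; first exact: Cmeasurable_laplace.
  apply: CmeasurableM; last exact: Cmeasurable_cst.
  apply: Cmeasurable_diff => [|t _]; first exact: open_hl.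
  apply: Cdiff_X; have := Cdiff_lin 0 (-1) t; congr (Cdiff _ _).
  by apply/funext => s; rewrite add0r mulrN1.
- exact: Rintegrable_gmaj.
- move=> n t /hlP t0; rewrite /cf CabsM kummer_laplace_abs // CabsM CabsX CabsN Cabs_real.
  rewrite gtr0_norm // CabsV Cabs_nat.
  have e : gmaj (Re A) (Re q) r t = gmaj (Re A) (Re q) (Re z0) t * expR (r * t).
    have er : - (r * t) = - (Re z0 * t) + r * t by rewrite /r; field.
    by rewrite /gmaj er expRD mulrA.
  rewrite e -mulrA ler_wpM2l ?gmaj_ge0 // mulrAC -exprMn.
  have rt : 0 <= t * r by rewrite mulr_ge0 // ltW.
  have := sum_exp_le n.+1 rt; rewrite big_nat_recr //= mulrC => h; apply: le_trans h.
  by rewrite lerDr sumr_ge0 // => i _; rewrite divr_ge0 // exprn_ge0 // mulrC.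
move=> z zr; split; first exact: Cmeasurable_laplace.
move=> t /hlP t0.
have := Cseries_cvgZ (kummer_laplace A q z0 t) (@exp_series R (- t%:C * (z - z0))).
have -> : kummer_laplace A q z0 t * Cexp (- t%:C * (z - z0)) = kummer_laplace A q z t.
  rewrite /kummer_laplace.
  have -> : - (z * t%:C) = - (z0 * t%:C) + - t%:C * (z - z0) by ring.
  by rewrite CexpD; ring.
by apply: Cseries_cvg_ext => n; rewrite /cf exprMn; move: (n`!%:R : C)^-1 => f; ring.
Qed.

(** The analytic function on the cut plane that continues U. *)
Definition kummer_ext A q z : C := (CGamma A)^-1 * (Cpow z (- (A + q)) * Cintegral hl (kummer_kernel A q z)).

Lemma analytic_kummer_ext A q : 0 < Re A -> analytic_on (@log_plane R) (kummer_ext A q).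
Proof.
move=> A0; apply: analytic_onM; first exact: analytic_cst.
by apply: analytic_onM; [exact: analytic_Cpow|exact: analytic_kummer_kernel].
Qed.

Lemma kummer_kernel_scale A q z x : 0 < Re A -> log_plane z -> 0 < x ->
  Cintegral hl (kummer_kernel A q (x%:C * z)) = Cpow x%:C (A + q) *
   Cintegral hl (fun t => Cpow t%:C (A - 1) * Cexp (- (x * t)%:C) * Cpow (z + t%:C) q).
Proof.
move=> A0 hz x0; have xn : x%:C != 0 :> C by exact: Re_gt0_neq0.
have hxz : log_plane (x%:C * z).
  move=> [h1 h2]; apply: hz; move: h1 h2; rewrite ImM ReM /= !mul0r addr0 subr0.
  by move=> /eqP; rewrite mulf_eq0 gt_eqF //= => /eqP -> ; rewrite pmulr_rle0.
have [i1 ->] := Cscale x0 (Cintegrable_kummer q A0 hxz).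
have e t : 0 < t -> kummer_kernel A q (x%:C * z) (x * t) = Cpow x%:C (A + q - 1) *
   (Cpow t%:C (A - 1) * Cexp (- (x * t)%:C) * Cpow (z + t%:C) q).
  move=> t0; rewrite /kummer_kernel Cpow_mulrr //.
  have -> : x%:C * z + (x * t)%:C = x%:C * (z + t%:C) by rewrite rmorphM /=; ring.
  rewrite Cpow_mulr //; last by apply: log_plane_neq0; apply: log_plane_addr => //; exact: ltW.
  have -> : A + q - 1 = (A - 1) + q by ring.
  by rewrite (CpowD (A - 1) q xn); ring.
have -> : Cintegral hl (fun t => kummer_kernel A q (x%:C * z) (x * t)) = Cpow x%:C (A + q - 1) *
  Cintegral hl (fun t => Cpow t%:C (A - 1) * Cexp (- (x * t)%:C) * Cpow (z + t%:C) q).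
  rewrite -CintegralZ //; first by apply: eq_Cintegral => t /hlP; exact: e.
  have := CintegrableZ (Cpow x%:C (A + q - 1))^-1 (@measurable_hl R) i1.
  apply: Cintegrable_ext => [|t /hlP t0]; first exact: measurable_hl.
  by rewrite e // mulKf // Cpow_neq0.
by rewrite mulrA CpowB1 // [X in X * _]mulrC divfK.
Qed.

Lemma kummer_ext_real A q x : 0 < Re A -> 0 < x ->
  kummer_ext A q x%:C = (CGamma A)^-1 * Cintegral hl (kummer_laplace A q x%:C).
Proof.
move=> A0 x0; have xn : x%:C != 0 :> C by exact: Re_gt0_neq0.
have h1 : log_plane (1 : C) by apply: log_plane_Re; rewrite Re_1.
have e := kummer_kernel_scale q A0 h1 x0; rewrite mulr1 in e.
rewrite /kummer_ext e; congr (_ * _).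
rewrite mulrA -CpowD // addNr Cpow0 mul1r.
apply: eq_Cintegral => t _; rewrite /kummer_laplace rmorphM /=; ring.
Qed.

(** On the positive reals this is a change of variable; the segment from 1 to z
    stays in the right half plane. *)
Lemma kummer_ext_RHP A B z : 0 < Re A -> right_half_plane z ->
  kummer_ext A (B - A - 1) z = kummerU_integral A B z.
Proof.
move=> A0 hz; set q := B - A - 1; rewrite /right_half_plane /= in hz.
have agree x : 0 < x -> kummer_ext A q x%:C = kummerU_integral A B x%:C.
  by move=> x0; rewrite kummer_ext_real.
have [->|z1] := eqVneq z 1; first by have := agree 1 ltr01; rewrite rmorph1.
have -> : z = 1 + (z - 1) by ring.
have sub : @right_half_plane R `<=` @log_plane R by move=> w /log_plane_Re.
apply: (@analytic_segment _ (@right_half_plane R)).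
- exact: analytic_onS sub (analytic_kummer_ext q A0).
- apply: analytic_onM; first exact: analytic_cst.
  exact: analytic_laplace.
- by rewrite subr_eq0.
- move=> s /andP[s0 s1]; rewrite /right_half_plane /= ReD ReM ReD ReN Re_1 /= mul0r subr0.
  have [->|sn] := eqVneq s 0; first by rewrite mul0r addr0.
  have sp : 0 < s by rewrite lt_def sn.
  have : 0 < s * Re z by rewrite mulr_gt0.
  by lra.
- move=> e e0; exists (1 + e / 2)%:C; split.
  + rewrite -subr_eq0 rmorphD rmorph1 addrC addKr; apply: Re_gt0_neq0 => /=; lra.
  + by rewrite rmorphD rmorph1 addrC addKr Cabs_real ger0_norm; lra.
  + by apply: agree; lra.
Qed.

(** The horizontal segment from 1 + z to z starts in the right half plane and
    avoids the real axis. *)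
Lemma kummerU_Re0 A B z : 0 < Re A -> Re z = 0 -> Im z != 0 ->
  kummerU A B z = kummer_ext A (B - A - 1) z.
Proof.
move=> A0 rz hz; have -> : z = (1 + z) + -1 by ring.
apply: continuation_segment.
- exact: analytic_kummer_ext.
- by move=> w hw; exact: kummer_ext_RHP.
- by rewrite oppr_eq0 oner_neq0.
- move=> s _; apply: log_plane_Im.
  by rewrite mulrN1 !ImD ImN Im_1 /= add0r oppr0 addr0.
- move=> e e0; exists (1 + z + (e / 2)%:C); split.
  + rewrite /right_half_plane /= !ReD Re_1 rz /=; lra.
  + rewrite -subr_eq0 addrC addKr; apply: Re_gt0_neq0 => /=; lra.
  + by rewrite addrC addKr Cabs_real ger0_norm; lra.
Qed.

(** ** The unit of the imaginary axis *)

(** The unit i or - i; its sign s will be that of lambda. *)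
Definition sgi s : C := 0 +i* s.

Lemma sgi_sqr s : `|s| = 1 -> sgi s * sgi s = -1.
Proof.
move=> h; apply: eqC; rewrite ?ReM ?ImM ?ReN ?ImN ?Re_1 ?Im_1 /=; last by ring.
by rewrite mul0r sub0r -expr2 -real_normK ?num_real // h expr1n.
Qed.

Lemma sgi_neq0 s : `|s| = 1 -> sgi s != 0.
Proof.
move=> h; apply/eqP => e; have := sgi_sqr h; rewrite e mul0r => /eqP.
by rewrite eq_sym oppr_eq0 oner_eq0.
Qed.

Lemma Clog_sgi s : `|s| = 1 -> Clog (sgi s) = 0 +i* (s * (pi / 2)).
Proof.
move=> h; have p0 := pi_gt0 R; have /andP[s1 s2] : - 1 <= s <= 1 by rewrite -ler_norml h.
have -> : sgi s = Cexp (0 +i* (s * (pi / 2))).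
  apply: eqC; rewrite /= expR0 mul1r.
    have [sp|sp] := ltrP 0 s; move: h.
      by rewrite gtr0_norm // => ->; rewrite mul1r cos_pihalf.
    by rewrite ler0_norm // => h; rewrite -[s]opprK h mulN1r cosN cos_pihalf.
  have [sp|sp] := ltrP 0 s; move: h.
    by rewrite gtr0_norm // => ->; rewrite mul1r sin_pihalf.
  by rewrite ler0_norm // => h; rewrite -[s]opprK h mulN1r sinN sin_pihalf.
rewrite CexpK //=; apply/andP; split; nra.
Qed.

Lemma sgiN s : - sgi s = sgi (- s).
Proof. by apply: eqC; rewrite /= ?oppr0. Qed.

(** i s and - i s are inverse to each other, with opposite arguments. *)
Lemma Cpow_sgiN s w : `|s| = 1 -> Cpow (- sgi s) w = Cpow (sgi s) (- w).
Proof.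
move=> h; have h' : `|- s| = 1 by rewrite normrN.
rewrite sgiN !CpowE ?sgi_neq0 // !Clog_sgi //.
have -> : (0 +i* (- s * (pi / 2)) : C) = - (0 +i* (s * (pi / 2))).
  by apply: eqC; rewrite ?ReN ?ImN ?oppr0 // mulNr.
by rewrite mulrN mulNr.
Qed.

Lemma Cpow_sgi_mul_Re s z w : `|s| = 1 -> 0 < Re z ->
  Cpow (sgi s * z) w = Cpow (sgi s) w * Cpow z w.
Proof.
move=> h z0; apply: Cpow_mul; [exact: sgi_neq0|exact: Re_gt0_neq0|].
apply: Clog_mul; [exact: sgi_neq0|exact: Re_gt0_neq0|].
have /andP[a1 a2] := Carg_Re_gt0 z0; rewrite -[Carg (sgi s)]Im_Clog Clog_sgi //=.
have /andP[s1 s2] : - 1 <= s <= 1 by rewrite -ler_norml h.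
have p0 := pi_gt0 R; apply/andP; split; nra.
Qed.

(** Rescaling the kernel by x leaves (- i s + t) ^ q with
    - i s + t = - i s * (1 + i s t): this is the integral that the expansion
    at the endpoint 0 produces. *)
Lemma kummerU_imaginary A B s x : 0 < Re A -> `|s| = 1 -> 0 < x ->
  CGamma A * kummerU A B (- (sgi s * x%:C)) =
  Cpow (sgi s) A * Cintegral hl (fun t => Cpow t%:C (A - 1) * Cexp (- (x * t)%:C)
     * Cpow (1 + sgi s * t%:C) (B - A - 1)).
Proof.
move=> A0 hs x0; set q := B - A - 1.
have G0 := CGamma_neq0 A0; have w0 := sgi_neq0 hs.
have hs' : `|- s| = 1 by rewrite normrN.
have ez : - (sgi s * x%:C) = x%:C * - sgi s by ring.
have sn : s != 0 by rewrite -normr_gt0 hs.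
have hl0 : log_plane (- sgi s) by apply: log_plane_Im; rewrite ImN /= oppr_eq0.
rewrite kummerU_Re0 //; last 2 first.
- by rewrite ez ReM ReN ImN /= oppr0 mulr0 mul0r subr0.
- by rewrite ez ImM ImN ReN /= mul0r addr0 mulf_neq0 ?oppr_eq0 // gt_eqF.
rewrite /kummer_ext mulrA divff // mul1r ez kummer_kernel_scale // mulrA.
have -> : Cpow (x%:C * - sgi s) (- (A + q)) * Cpow x%:C (A + q) = Cpow (sgi s) A * Cpow (sgi s) q.
  have xn : x%:C != 0 :> C by exact: Re_gt0_neq0.
  rewrite Cpow_mulr ?oppr_eq0 // (CpowN _ xn) mulrAC mulVf ?Cpow_neq0 // mul1r.
  by rewrite Cpow_sgiN // opprK CpowD.
rewrite -mulrA; congr (_ * _).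
have i1 : Cintegrable hl (fun t => Cpow t%:C (A - 1) * Cexp (- (x * t)%:C) * Cpow (- sgi s + t%:C) q).
  have [K K0 hK] := Cpow_addr_bound q hl0.
  apply: (Cintegrable_gmaj K (Re A) `|Re q| x) => //.
    apply: Cmeasurable_diff; first exact: open_hl.
    move=> t /hlP t0; apply: CdiffM.
      by apply: CdiffM; [exact: Cdiff_Cpow_real|exact: Cdiff_Cexp_scale].
    by apply: Cdiff_Cpow; [apply: log_plane_addr => //; exact: ltW|exact: Cdiff_addr].
  move=> t t0; rewrite CabsM CabsM Cabs_Cpow_real // Cabs_Cexp /gmaj ReD !ReN Re_1 /=.
  have h := hK t (ltW t0).
  have -> : forall X1 X2 X3 : R, K * (X1 * X2 * X3) = X1 * X3 * (K * X2) by move=> *; ring.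
  by rewrite ler_wpM2l // mulr_ge0 ?powR_ge0 ?expR_ge0.
rewrite -CintegralZ //; apply: eq_Cintegral => t /hlP t0.
rewrite mulrCA; congr (_ * _).
have -> : - sgi s + t%:C = sgi (- s) * (1 + sgi s * t%:C).
  rewrite -sgiN mulrDr mulr1 mulrA mulNr sgi_sqr // opprK mul1r //.
rewrite Cpow_sgi_mul_Re //; last by rewrite ReD ReM Re_1 /= mulr0 mul0r subr0 addr0.
by rewrite -sgiN Cpow_sgiN // mulrA -CpowD // addrN Cpow0 mul1r.
Qed.

End Kummer.

(** * Moving a horizontal segment upwards *)

Section Contour.
Variable R : realType.
Local Notation C := R[i].
Local Notation Re := (@complex.Re R).
Local Notation Im := (@complex.Im R).
Local Notation mu := (@lebesgue_measure R).
Local Notation hl := (`]0, +oo[%classic : set R).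
Local Notation ui := (`]0, 1[%classic : set R).
Implicit Types (z w a b c : C) (t v d L : R) (n N : nat).

Lemma Cpow_growth w d L : 0 < d -> 0 < L -> exists2 K, 0 < K & forall z v, 0 <= v ->
  d <= Cabs z <= L * (1 + v) -> Cabs (Cpow z w) <= K * (1 + v) `^ `|Re w|.
Proof.
move=> d0 L0; exists (expR (`|Im w| * pi) * (d `^ Re w + L `^ Re w)).
  by rewrite mulr_gt0 ?expR_gt0 // ltr_pwDl ?powR_ge0 // powR_gt0.
move=> z v v0 h; have zn : z != 0.
  by rewrite -Cabs_gt0; case/andP: h => h _; exact: lt_le_trans h.
apply: le_trans (Cabs_Cpow_le _ zn) _; rewrite -mulrA ler_wpM2l ?expR_ge0 //.
exact: powR_growth.
Qed.

Lemma Rintegrable_cst_ui (k : R) : Rintegrable ui (fun=> k).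
Proof.
have h := RintegrableZ (k / 2) (@measurable_ui R) (@Rintegrable_bmaj R 1 1 ltr01 ltr01).
apply: Rintegrable_ext h; first exact: measurable_ui.
by move=> t _; rewrite /bmaj !subrr !powRr0 -(natrD _ 1 1) divfK.
Qed.

Section Integrand.
Variables (p q r : C) (x s el : R).
Hypothesis x0 : (0 : R) < x.
Hypothesis hs : `|s| = 1.
Hypothesis el0 : (0 : R) < el.

(** The integrand of Phi_1 [a, b; c; - x, i lambda x], as a function of a complex
    z, for p = a - 1, q = c - a - 1, r = - b and el = |lambda| x. *)
Definition contour_fun z : C :=
  Cpow z p * Cpow (1 - z) q * Cpow (1 + x%:C * z) r * Cexp (sgi s * el%:C * z).
Definition contour_der z : C := contour_fun z *
  (p / z - q / (1 - z) + r * x%:C / (1 + x%:C * z) + sgi s * el%:C).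
Definition contour_dom z := [/\ log_plane z, log_plane (1 - z) & log_plane (1 + x%:C * z)].

Lemma is_Cder_contour f t l : contour_dom (f t) -> is_Cder f t l ->
  is_Cder (fun y => contour_fun (f y)) t (l * contour_der (f t)).
Proof.
move=> [h1 h2 h3] hf.
have d1 : is_Cder (fun y => 1 - f y) t (- l).
  by apply: is_Cder_eq (is_CderB (is_Cder_cst 1 t) hf) _; rewrite sub0r.
have d2 : is_Cder (fun y => 1 + x%:C * f y) t (x%:C * l).
  by apply: is_Cder_eq (is_CderD (is_Cder_cst 1 t) (is_CderZ x%:C hf)) _; rewrite add0r.
have n1 := log_plane_neq0 h1; have n2 := log_plane_neq0 h2; have n3 := log_plane_neq0 h3.
apply: is_Cder_eq (is_CderM (is_CderM (is_CderM (is_Cder_Cpow p hf h1)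
  (is_Cder_Cpow q d1 h2)) (is_Cder_Cpow r d2 h3)) (is_Cder_Cexp (is_CderZ (sgi s * el%:C) hf))) _.
rewrite /contour_der /contour_fun; move: (Cpow _ _) (Cpow _ _) (Cpow _ _) (Cexp _) => X1 X2 X3 X4.
by field; rewrite n1 n2 n3.
Qed.

Lemma Cdiff_contour f t : contour_dom (f t) -> Cdiff f t -> Cdiff (fun y => contour_fun (f y)) t.
Proof. by move=> h [l hf]; eexists; exact: is_Cder_contour hf. Qed.

Lemma Cdiff_contour_der f t : contour_dom (f t) -> Cdiff f t ->
  Cdiff (fun y => contour_der (f y)) t.
Proof.
move=> h hf; apply: CdiffM; first exact: Cdiff_contour.
case: h => h1 h2 h3.
have d1 : Cdiff (fun y => 1 - f y) t by apply: CdiffD; [exact: Cdiff_cst|exact: CdiffN].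
have d2 : Cdiff (fun y => 1 + x%:C * f y) t.
  by apply: CdiffD; [exact: Cdiff_cst|apply: CdiffM; [exact: Cdiff_cst|]].
apply: CdiffD; last exact: Cdiff_cst.
apply: CdiffD.
  apply: CdiffD; first by apply: CdiffM; [exact: Cdiff_cst|exact: Cdiff_inv].
  by apply: CdiffN; apply: CdiffM; [exact: Cdiff_cst|exact: Cdiff_inv].
by apply: CdiffM; [exact: Cdiff_cst|exact: Cdiff_inv].
Qed.

(** The cuts of the three powers lie on the real axis, outside ]0, 1[. *)
Lemma contour_domP t v : (0 < t < 1) || (0 < v) -> contour_dom (t%:C + v%:C * sgi s).
Proof.
have sn : s != 0 by rewrite -normr_gt0 hs.
have rr : Re (t%:C + v%:C * sgi s) = t by rewrite ReD ReM /= mulr0 mul0r subr0 addr0.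
have ii : Im (t%:C + v%:C * sgi s) = v * s by rewrite ImD ImM /= mul0r addr0 add0r.
case/orP => [/andP[t0 t1]|v0].
  split; apply: log_plane_Re; first by rewrite rr.
    by rewrite ReD ReN Re_1 rr; lra.
  by rewrite ReD ReM Re_1 rr /= mul0r subr0; apply: ltr_wpDr => //; rewrite mulr_ge0 // ltW.
have vs : v * s != 0 by rewrite mulf_neq0 // gt_eqF.
split; apply: log_plane_Im; first by rewrite ii.
  by rewrite ImD ImN Im_1 ii sub0r oppr_eq0.
by rewrite ImD ImM Im_1 ii /= mul0r add0r addr0 mulf_neq0 // gt_eqF.
Qed.

Lemma Cabs_contour_point t v : Cabs (t%:C + v%:C * sgi s) = Num.sqrt (t ^+ 2 + v ^+ 2).
Proof.
rewrite CabsE ReD ImD ReM ImM /=; congr Num.sqrt.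
have : s ^+ 2 = 1 by rewrite -real_normK ?num_real // hs expr1n.
by move=> e; rewrite !mulr0 ?mul0r ?subr0 ?addr0 ?add0r exprMn e mulr1.
Qed.

Lemma contour_point_ge t v : `|t| <= Cabs (t%:C + v%:C * sgi s) /\ `|v| <= Cabs (t%:C + v%:C * sgi s).
Proof.
rewrite Cabs_contour_point; split; rewrite -sqrtr_sqr ler_sqrt ?addr_ge0 ?sqr_ge0 //.
  by rewrite lerDl sqr_ge0.
by rewrite lerDr sqr_ge0.
Qed.

Lemma contour_point_le t v : Cabs (t%:C + v%:C * sgi s) <= `|t| + `|v|.
Proof.
by apply: le_trans (Cabs_le _) _; rewrite ReD ImD ReM ImM /= !mulr0 ?mul0r ?subr0 ?addr0 ?add0r
  normrM hs mulr1.
Qed.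

Lemma contour_point1 t v : 1 - (t%:C + v%:C * sgi s) = (1 - t)%:C + (- v)%:C * sgi s.
Proof. by rewrite !rmorphB rmorph1 rmorphN /=; ring. Qed.

Lemma contour_pointx t v : 1 + x%:C * (t%:C + v%:C * sgi s) = (1 + x * t)%:C + (x * v)%:C * sgi s.
Proof. by rewrite rmorphD !rmorphM rmorph1 /=; ring. Qed.

(** i s turns the oscillation into the decay exp (- el v). *)
Lemma contour_exp t v : Cabs (Cexp (sgi s * el%:C * (t%:C + v%:C * sgi s))) = expR (- (el * v)).
Proof.
rewrite Cabs_Cexp; congr expR.
have -> : sgi s * el%:C * (t%:C + v%:C * sgi s) = sgi s * (el * t)%:C - (el * v)%:C.
  rewrite !rmorphM /= mulrDr.
  have -> : sgi s * el%:C * (v%:C * sgi s) = (sgi s * sgi s) * (el%:C * v%:C) by ring.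
  by rewrite sgi_sqr //; ring.
by rewrite ReD ReN ReM /= mul0r mulr0 subr0 add0r.
Qed.

Lemma contour_regular_bound : exists2 K, 0 < K & forall t v, 0 <= t <= 1 -> 0 <= v ->
  Cabs (Cpow (1 + x%:C * (t%:C + v%:C * sgi s)) r) <= K * (1 + v) `^ `|Re r|.
Proof.
have x0p := x0; have L0 : 0 < 1 + x by lra.
have [K K0 h] := Cpow_growth r ltr01 L0; exists K => // t' v' /andP[t0 t1] v0.
apply: h => //; rewrite contour_pointx.
have [h1 _] := contour_point_ge (1 + x * t') (x * v'); have h2 := contour_point_le (1 + x * t') (x * v').
have a0 : 0 <= x * t' by rewrite mulr_ge0 // ltW.
have a1 : 0 <= x * v' by rewrite mulr_ge0 // ltW.
have a2 : x * t' <= x by rewrite ler_piMr // ltW.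
have e1 : `|1 + x * t'| = 1 + x * t' by rewrite ger0_norm //; lra.
have e2 : `|x * v'| = x * v' by rewrite ger0_norm.
rewrite e1 e2 in h2; rewrite e1 in h1.
apply/andP; split; first lra.
apply: le_trans h2 _; lra.
Qed.

(** Half of the exponential decay absorbs the growth of the powers. *)
Lemma contour_far_bound d : 0 < d -> exists2 K, 0 < K & forall t v, 0 <= t <= 1 -> d <= v ->
  Cabs (contour_fun (t%:C + v%:C * sgi s)) <= K * expR (- (el / 2 * v)).
Proof.
move=> d0; have [K1 K10 h1] := Cpow_growth p d0 ltr01; have [K2 K20 h2] := Cpow_growth q d0 ltr01.
have [K3 K30 h3] := contour_regular_bound.
have e0 : 0 < el / 2 by rewrite divr_gt0.
have [K4 K40 h4] := powR_expR_bound (`|Re p| + `|Re q| + `|Re r|) e0.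
exists (K1 * K2 * K3 * K4); first by rewrite !mulr_gt0.
move=> t v ht dv; have v0 : 0 <= v by lra.
rewrite /contour_fun CabsM contour_exp.
have {}h3 := h3 t v ht v0; have {}h4 := h4 v v0; case/andP: ht => t0 t1.
have {}h1 : Cabs (Cpow (t%:C + v%:C * sgi s) p) <= K1 * (1 + v) `^ `|Re p|.
  apply: h1 => //; have [_ g1] := contour_point_ge t v; have g2 := contour_point_le t v.
  have e1 : `|t| = t by rewrite ger0_norm.
  have e2 : `|v| = v by rewrite ger0_norm.
  rewrite e1 e2 in g2; rewrite e2 in g1; apply/andP; split; lra.
have {}h2 : Cabs (Cpow (1 - (t%:C + v%:C * sgi s)) q) <= K2 * (1 + v) `^ `|Re q|.
  apply: h2 => //; rewrite contour_point1.
  have [_ g1] := contour_point_ge (1 - t) (- v); have g2 := contour_point_le (1 - t) (- v).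
  have e1 : `|1 - t| = 1 - t by rewrite ger0_norm //; lra.
  have e2 : `|- v| = v by rewrite normrN ger0_norm.
  rewrite e1 e2 in g2; rewrite e2 in g1; apply/andP; split; lra.
rewrite CabsM (CabsM (Cpow _ _)).
have h : Cabs (Cpow (t%:C + v%:C * sgi s) p) * Cabs (Cpow (1 - (t%:C + v%:C * sgi s)) q) *
    Cabs (Cpow (1 + x%:C * (t%:C + v%:C * sgi s)) r) <= K1 * K2 * K3 * (K4 * expR (el / 2 * v)).
  apply: le_trans (_ : (K1 * (1 + v) `^ `|Re p|) * (K2 * (1 + v) `^ `|Re q|) * (K3 * (1 + v) `^ `|Re r|) <= _).
    by apply: ler_pM; rewrite ?mulr_ge0 ?Cabs_ge0 //; apply: ler_pM; rewrite ?Cabs_ge0.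
  have v1 : 0 < 1 + v by lra.
  move: h4; rewrite !powRDp // => h4.
  have -> : forall X1 X2 X3 : R, K1 * X1 * (K2 * X2) * (K3 * X3) = K1 * K2 * K3 * (X1 * X2 * X3).
    by move=> *; ring.
  by rewrite ler_wpM2l // !mulr_ge0 // ltW.
have e : expR (- (el / 2 * v)) = expR (el / 2 * v) * expR (- (el * v)).
  by rewrite -expRD; congr expR; field.
rewrite e; apply: le_trans (ler_wpM2r (expR_ge0 _) h) _.
by rewrite le_eqVlt; apply/orP; left; apply/eqP; ring.
Qed.

Lemma contour_der_far_bound d : 0 < d -> exists2 K, 0 < K & forall t v, 0 <= t <= 1 -> d <= v ->
  Cabs (contour_der (t%:C + v%:C * sgi s)) <= K.
Proof.
move=> d0; have [K K0 h] := contour_far_bound d0.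
pose M := Cabs p / d + Cabs q / d + Cabs (r * x%:C) + el.
have M0 : 0 < M.
  by rewrite /M ltr_wpDl // !addr_ge0 ?divr_ge0 ?Cabs_ge0 // ltW.
exists (K * M); first by rewrite mulr_gt0.
move=> t v ht dv; have v0 : 0 < v by lra.
rewrite /contour_der CabsM; apply: ler_pM; rewrite ?Cabs_ge0 //.
  apply: le_trans (h t v ht dv) _; rewrite ler_piMr ?(ltW K0) // -expR0 ler_expR.
  by rewrite oppr_le0 mulr_ge0 ?divr_ge0 // ltW.
have [_ g1] := contour_point_ge t v.
have [_ g2] := contour_point_ge (1 - t) (- v).
have [g3 _] := contour_point_ge (1 + x * t) (x * v).
case/andP: ht => t0 t1; have xt : 0 <= x * t by rewrite mulr_ge0 // ltW.
have e2 : `|v| = v by rewrite gtr0_norm.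
have e3 : `|1 + x * t| = 1 + x * t by rewrite ger0_norm //; lra.
rewrite -contour_point1 normrN e2 in g2; rewrite -contour_pointx e3 in g3; rewrite e2 in g1.
have dvd w z e : 0 < e -> e <= Cabs z -> Cabs (w / z) <= Cabs w / e.
  by move=> e0 he; rewrite CabsM CabsV ler_wpM2l ?Cabs_ge0 // lef_pV2 ?posrE //; exact: lt_le_trans he.
apply: le_trans (CabsD _ _) _; apply: lerD; last first.
  rewrite CabsM Cabs_real gtr0_norm // CabsE /= expr0n /= add0r sqrtr_sqr hs mul1r //.
apply: le_trans (CabsD _ _) _; apply: lerD; last first.
  by rewrite -[X in _ <= X]divr1; apply: dvd => //; lra.
apply: le_trans (CabsD _ _) _; apply: lerD; first by apply: dvd => //; lra.
by rewrite CabsN; apply: dvd => //; lra.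
Qed.

(** The integral over the segment from i s v to 1 + i s v. *)
Definition contour_slice v : C := Cintegral ui (fun t => contour_fun (t%:C + v%:C * sgi s)).

Lemma is_Cder_horizontal v t : is_Cder (fun y => y%:C + v%:C * sgi s) t 1.
Proof. by apply: is_Cder_eq (is_CderD (is_Cder_id t) (is_Cder_cst _ t)) _; rewrite addr0. Qed.

Lemma is_Cder_vertical t v : is_Cder (fun y => t%:C + y%:C * sgi s) v (sgi s).
Proof. exact: is_Cder_lin. Qed.

Lemma Cmeasurable_slice v : 0 <= v -> Cmeasurable ui (fun t => contour_fun (t%:C + v%:C * sgi s)).
Proof.
move=> v0; apply: Cmeasurable_diff; first exact: open_ui.
move=> t /uiP ht; apply: Cdiff_contour; first by apply: contour_domP; rewrite ht.
by eexists; exact: is_Cder_horizontal.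
Qed.

Lemma Cintegrable_slice v : 0 < v -> Cintegrable ui (fun t => contour_fun (t%:C + v%:C * sgi s)).
Proof.
move=> v0; have [K K0 h] := contour_far_bound v0.
apply: (Cintegrable_le (g := fun=> K * expR (- (el / 2 * v)))).
- exact: measurable_ui.
- exact: Cmeasurable_slice (ltW v0).
- exact: Rintegrable_cst_ui.
- by move=> t /uiP/andP[t0 t1]; apply: h => //; rewrite !ltW.
Qed.

(** In place of Cauchy's theorem: under the integral sign d/dv is i s d/dt, and
    the integral of a t-derivative is a difference of endpoint values. *)
Lemma contour_slice_der v : 0 < v -> is_Cder contour_slice v
  (sgi s * (contour_fun (1 + v%:C * sgi s) - contour_fun (v%:C * sgi s))).
Proof.
move=> v0; have v20 : 0 < v / 2 by rewrite divr_gt0.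
have [K K0 hK] := contour_der_far_bound v20.
have hv : v / 2 < v < v + 1 by apply/andP; split; lra.
have I1 : Cintegrable ui (fun t => contour_der (t%:C + v%:C * sgi s)).
  apply: (Cintegrable_le (g := fun=> K)).
  - exact: measurable_ui.
  - apply: Cmeasurable_diff; first exact: open_ui.
    move=> t /uiP ht; apply: Cdiff_contour_der; first by apply: contour_domP; rewrite ht.
    by eexists; exact: is_Cder_horizontal.
  - exact: Rintegrable_cst_ui.
  - by move=> t /uiP/andP[t0 t1]; apply: hK; rewrite ?ltW //; lra.
have -> : sgi s * (contour_fun (1 + v%:C * sgi s) - contour_fun (v%:C * sgi s)) =
   Cintegral ui (fun t => sgi s * contour_der (t%:C + v%:C * sgi s)).
  rewrite CintegralZ //; congr (_ * _); apply/esym.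
  have der t : is_Cder (fun y => contour_fun (y%:C + v%:C * sgi s)) t (contour_der (t%:C + v%:C * sgi s)).
    apply: is_Cder_eq (is_Cder_contour _ (is_Cder_horizontal v t)) _; last by rewrite mul1r.
    by apply: contour_domP; rewrite v0 orbT.
  apply: (@CFTC_Cdiff R _ _ _ (fun y => contour_fun (y%:C + v%:C * sgi s)) _ _ _ (@exhausts_01 R)) => //.
  - move=> t /uiP ht; apply: Cdiff_contour_der; first by apply: contour_domP; rewrite ht.
    by eexists; exact: is_Cder_horizontal.
  - have := is_Cder_cvg (der 0) (@cvg_inv3 R); apply: Ccvg_ext => //.
    by rewrite rmorph0 add0r.
  - have h : (fun n => 1 - n.+3%:R^-1) @ \oo --> (1 : R).
      by rewrite -[X in _ --> X]subr0; apply: cvgB; [exact: cvg_cst|exact: cvg_inv3].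
    by have := is_Cder_cvg (der 1) h; apply: Ccvg_ext.
apply: (Cder_under_integral (f := fun v t => contour_fun (t%:C + v%:C * sgi s))
  (df := fun v t => sgi s * contour_der (t%:C + v%:C * sgi s)) (g := fun=> K) _ hv).
- exact: measurable_ui.
- by move=> y /andP[y1 y2]; apply: Cintegrable_slice; lra.
- move=> y t /andP[y1 y2] /uiP ht; apply: is_Cder_contour (is_Cder_vertical t y).
  by apply: contour_domP; rewrite ht.
- exact: Rintegrable_cst_ui.
- by move=> _; exact: ltW.
- move=> y t /andP[y1 y2] /uiP/andP[t0 t1]; rewrite CabsM.
  have -> : Cabs (sgi s) = 1 by rewrite CabsE /= expr0n /= add0r sqrtr_sqr.
  by rewrite mul1r; apply: hK; rewrite ?ltW.
Qed.

End Integrand.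
End Contour.

(** * Turning the path of integration *)

Section ContourShift.
Variable R : realType.
Local Notation C := R[i].
Local Notation Re := (@complex.Re R).
Local Notation Im := (@complex.Im R).
Local Notation mu := (@lebesgue_measure R).
Local Notation hl := (`]0, +oo[%classic : set R).
Local Notation ui := (`]0, 1[%classic : set R).
Implicit Types (z w a b c p q r : C) (t v d L x s el y : R) (n N : nat).

(** The exponent y = min (Re w + 1, 1) makes t ^ (y - 1) decreasing in t, which
    bounds the power for moduli from t up to 2 at once. *)
Lemma Cpow_edge_bound w : 0 < Re w + 1 -> exists y K, [/\ 0 < y, 0 < K &
  forall t z, 0 < t < 1 -> t <= Cabs z <= 2 -> Cabs (Cpow z w) <= K * t `^ (y - 1)].
Proof.
move=> w1; exists (Num.min (Re w + 1) 1), (expR (`|Im w| * pi) * (1 + 2 `^ Re w)).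
split; first by rewrite lt_min w1 ltr01.
  by rewrite mulr_gt0 ?expR_gt0 // ltr_pwDl ?powR_ge0.
move=> t z /andP[t0 t1] h; set y := Num.min _ _.
have y1 : y <= 1 by rewrite ge_min lexx orbT.
have y2 : y <= Re w + 1 by rewrite ge_min lexx.
have zn : z != 0 by rewrite -Cabs_gt0; case/andP: h => h _; exact: lt_le_trans h.
apply: le_trans (Cabs_Cpow_le _ zn) _; rewrite -mulrA ler_wpM2l ?expR_ge0 //.
clearbody y; apply: le_trans (powR_between (Re w) t0 h) _; rewrite mulrDl mul1r.
have mono u u' : u <= u' -> t `^ u' <= t `^ u.
  move=> uu; rewrite !powR_pos // ler_expR ler_wnM2r // ln_le0 //; exact: ltW.
apply: lerD; first by apply: mono; rewrite lerBlDr.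
by have := mono (y - 1) 0; rewrite powRr0 subr_le0 => m0; rewrite ler_peMr ?powR_ge0 ?m0.
Qed.

(** A majorant uniform in the height v, for the limit v -> 0. *)
Lemma contour_near_bound p q r x s el : 0 < Re p + 1 -> 0 < Re q + 1 -> 0 < x ->
  `|s| = 1 -> 0 < el -> exists2 g, Rintegrable ui g & forall t v, 0 < t < 1 -> 0 <= v <= 1 ->
  Cabs (contour_fun p q r x s el (t%:C + v%:C * sgi s)) <= g t.
Proof.
move=> p1 q1 x0 hs el0.
have [y1 [K1 [y10 K10 h1]]] := Cpow_edge_bound p1.
have [y2 [K2 [y20 K20 h2]]] := Cpow_edge_bound q1.
have [K3 K30 h3] := contour_regular_bound r x0 hs.
have [K4 K40 h4] := powM_bmaj y1 y2.
exists (fun t => K1 * K2 * (K3 * 2 `^ `|Re r|) * (K4 * bmaj y1 y2 t)).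
  apply: RintegrableZ; first exact: measurable_ui.
  apply: RintegrableZ; first exact: measurable_ui.
  exact: Rintegrable_bmaj.
move=> t v ht /andP[v0 v1]; have {}h4 := h4 t ht; case/andP: (ht) => t0 t1.
have ht' : 0 <= t <= 1 by rewrite !ltW.
have {}h3 := h3 t v ht' v0.
have e1 : `|t| = t by rewrite gtr0_norm.
have e2 : `|v| = v by rewrite ger0_norm.
have e3 : `|1 - t| = 1 - t by rewrite gtr0_norm //; lra.
have {}h1 : Cabs (Cpow (t%:C + v%:C * sgi s) p) <= K1 * t `^ (y1 - 1).
  apply: h1 => //; have [g1 _] := contour_point_ge hs t v; have g2 := contour_point_le hs t v.
  rewrite e1 in g1; rewrite e1 e2 in g2; apply/andP; split; lra.
have {}h2 : Cabs (Cpow (1 - (t%:C + v%:C * sgi s)) q) <= K2 * (1 - t) `^ (y2 - 1).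
  apply: h2; first by apply/andP; split; lra.
  rewrite contour_point1; have [g1 _] := contour_point_ge hs (1 - t) (- v).
  have g2 := contour_point_le hs (1 - t) (- v).
  rewrite e3 in g1; rewrite e3 normrN e2 in g2; apply/andP; split; lra.
have {}h3 : Cabs (Cpow (1 + x%:C * (t%:C + v%:C * sgi s)) r) <= K3 * 2 `^ `|Re r|.
  apply: le_trans h3 _; rewrite ler_wpM2l ?(ltW K30) //.
  by apply: ge0_ler_powR; rewrite ?nnegrE //; lra.
rewrite /contour_fun CabsM contour_exp // CabsM (CabsM (Cpow _ _)).
set X3 := K3 * _ in h3 *.
have h : Cabs (Cpow (t%:C + v%:C * sgi s) p) * Cabs (Cpow (1 - (t%:C + v%:C * sgi s)) q) *
    Cabs (Cpow (1 + x%:C * (t%:C + v%:C * sgi s)) r) <= K1 * K2 * X3 * (K4 * bmaj y1 y2 t).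
  apply: le_trans (_ : (K1 * t `^ (y1 - 1)) * (K2 * (1 - t) `^ (y2 - 1)) * X3 <= _).
    by apply: ler_pM; rewrite ?mulr_ge0 ?Cabs_ge0 //; apply: ler_pM; rewrite ?Cabs_ge0.
  have -> : forall X1 X2 : R, K1 * X1 * (K2 * X2) * X3 = K1 * K2 * X3 * (X1 * X2).
    by move=> *; ring.
  have X30 : 0 <= X3 by rewrite /X3 mulr_ge0 ?powR_ge0 // ltW.
  by rewrite ler_wpM2l //; apply: mulr_ge0 => //; apply: mulr_ge0; exact: ltW.
apply: le_trans (_ : _ * 1 <= _); last by rewrite mulr1; exact: h.
rewrite ler_wpM2l ?mulr_ge0 ?Cabs_ge0 //.
by rewrite -[leRHS]expR0 ler_expR oppr_le0 mulr_ge0 // ltW.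
Qed.

Lemma contour_slice_cvg0 p q r x s el : 0 < Re p + 1 -> 0 < Re q + 1 -> 0 < x ->
  `|s| = 1 -> 0 < el ->
  Cintegrable ui (fun t => contour_fun p q r x s el t%:C) /\
  ((fun n => contour_slice p q r x s el n.+2%:R^-1) : nat -> R[i]^o) @ \oo
    --> (Cintegral ui (fun t => contour_fun p q r x s el t%:C) : R[i]^o).
Proof.
move=> p1 q1 x0 hs el0; have [g gi hg] := contour_near_bound r p1 q1 x0 hs el0.
have e0 t : t%:C = t%:C + 0%:C * sgi s :> C by rewrite mul0r addr0.
have hn n : 0 <= n.+2%:R^-1 :> R by rewrite invr_ge0.
apply: (Cdct (u := fun n t => contour_fun p q r x s el (t%:C + (n.+2%:R^-1)%:C * sgi s))
  (f := fun t => contour_fun p q r x s el t%:C) (g := g)) => //.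
- by move=> n; apply: Cmeasurable_slice.
- apply: Cmeasurable_ext (Cmeasurable_slice p q r el x0 hs (lexx 0)) => t _.
  by rewrite -e0.
- move=> t /uiP ht.
  have dom : contour_dom x (t%:C + 0%:C * sgi s) by apply: contour_domP; rewrite ?ht.
  have := is_Cder_cvg (is_Cder_contour p q r s el dom (is_Cder_vertical s t 0)) (@cvg_inv2 R).
  by apply: Ccvg_ext => //; rewrite -e0.
- move=> n t /uiP ht; apply: hg => //; rewrite hn invf_le1 ?ler1n //.
Qed.

Lemma contour_slice_cvg_infty p q r x s el : 0 < x -> `|s| = 1 -> 0 < el ->
  ((fun n => contour_slice p q r x s el n.+2%:R) : nat -> R[i]^o) @ \oo --> (0 : R[i]^o).
Proof.
move=> x0 hs el0; have [K K0 hK] := contour_far_bound p q r x0 hs el0 ltr01.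
pose M := Rintegral mu ui (fun=> 1).
have hM v : 1 <= v -> Cabs (contour_slice p q r x s el v) <= 2 * (K * expR (- (el / 2 * v)) * `|M|).
  move=> v1; have v0 : 0 <= v by lra.
  apply: le_trans (Cabs_Cintegral_le (g := fun=> K * expR (- (el / 2 * v))) _ _ _ _) _ => //.
  - exact: Cmeasurable_slice.
  - exact: Rintegrable_cst_ui.
  - by move=> t /uiP/andP[t0 t1]; apply: hK => //; rewrite !ltW.
  rewrite ler_wpM2l //; set k := K * _; have k0 : 0 <= k by rewrite mulr_ge0 ?expR_ge0 // ltW.
  have -> : Rintegral mu ui (fun=> k) = k * M.
    rewrite /M -RintegralZl //; last exact: Rintegrable_cst_ui.
    by apply: eq_Rintegral => t _; rewrite mulr1.
  by rewrite ler_wpM2l // ler_norm.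
apply: (Ccvg_le (e := fun n => 2 * K * `|M| * (2 / el) * n.+2%:R^-1)); last first.
  rewrite -[X in _ --> X](mulr0 (2 * K * `|M| * (2 / el))).
  apply: cvgM; [exact: cvg_cst|exact: cvg_inv2].
apply: nearW => n; rewrite subr0.
have n1 : 1 <= n.+2%:R :> R by rewrite ler1n.
apply: le_trans (hM _ n1) _; move: (n.+2%:R) n1 => y y1.
have y0 : 0 < y by lra.
have ey : expR (- (el / 2 * y)) <= 2 / el * y^-1.
  have k0 : 0 < el / 2 * y by rewrite !mulr_gt0 ?divr_gt0.
  rewrite expRN -[X in _ <= X]invrK lef_pV2 ?posrE ?expR_gt0 ?invr_gt0 ?mulr_gt0 ?invr_gt0 //.
  rewrite invfM invrK invf_div; have := expR_ge1Dx (el / 2 * y); lra.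
have -> : 2 * K * `|M| * (2 / el) * y^-1 = 2 * (K * `|M|) * (2 / el * y^-1) by ring.
have -> : 2 * (K * expR (- (el / 2 * y)) * `|M|) = 2 * (K * `|M|) * expR (- (el / 2 * y)) by ring.
by rewrite ler_wpM2l // !mulr_ge0 // ltW.
Qed.

(** The integrand along the half lines that leave 0 and, below, 1 in the
    direction i s. *)
Definition contour_left p q r x s el v : C := contour_fun p q r x s el (v%:C * sgi s).
Definition contour_right p q r x s el v : C := contour_fun p q r x s el (1 + v%:C * sgi s).

Lemma Cabs_mul_sgi s v : `|s| = 1 -> 0 <= v -> Cabs (v%:C * sgi s) = v.
Proof.
by move=> hs v0; rewrite CabsM Cabs_real ger0_norm // CabsE /= expr0n /= add0r sqrtr_sqr hs mulr1.
Qed.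

Lemma Cpow_mul_sgi_bound s w : `|s| = 1 -> exists2 K, 0 < K & forall v, 0 < v ->
  Cabs (Cpow (v%:C * sgi s) w) <= K * v `^ Re w.
Proof.
move=> hs; exists (expR (`|Im w| * pi)); first exact: expR_gt0.
move=> v v0; have e := Cabs_mul_sgi hs (ltW v0); rewrite -{2}e.
by apply: Cabs_Cpow_le; rewrite -Cabs_gt0 e.
Qed.

Lemma Cmeasurable_contour_side p q r x s el t0 : 0 < x -> `|s| = 1 ->
  Cmeasurable hl (fun v => contour_fun p q r x s el (t0%:C + v%:C * sgi s)).
Proof.
move=> x0 hs; apply: Cmeasurable_diff; first exact: open_hl.
move=> v /hlP v0; apply: Cdiff_contour; first by apply: contour_domP; rewrite ?v0 ?orbT.
by eexists; exact: is_Cder_vertical.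
Qed.

Lemma Cintegrable_contour_left p q r x s el : 0 < Re p + 1 -> 0 < x -> `|s| = 1 -> 0 < el ->
  Cintegrable hl (contour_left p q r x s el).
Proof.
move=> p1 x0 hs el0.
have [K1 K10 h1] := Cpow_mul_sgi_bound p hs.
have [K2 K20 h2] := Cpow_growth q ltr01 ltr01.
have [K3 K30 h3] := contour_regular_bound r x0 hs.
have e t : 0%:C + t%:C * sgi s = t%:C * sgi s :> C by rewrite add0r.
apply: (Cintegrable_gmaj (K1 * K2 * K3) (Re p + 1) (`|Re q| + `|Re r|) el) => //.
  apply: Cmeasurable_ext (Cmeasurable_contour_side p q r el 0 x0 hs) => v _.
  by rewrite e.
move=> v v0; have vv := ltW v0.
have z01 : 0 <= (0 : R) <= 1 by rewrite lexx ler01.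
have {}h3 := h3 0 v z01 vv; rewrite e in h3.
have {}h1 := h1 v v0.
have {}h2 : Cabs (Cpow (1 - v%:C * sgi s) q) <= K2 * (1 + v) `^ `|Re q|.
  apply: h2 => //; rewrite -e contour_point1.
  have [g1 _] := contour_point_ge hs (1 - 0) (- v); have g2 := contour_point_le hs (1 - 0) (- v).
  have e1 : `|1 - 0| = 1 :> R by rewrite subr0 normr1.
  have e2 : `|- v| = v by rewrite normrN gtr0_norm.
  rewrite e1 in g1; rewrite e1 e2 in g2; apply/andP; split; lra.
rewrite /contour_left /contour_fun CabsM -{4}e contour_exp // CabsM (CabsM (Cpow _ _)) /gmaj addrK.
have v1 : 0 < 1 + v by lra.
rewrite powRDp // [leRHS]mulrA; apply: ler_wpM2r; first exact: expR_ge0.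
apply: le_trans (_ : (K1 * v `^ Re p) * (K2 * (1 + v) `^ `|Re q|) * (K3 * (1 + v) `^ `|Re r|) <= _).
  by apply: ler_pM; rewrite ?mulr_ge0 ?Cabs_ge0 //; apply: ler_pM; rewrite ?Cabs_ge0.
by rewrite le_eqVlt; apply/orP; left; apply/eqP; ring.
Qed.

Lemma Cintegrable_contour_right p q r x s el : 0 < Re q + 1 -> 0 < x -> `|s| = 1 -> 0 < el ->
  Cintegrable hl (contour_right p q r x s el).
Proof.
move=> q1 x0 hs el0.
have hs' : `|- s| = 1 by rewrite normrN.
have [K1 K10 h1] := Cpow_mul_sgi_bound q hs'.
have [K2 K20 h2] := Cpow_growth p ltr01 ltr01.
have [K3 K30 h3] := contour_regular_bound r x0 hs.
have e t : 1 + t%:C * sgi s = 1%:C + t%:C * sgi s :> C by rewrite rmorph1.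
apply: (Cintegrable_gmaj (K1 * K2 * K3) (Re q + 1) (`|Re p| + `|Re r|) el) => //.
  apply: Cmeasurable_ext (Cmeasurable_contour_side p q r el 1 x0 hs) => v _.
  by rewrite -e.
move=> v v0; have vv := ltW v0.
have z01 : 0 <= (1 : R) <= 1 by rewrite lexx ler01.
have {}h3 := h3 1 v z01 vv; rewrite -e in h3.
have {}h1 : Cabs (Cpow (1 - (1 + v%:C * sgi s)) q) <= K1 * v `^ Re q.
  have -> : 1 - (1 + v%:C * sgi s) = v%:C * sgi (- s) by rewrite -sgiN; ring.
  exact: h1.
have {}h2 : Cabs (Cpow (1 + v%:C * sgi s) p) <= K2 * (1 + v) `^ `|Re p|.
  apply: h2 => //; rewrite e.
  have [g1 _] := contour_point_ge hs 1 v; have g2 := contour_point_le hs 1 v.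
  have e1 : `|1| = 1 :> R by rewrite normr1.
  have e2 : `|v| = v by rewrite gtr0_norm.
  rewrite e1 in g1; rewrite e1 e2 in g2; apply/andP; split; lra.
rewrite /contour_right /contour_fun CabsM {4}e contour_exp // CabsM (CabsM (Cpow _ _)) /gmaj addrK.
have v1 : 0 < 1 + v by lra.
rewrite powRDp // [leRHS]mulrA; apply: ler_wpM2r; first exact: expR_ge0.
apply: le_trans (_ : (K2 * (1 + v) `^ `|Re p|) * (K1 * v `^ Re q) * (K3 * (1 + v) `^ `|Re r|) <= _).
  by apply: ler_pM; rewrite ?mulr_ge0 ?Cabs_ge0 //; apply: ler_pM; rewrite ?Cabs_ge0.
by rewrite le_eqVlt; apply/orP; left; apply/eqP; ring.
Qed.

(** [contour_slice_der] is integrated over all v > 0: the slice tends to the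
    integral over ]0, 1[ as v -> 0, and to 0 as v -> +oo. *)
Lemma contour_shift p q r x s el : 0 < Re p + 1 -> 0 < Re q + 1 -> 0 < x ->
  `|s| = 1 -> 0 < el ->
  Cintegral ui (fun t => contour_fun p q r x s el t%:C) =
  sgi s * Cintegral hl (contour_left p q r x s el) -
  sgi s * Cintegral hl (contour_right p q r x s el).
Proof.
move=> p1 q1 x0 hs el0.
have [_ c0] := contour_slice_cvg0 r p1 q1 x0 hs el0.
have c1 := contour_slice_cvg_infty p q r x0 hs el0.
have il := Cintegrable_contour_left q r p1 x0 hs el0.
have ir := Cintegrable_contour_right p r q1 x0 hs el0.
have ib := CintegrableB (@measurable_hl R) ir il.
suff h : sgi s * (Cintegral hl (contour_right p q r x s el) - Cintegral hl (contour_left p q r x s el))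
    = 0 - Cintegral ui (fun t => contour_fun p q r x s el t%:C).
  by move: h; rewrite sub0r => h; rewrite -[LHS]opprK -h; ring.
rewrite -CintegralB // -CintegralZ //.
apply: (@CFTC_Cdiff _ _ _ _ (contour_slice p q r x s el) _ _ _ (@exhausts_0y R) _ _ _ c0 c1).
- by move=> v /hlP; exact: contour_slice_der.
- move=> v /hlP v0; apply: CdiffM; first exact: Cdiff_cst.
  apply: CdiffD.
    apply: Cdiff_contour; last by eexists; exact: (is_Cder_lin 1).
    by rewrite -(rmorph1 (real_complex R)); apply: contour_domP; rewrite ?v0 ?orbT.
  apply: CdiffN.
    apply: (@Cdiff_ext _ (fun v => contour_fun p q r x s el (0%:C + v%:C * sgi s))).
    + by move=> y; rewrite /contour_left add0r.
  apply: Cdiff_contour; first by apply: contour_domP; rewrite ?v0 ?orbT.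
  by eexists; exact: is_Cder_vertical.
- exact: CintegrableZ.
Qed.

End ContourShift.

(** * Remainder of the binomial expansion *)

Section Remainder.
Variable R : realType.
Local Notation C := R[i].
Local Notation Re := (@complex.Re R).
Local Notation Im := (@complex.Im R).
Local Notation mu := (@lebesgue_measure R).
Local Notation hl := (`]0, +oo[%classic : set R).
Implicit Types (z w u : C) (t x s k : R) (n N : nat).

Lemma le_eq_trans (x y z : R) : x <= y -> y = z -> x <= z. Proof. by move=> h <-. Qed.

(** The sum of the first N terms of the Taylor series of (1 + u) ^ w. *)
Definition binomial_sum w N u : C := \sum_(0 <= k < N) binc (- w) k * (- u) ^+ k.

Lemma is_Cder_binomial_sum w N u t :
  is_Cder (fun y => binomial_sum w N.+1 (y%:C * u)) t (u * w * binomial_sum (w - 1) N (t%:C * u)).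
Proof.
have h (k : nat) : is_Cder (fun y => binc (- w) k * (- (y%:C * u)) ^+ k) t
    (binc (- w) k * (k%:R * (- (t%:C * u)) ^+ k.-1 * - u)).
  apply: is_CderZ; apply: is_Cder_eq.
    by apply: is_Cder_ext (is_CderX k (is_Cder_lin 0 (- u) t)) => y; rewrite add0r mulrN.
  by rewrite /= add0r (mulrN t%:C).
apply: is_Cder_eq (is_Cder_sum _ _ h) _.
rewrite big_nat_recl //= mul0r mul0r mulr0 add0r /binomial_sum mulr_sumr.
apply: eq_bigr => i _.
have e : i.+1%:R * binc (- w) i.+1 = - w * binc (- (w - 1)) i.
  by rewrite bincS1; congr (_ * binc _ _); ring.
have -> : binc (- w) i.+1 * (i.+1%:R * (- (t%:C * u)) ^+ i * - u) =
   (i.+1%:R * binc (- w) i.+1) * (- (t%:C * u)) ^+ i * - u by ring.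
rewrite e; ring.
Qed.

(** Induction on N: along the ray t u, the derivative of the remainder of order
    N + 1 for w is u * w times the remainder of order N for w - 1. *)
Lemma Cpow_remainder w N : exists K M : R, [/\ 0 <= K, 0 <= M & forall u, 0 <= Re u ->
  Cabs (Cpow (1 + u) w - binomial_sum w N u) <= K * Cabs u ^+ N * (1 + Cabs u) `^ M].
Proof.
have pos u : 0 <= Re u -> 0 < Re (1 + u) by move=> h; rewrite ReD Re_1; apply: ltr_pwDl.
elim: N w => [|N IH] w.
  have [K K0 hK] := Cpow_growth w ltr01 (ltr01 : (0 : R) < 1).
  exists K, `|Re w|; split; rewrite ?normr_ge0 ?ltW // => u u0.
  rewrite /binomial_sum big_geq // subr0 expr0 mulr1; apply: hK; first exact: Cabs_ge0.
  rewrite mul1r; apply/andP; split; last by apply: le_trans (CabsD _ _) _; rewrite Cabs1.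
  apply: le_trans (Re_le_Cabs _); apply: le_trans (ler_norm _); rewrite ReD Re_1.
  by rewrite lerDl.
have [K [M [K0 M0 hK]]] := IH (w - 1).
exists (2 * (Cabs w * K)), M; split => //; first by rewrite !mulr_ge0 ?Cabs_ge0.
move=> u u0; pose f (y : R) := Cpow (1 + y%:C * u) w - binomial_sum w N.+1 (y%:C * u).
pose df (y : R) := u * w * (Cpow (1 + y%:C * u) (w - 1) - binomial_sum (w - 1) N (y%:C * u)).
have yu (y : R) : 0 <= y -> 0 <= Re (y%:C * u).
  by move=> y0; rewrite ReM /= mul0r subr0 mulr_ge0.
have hf (y : R) : 0 <= y <= 1 -> is_Cder f y (df y).
  move=> /andP[y0 _]; apply: is_Cder_eq.
    apply: is_CderB (is_Cder_binomial_sum w N u y).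
    by apply: is_Cder_Cpow_lin; apply: log_plane_Re; apply: pos; exact: yu.
  by rewrite /df; ring.
have hb (y : R) : 0 <= y <= 1 -> Cabs (df y) <= Cabs w * K * (Cabs u ^+ N.+1 * (1 + Cabs u) `^ M).
  move=> /andP[y0 y1]; rewrite /df CabsM CabsM.
  have U0 := Cabs_ge0 u.
  have h1 : Cabs (y%:C * u) <= Cabs u by rewrite CabsM Cabs_real ger0_norm // ler_piMl.
  have h2 : Cabs (Cpow (1 + y%:C * u) (w - 1) - binomial_sum (w - 1) N (y%:C * u)) <=
    K * Cabs u ^+ N * (1 + Cabs u) `^ M.
    apply: le_trans (hK _ (yu y y0)) _; apply: ler_pM; rewrite ?powR_ge0 ?mulr_ge0 ?exprn_ge0 ?Cabs_ge0 //.
      by rewrite ler_wpM2l // lerXn2r ?nnegrE ?Cabs_ge0.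
    by apply: ge0_ler_powR; rewrite ?nnegrE ?addr_ge0 ?Cabs_ge0 ?lerD2l.
  apply: le_eq_trans (ler_wpM2l (mulr_ge0 U0 (Cabs_ge0 w)) h2) _; rewrite exprS; ring.
have h := Cder_mean_value ler01 hf hb; apply: le_trans (le_eq_trans h _); last ring.
rewrite /f rmorph1 rmorph0 !mul1r mul0r.
rewrite addr0 Cpow_base1.
have -> : binomial_sum w N.+1 0 = 1.
  rewrite /binomial_sum big_nat_recl // expr0 binc0 mulr1 big1 ?addr0 // => i _.
  by rewrite oppr0 expr0n /= mulr0.
by rewrite subrr subr0.
Qed.

Definition gamma_weight z k t : C := Cpow t%:C (z - 1) * Cexp (- (k * t)%:C).

(** B depends neither on h nor on E; this makes the error terms uniform in x. *)
Lemma gamma_weight_integral_le z k (M : R) : 0 < Re z -> 0 < k ->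
  exists2 B : R, 0 <= B & forall (h : R -> C) (E : R), 0 <= E -> Cmeasurable hl h ->
    (forall t, 0 < t -> Cabs (h t) <= E * (1 + t) `^ M) ->
    Cintegrable hl (fun t => gamma_weight z k t * h t) /\
    Cabs (Cintegral hl (fun t => gamma_weight z k t * h t)) <= B * E.
Proof.
move=> z0 k0; have ig := Rintegrable_gmaj M z0 k0.
exists (2 * `|Rintegral mu hl (gmaj (Re z) M k)|); first by rewrite mulr_ge0.
move=> h E E0 mh hh.
have mw : Cmeasurable hl (fun t => gamma_weight z k t * h t).
  apply: CmeasurableM mh; exact: Cintegrable_meas (Cintegrable_gamma z0 k0).
have bd t : 0 < t -> Cabs (gamma_weight z k t * h t) <= E * gmaj (Re z) M k t.
  move=> t0; rewrite /gamma_weight !CabsM Cabs_Cpow_real // Cabs_Cexp ReD !ReN Re_1 /= /gmaj.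
  have -> : forall X Y Z : R, E * (X * Y * Z) = X * Z * (E * Y) by move=> *; ring.
  by rewrite ler_wpM2l ?mulr_ge0 ?powR_ge0 ?expR_ge0 // hh.
split; first exact: Cintegrable_gmaj bd.
have ih := RintegrableZ E (@measurable_hl R) ig.
apply: le_trans (Cabs_Cintegral_le (@measurable_hl R) mw ih _) _.
  by move=> t /hlP; exact: bd.
rewrite RintegralZl //.
by rewrite -(mulrA 2 _ E) ler_wpM2l // [leRHS]mulrC ler_wpM2l // ler_norm.
Qed.

End Remainder.

(** * Contribution of the endpoint 0 *)

Section LeftExpansion.
Variable R : realType.
Local Notation C := R[i].
Local Notation Re := (@complex.Re R).
Local Notation Im := (@complex.Im R).
Local Notation mu := (@lebesgue_measure R).
Local Notation hl := (`]0, +oo[%classic : set R).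
Implicit Types (z w u a b c p q r : C) (t x s el : R) (n k N : nat).

Lemma gamma_weight_expansion z el (g rho : R -> C) (cf : nat -> C) (h : nat -> R -> C) N :
  (forall t, 0 < t -> g t = \sum_(0 <= n < N) cf n * h n t + rho t) ->
  (forall n, Cintegrable hl (fun t => gamma_weight z el t * h n t)) ->
  Cintegrable hl (fun t => gamma_weight z el t * rho t) ->
  Cintegral hl (fun t => gamma_weight z el t * g t) =
  \sum_(0 <= n < N) cf n * Cintegral hl (fun t => gamma_weight z el t * h n t)
   + Cintegral hl (fun t => gamma_weight z el t * rho t).
Proof.
move=> e ih ir.
have ih' n : Cintegrable hl (fun t => cf n * (gamma_weight z el t * h n t)).
  exact: CintegrableZ (ih n).
have [i1 e1] := Cintegrable_sum N (@measurable_hl R) ih'.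
have -> : \sum_(0 <= n < N) cf n * Cintegral hl (fun t => gamma_weight z el t * h n t) =
    \sum_(0 <= n < N) Cintegral hl (fun t => cf n * (gamma_weight z el t * h n t)).
  by apply: eq_bigr => n _; rewrite CintegralZ.
rewrite -e1 -CintegralD //; apply: eq_Cintegral => t /hlP t0.
by rewrite e // mulrDr mulr_sumr; congr (_ + _); apply: eq_bigr => n _; ring.
Qed.

Lemma gamma_weightX z el t n : 0 < t -> gamma_weight z el t * t%:C ^+ n = gamma_weight (z + n%:R) el t.
Proof.
move=> t0; have tn : t%:C != 0 :> C by exact: Re_gt0_neq0.
rewrite /gamma_weight -(Cpow_nat n tn) mulrAC -CpowD //.
by congr (Cpow _ _ * _); ring.
Qed.

Lemma Re_1D_sgi t s : Re (1 + t%:C * sgi s) = 1.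
Proof. by rewrite ReD ReM Re_1 /= mulr0 mul0r subr0 addr0. Qed.

Lemma Cpow_1D_sgi_bound w s : `|s| = 1 -> exists2 K, 0 < K & forall t, 0 <= t ->
  Cabs (Cpow (1 + t%:C * sgi s) w) <= K * (1 + t) `^ `|Re w|.
Proof.
move=> hs; have [K K0 hK] := Cpow_growth w ltr01 (ltr01 : (0 : R) < 1).
exists K => // t t0; apply: hK => //.
have e : 1 + t%:C * sgi s = 1%:C + t%:C * sgi s :> C by rewrite rmorph1.
have [g1 _] := contour_point_ge hs 1 t; have g2 := contour_point_le hs 1 t.
rewrite -e normr1 in g1; rewrite -e normr1 (ger0_norm t0) in g2.
by rewrite g1 mul1r.
Qed.

Lemma Cmeasurable_Cpow_1D w v : 0 <= Re v -> Cmeasurable hl (fun t => Cpow (1 + t%:C * v) w).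
Proof.
move=> v0; apply: Cmeasurable_diff; first exact: open_hl.
move=> t /hlP t0; apply: Cdiff_Cpow; last exact: Cdiff_lin.
apply: log_plane_Re; rewrite ReD ReM Re_1 /= mul0r subr0.
by apply: ltr_pwDl => //; rewrite mulr_ge0 // ltW.
Qed.

Lemma Cmeasurable_lin v : Cmeasurable hl (fun t => t%:C * v : C).
Proof.
apply: Cmeasurable_diff; first exact: open_hl.
by move=> t _; apply: Cdiff_ext (Cdiff_lin 0 v t) => y; rewrite add0r.
Qed.

Lemma CmeasurableX (D : set R) f n : measurable D -> Cmeasurable D f ->
  Cmeasurable D (fun t => f t ^+ n : C).
Proof.
move=> mD mf; elim: n => [|n IH].
  by apply: Cmeasurable_ext (Cmeasurable_cst D 1) => t _; rewrite expr0.
by apply: Cmeasurable_ext (CmeasurableM mf IH) => t _; rewrite exprS.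
Qed.

Lemma CmeasurableB (D : set R) (f g : R -> C) : Cmeasurable D f -> Cmeasurable D g ->
  Cmeasurable D (fun t => f t - g t).
Proof.
move=> hf hg; have := CmeasurableD hf (CmeasurableM (Cmeasurable_cst D (- 1)) hg).
by apply: Cmeasurable_ext => t _; rewrite mulN1r.
Qed.

Lemma Cmeasurable_binomial_sum w N (f : R -> C) : Cmeasurable hl f ->
  Cmeasurable hl (fun t => binomial_sum w N (f t)).
Proof.
move=> mf; apply: Cmeasurable_sum => k; apply: CmeasurableM; first exact: Cmeasurable_cst.
apply: CmeasurableX; first exact: measurable_hl.
have := CmeasurableM (Cmeasurable_cst hl (- 1)) mf.
by apply: Cmeasurable_ext => t _; rewrite mulN1r.
Qed.

Lemma expX_le_powR t n (M : R) : 0 <= t -> t ^+ n * (1 + t) `^ M <= (1 + t) `^ (M + n%:R).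
Proof.
move=> t0; have t1 : 0 < 1 + t by lra.
rewrite powRDp // powR_nat // mulrC ler_wpM2l ?powR_ge0 // lerXn2r ?nnegrE //; lra.
Qed.

(** The substitution v = t / x turns exp (- el x v) into a weight that does not
    depend on x. *)
Lemma contour_left_scaled a c r x s el : 0 < Re a -> 0 < x -> `|s| = 1 -> 0 < el ->
  sgi s * Cintegral hl (contour_left (a - 1) (c - a - 1) r x s (el * x)) =
  Cpow x%:C (- a) * Cpow (sgi s) a * Cintegral hl (fun t => gamma_weight a el t *
    (Cpow (1 + t%:C * sgi s) r * Cpow (1 + t%:C * ((x^-1)%:C * - sgi s)) (c - a - 1))).
Proof.
move=> a0 x0 hs el0; set q := c - a - 1; set G := fun t : R => _ * (_ * _).
have wn := sgi_neq0 hs; have xn : x%:C != 0 :> C by exact: Re_gt0_neq0.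
have xi0 : 0 < x^-1 by rewrite invr_gt0.
have a1 : 0 < Re (a - 1) + 1 by rewrite ReD ReN Re_1 subrK.
have i0 := Cintegrable_contour_left q r a1 x0 hs (mulr_gt0 el0 x0).
have [i1 ->] := Cscale xi0 i0.
pose k0 := (Cpow x%:C (a - 1))^-1 * Cpow (sgi s) (a - 1).
have k0n : k0 != 0 by rewrite mulf_neq0 ?invr_eq0 ?Cpow_neq0.
have xx : x%:C * (x^-1)%:C = 1 :> C by rewrite -rmorphM divff ?rmorph1 // gt_eqF.
have e t : 0 < t -> contour_left (a - 1) q r x s (el * x) (x^-1 * t) = k0 * G t.
  move=> t0; rewrite /contour_left /contour_fun Cpow_mulr ?mulr_gt0 // Cpow_mulrr // Cpow_invr //.
  have -> : 1 + x%:C * ((x^-1 * t)%:C * sgi s) = 1 + t%:C * sgi s.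
    by rewrite rmorphM /= -mulrA mulrA xx mul1r.
  have -> : sgi s * (el * x)%:C * ((x^-1 * t)%:C * sgi s) = - (el * t)%:C.
    have -> : sgi s * (el * x)%:C * ((x^-1 * t)%:C * sgi s) =
      sgi s * sgi s * (x%:C * (x^-1)%:C) * (el%:C * t%:C) by rewrite !rmorphM /=; ring.
    by rewrite sgi_sqr // xx mulr1 mulN1r rmorphM.
  have -> : 1 - (x^-1 * t)%:C * sgi s = 1 + t%:C * ((x^-1)%:C * - sgi s) by rewrite rmorphM /=; ring.
  by rewrite /G /gamma_weight /k0; ring.
have iG : Cintegrable hl G.
  have := CintegrableZ k0^-1 (@measurable_hl R) i1.
  by apply: Cintegrable_ext => [|t /hlP t0]; [exact: measurable_hl|rewrite e // mulKf].
have -> : Cintegral hl (fun t => contour_left (a - 1) q r x s (el * x) (x^-1 * t)) = k0 * Cintegral hl G.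
  by rewrite -CintegralZ //; apply: eq_Cintegral => t /hlP; exact: e.
rewrite /k0 !mulrA; congr (_ * _).
rewrite CpowN // !CpowB1 // invfM invrK rmorphV ?unitfE ?gt_eqF //=.
field; by rewrite wn xn Cpow_neq0.
Qed.

Lemma Cabs_scaled_sgi s x t : `|s| = 1 -> 1 <= x -> 0 <= t ->
  Cabs (t%:C * ((x^-1)%:C * - sgi s)) = t * x^-1 /\ t * x^-1 <= t.
Proof.
move=> hs x1 t0; have x0 : 0 < x by lra.
split; last by rewrite ler_piMr // invf_le1.
have es : Cabs (sgi s) = 1 by rewrite CabsE /= expr0n /= add0r sqrtr_sqr.
by rewrite !CabsM CabsN es mulr1 !Cabs_real !ger0_norm // invr_ge0 ltW.
Qed.

(** (1 - i s t / x) ^ (c - a - 1) is expanded in powers of 1 / x, while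
    (1 + i s t) ^ (- b) is kept; [kummerU_imaginary] then recognizes every term
    as a value of U. *)
Lemma left_expansion a b c s el N : 0 < Re a -> `|s| = 1 -> 0 < el ->
  exists K, forall x, 1 <= x ->
  Cabs (sgi s * Cintegral hl (contour_left (a - 1) (c - a - 1) (- b) x s (el * x)) -
    CGamma a * \sum_(k < N) (humbert_coef2 a b c k (- (sgi s * el%:C)) * Cpow x%:C (- a - k%:R)))
  <= K * x `^ (- Re a - N%:R).
Proof.
move=> a0 hs el0; set q := c - a - 1.
have [K1 K10 h1] := Cpow_1D_sgi_bound (- b) hs.
have [K2 [M [K20 M0 h2]]] := Cpow_remainder q N.
have [B B0 hB] := gamma_weight_integral_le (`|Re (- b)| + (M + N%:R)) a0 el0.
have wn := sgi_neq0 hs.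
exists (Cabs (Cpow (sgi s) a) * B * (K1 * K2)) => x x1; have x0 : 0 < x by lra.
have xn : x%:C != 0 :> C by exact: Re_gt0_neq0.
have xi0 : 0 < x^-1 by rewrite invr_gt0.
rewrite contour_left_scaled // -/q.
pose u t : C := t%:C * ((x^-1)%:C * - sgi s).
pose f t := Cpow (1 + t%:C * sgi s) (- b).
have ru : 0 <= Re ((x^-1)%:C * - sgi s) by rewrite ReM ReN /= oppr0 mulr0 mul0r subr0.
have mf : Cmeasurable hl f by exact: Cmeasurable_Cpow_1D.
have mu_ : Cmeasurable hl u by exact: Cmeasurable_lin.
pose h (n : nat) t := f t * (- u t) ^+ n.
pose rho t := f t * (Cpow (1 + u t) q - binomial_sum q N (u t)).
have Eh t : 0 < t -> f t * Cpow (1 + u t) q = \sum_(0 <= n < N) binc (- q) n * h n t + rho t.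
  move=> t0; rewrite /rho /binomial_sum mulrBr mulr_sumr.
  have -> : \sum_(0 <= n < N) binc (- q) n * h n t =
      \sum_(0 <= n < N) f t * (binc (- q) n * (- u t) ^+ n).
    by apply: eq_bigr => n _; rewrite /h; ring.
  by rewrite [RHS]addrC subrK.
have t1 t : 0 < t -> 0 < 1 + t by move=> ?; lra.
have ih n : Cintegrable hl (fun t => gamma_weight a el t * h n t).
  have [B' _ hB'] := gamma_weight_integral_le (`|Re (- b)| + n%:R) a0 el0.
  have [] // := hB' (h n) K1 (ltW K10).
    apply: CmeasurableM mf _; apply: CmeasurableX; first exact: measurable_hl.
    apply: Cmeasurable_ext (CmeasurableM (Cmeasurable_cst hl (- 1)) mu_) => t _.
    by rewrite mulN1r.
  move=> t t0; have [e1 e2] := Cabs_scaled_sgi hs x1 (ltW t0).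
  rewrite /h CabsM CabsX CabsN e1.
  have tx0 : 0 <= t * x^-1 by rewrite mulr_ge0 // ltW.
  have e3 : (t * x^-1) ^+ n <= t ^+ n by rewrite lerXn2r ?nnegrE // ltW.
  apply: le_trans (ler_pM (Cabs_ge0 _) (exprn_ge0 n tx0) (h1 t (ltW t0)) e3) _.
  rewrite -mulrA; apply: ler_wpM2l; first exact: ltW.
  rewrite mulrC; apply: expX_le_powR; exact: ltW.
have [] := hB rho (K1 * K2 * x^-1 ^+ N).
- by rewrite !mulr_ge0 ?exprn_ge0 // ltW.
- apply: CmeasurableM mf _; apply: CmeasurableB; last exact: Cmeasurable_binomial_sum.
  exact: Cmeasurable_Cpow_1D.
- move=> t t0; have [e1 e2] := Cabs_scaled_sgi hs x1 (ltW t0).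
  have tt := ltW t0.
  have hr : Cabs (Cpow (1 + u t) q - binomial_sum q N (u t)) <=
      K2 * x^-1 ^+ N * (1 + t) `^ (M + N%:R).
    apply: le_trans (h2 _ _) _.
      by rewrite /u ReM Re_real Im_real mul0r subr0; apply: mulr_ge0.
    rewrite e1 exprMn.
    have -> : forall X : R, K2 * (t ^+ N * x^-1 ^+ N) * X = K2 * x^-1 ^+ N * (t ^+ N * X).
      by move=> X; ring.
    have k0 : 0 <= K2 * x^-1 ^+ N by rewrite mulr_ge0 ?exprn_ge0 // ltW.
    rewrite ler_wpM2l //; apply: le_trans (expX_le_powR N M tt).
    rewrite ler_wpM2l ?exprn_ge0 //; apply: ge0_ler_powR => //; rewrite ?nnegrE.
    - by rewrite addr_ge0 // mulr_ge0 // ltW.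
    - by rewrite addr_ge0.
    - by rewrite lerD2l.
  rewrite /rho CabsM; apply: le_eq_trans (ler_pM (Cabs_ge0 _) (Cabs_ge0 _) (h1 t tt) hr) _.
  by rewrite (@powRDp _ _ _ (M + N%:R)) ?t1 //; ring.
move=> irho brho.
rewrite (gamma_weight_expansion Eh ih irho) mulrDr.
have term k : Cpow x%:C (- a) * Cpow (sgi s) a *
    (binc (- q) k * Cintegral hl (fun t => gamma_weight a el t * h k t)) =
    CGamma a * (humbert_coef2 a b c k (- (sgi s * el%:C)) * Cpow x%:C (- a - k%:R)).
  have ak := Re_addn k a0.
  have kU := kummerU_imaginary (a - b + k%:R + 1) ak hs el0.
  have eB : a - b + k%:R + 1 - (a + k%:R) - 1 = - b by ring.
  rewrite eB CGamma_addn // in kU.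
  have -> : Cintegral hl (fun t => gamma_weight a el t * h k t) = (x%:C^-1) ^+ k * sgi s ^+ k *
     Cintegral hl (fun t => Cpow t%:C (a + k%:R - 1) * Cexp (- (el * t)%:C) *
       Cpow (1 + sgi s * t%:C) (- b)).
    have eh t : 0 < t -> gamma_weight a el t * h k t = (x%:C^-1) ^+ k * sgi s ^+ k *
       (Cpow t%:C (a + k%:R - 1) * Cexp (- (el * t)%:C) * Cpow (1 + sgi s * t%:C) (- b)).
      move=> t0; have := gamma_weightX a el k t0; rewrite {2}/gamma_weight => <-.
      rewrite /h /f /u (mulrC (sgi s) t%:C).
      have -> : - (t%:C * ((x^-1)%:C * - sgi s)) = t%:C * (x%:C^-1 * sgi s).
        by rewrite rmorphV ?unitfE ?gt_eqF //=; ring.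
      by rewrite !exprMn; ring.
    have nz : x%:C^-1 ^+ k * sgi s ^+ k != 0 by rewrite mulf_neq0 // expf_neq0 // invr_eq0.
    rewrite -CintegralZ //; first by apply: eq_Cintegral => t /hlP; exact: eh.
    have := CintegrableZ (x%:C^-1 ^+ k * sgi s ^+ k)^-1 (@measurable_hl R) (ih k).
    by apply: Cintegrable_ext => [|t /hlP t0]; [exact: measurable_hl|rewrite eh // mulKf].
  move: kU; rewrite CpowD // Cpow_nat // => kU.
  have -> : Cpow x%:C (- a - k%:R) = Cpow x%:C (- a) * x%:C^-1 ^+ k.
    by rewrite CpowD // (CpowN k%:R) // Cpow_nat // exprVn.
  rewrite /humbert_coef2; move: kU; set U := kummerU _ _ _; set J := Cintegral _ _ => kU.
  have -> : - q = a - c + 1 by rewrite /q; ring.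
  rewrite /binc.
  transitivity (pochhammer (a - c + 1) k / k`!%:R * (Cpow x%:C (- a) * x%:C^-1 ^+ k) *
    (Cpow (sgi s) a * sgi s ^+ k * J)); first by ring.
  by rewrite -kU; ring.
rewrite mulr_sumr (eq_bigr _ (fun k _ => term k)) mulr_sumr big_mkord addrC addKr.
rewrite !CabsM Cabs_Cpow_real // ReN.
have -> : x `^ (- Re a - N%:R) = x `^ (- Re a) * x^-1 ^+ N.
  by rewrite powRDp // (powRN _ N%:R) powR_nat // exprVn.
apply: le_eq_trans (ler_wpM2l (mulr_ge0 (powR_ge0 _ _) (Cabs_ge0 _)) brho) _; ring.
Qed.

End LeftExpansion.

(** * Expanding the integrand at the endpoint 1 *)

Section RightExpansion.
Variable R : realType.
Local Notation C := R[i].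
Local Notation Re := (@complex.Re R).
Local Notation Im := (@complex.Im R).
Local Notation mu := (@lebesgue_measure R).
Local Notation hl := (`]0, +oo[%classic : set R).
Implicit Types (z w u a b c p q r : C) (t x s el : R) (n k N : nat).

Lemma triangular_sum (F : nat -> nat -> C) N :
  \sum_(0 <= n < N) \sum_(0 <= j < N - n) F n j =
  \sum_(0 <= k < N) \sum_(0 <= n < k.+1) F n (k - n)%N.
Proof.
elim: N => [|N IH]; first by rewrite !big_geq.
rewrite [RHS]big_nat_recr //= -IH [LHS]big_nat_recr //= subSnn big_nat1.
rewrite [X in _ = _ + X]big_nat_recr //= subnn addrA.
congr (_ + _); rewrite -big_split /=; apply: eq_big_nat => n /andP[_ nN].
by rewrite subSn ?(ltnW nN) // big_nat_recr.
Qed.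

Lemma Re_inv_gt0 z : 0 < Re z -> 0 < Re z^-1.
Proof.
case: z => x y /= x0; apply: divr_gt0 => //.
by apply: ltr_pwDl; rewrite ?exprn_gt0 ?sqr_ge0.
Qed.

(** Common constants for the finitely many exponents w - n. *)
Lemma Cpow_remainder_family w N m : exists K M : R, [/\ 0 <= K, 0 <= M &
  forall n u, (n < m)%N -> 0 <= Re u ->
  Cabs (Cpow (1 + u) (w - n%:R) - binomial_sum (w - n%:R) (N - n) u) <=
  K * Cabs u ^+ (N - n) * (1 + Cabs u) `^ M].
Proof.
elim: m => [|m [K [M [K0 M0 h]]]]; first by exists 0, 0; split.
have [K' [M' [K'0 M'0 h']]] := Cpow_remainder (w - m%:R) (N - m).
exists (K + K'), (M + M'); split; rewrite ?addr_ge0 // => n u nm u0.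
have U0 := Cabs_ge0 u.
have mono (P Q : R) : P <= Q -> (1 + Cabs u) `^ P <= (1 + Cabs u) `^ Q.
  by move=> PQ; rewrite !powR_pos ?ltr_pwDl // ler_expR ler_wpM2r // ln_ge0 // lerDl.
have fin (k P : R) : 0 <= k -> k <= K + K' -> P <= M + M' ->
  k * Cabs u ^+ (N - n) * (1 + Cabs u) `^ P <= (K + K') * Cabs u ^+ (N - n) * (1 + Cabs u) `^ (M + M').
  move=> k0 kK PM; apply: ler_pM; rewrite ?mulr_ge0 ?exprn_ge0 ?powR_ge0 //.
    by rewrite ler_wpM2r ?exprn_ge0.
  exact: mono.
move: nm; rewrite ltnS leq_eqVlt => /orP[/eqP e|nm].
  rewrite e in fin *; apply: le_trans (h' u u0) _; apply: fin => //; lra.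
apply: le_trans (h n u nm u0) _; apply: fin => //; lra.
Qed.

Lemma CexpM_sgi s el t : `|s| = 1 ->
  Cexp (sgi s * el%:C * (1 + t%:C * sgi s)) = Cexp (sgi s * el%:C) * Cexp (- (el * t)%:C).
Proof.
move=> hs; rewrite -CexpD; congr Cexp.
have -> : sgi s * el%:C * (1 + t%:C * sgi s) = sgi s * el%:C + sgi s * sgi s * (el%:C * t%:C) by ring.
by rewrite sgi_sqr // mulN1r rmorphM.
Qed.

(** What remains of the integrand at 1 + i s t / x. With w = 1 / x and
    v = i s / x it comes from the factorization
    1 + x + i s t = x * (1 + t v) * (1 + w / (1 + t v)). *)
Definition right_factor a b w v t : C :=
  Cpow (1 + t%:C * v) (a - 1 - b) * Cpow (1 + w / (1 + t%:C * v)) (- b).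

Lemma contour_right_scaled a b c x s el : 0 < Re (c - a) -> 0 < x -> `|s| = 1 -> 0 < el ->
  sgi s * Cintegral hl (contour_right (a - 1) (c - a - 1) (- b) x s (el * x)) =
  - (Cpow x%:C (- b) * Cexp (sgi s * (el * x)%:C) * (Cpow x%:C (a - c) * Cpow (sgi s) (a - c)) *
   Cintegral hl (fun t => gamma_weight (c - a) el t *
     right_factor a b (x^-1)%:C ((x^-1)%:C * sgi s) t)).
Proof.
move=> ca0 x0 hs el0; set G := fun t : R => _ * right_factor _ _ _ _ _.
have wn := sgi_neq0 hs; have xn : x%:C != 0 :> C by exact: Re_gt0_neq0.
have wn' : - sgi s != 0 by rewrite oppr_eq0.
have xi0 : 0 < x^-1 by rewrite invr_gt0.
have q1 : 0 < Re (c - a - 1) + 1 by rewrite ReD ReN Re_1 subrK.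
have i0 := Cintegrable_contour_right (a - 1) (- b) q1 x0 hs (mulr_gt0 el0 x0).
have [i1 ->] := Cscale xi0 i0.
have xx : x%:C * (x^-1)%:C = 1 :> C by rewrite -rmorphM divff ?rmorph1 // gt_eqF.
pose e0 := Cexp (sgi s * (el * x)%:C).
pose k0 := (Cpow x%:C (c - a - 1))^-1 * Cpow (- sgi s) (c - a - 1) * Cpow x%:C (- b) * e0.
have k0n : k0 != 0 by rewrite !mulf_neq0 ?invr_eq0 ?Cpow_neq0 // Cexp_neq0.
have e t : 0 < t -> contour_right (a - 1) (c - a - 1) (- b) x s (el * x) (x^-1 * t) = k0 * G t.
  move=> t0; rewrite /contour_right /contour_fun CexpM_sgi //.
  have -> : el * x * (x^-1 * t) = el * t by field; rewrite gt_eqF.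
  pose y := 1 + t%:C * ((x^-1)%:C * sgi s).
  have ey : 1 + (x^-1 * t)%:C * sgi s = y by rewrite /y rmorphM /=; ring.
  have ry : Re y = 1.
    by rewrite -ey Re_1D_sgi.
  have ry0 : 0 < Re y by rewrite ry.
  have yn := Re_gt0_neq0 ry0.
  have ry' : 0 < Re (1 + (x^-1)%:C / y).
    rewrite ReD Re_1 ReM Re_real Im_real mul0r subr0; apply: ltr_wpDr => //.
    by apply: mulr_ge0; apply: ltW => //; exact: Re_inv_gt0.
  rewrite ey.
  have -> : 1 - y = (x^-1 * t)%:C * - sgi s by rewrite -ey; ring.
  have -> : 1 + x%:C * y = x%:C * (y * (1 + (x^-1)%:C / y)).
    have -> : y * (1 + (x^-1)%:C / y) = y + (x^-1)%:C.
      by rewrite (mulrDr y 1) mulr1 (mulrCA y) divff // mulr1.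
    by rewrite (mulrDr x%:C y) xx addrC.
  rewrite (Cpow_mulr _ x0); last by rewrite mulf_neq0 // Re_gt0_neq0.
  rewrite (Cpow_mul_Re _ ry0 ry') Cpow_mulr ?mulr_gt0 // (Cpow_mulrr _ xi0 t0) Cpow_invr //.
  by rewrite /G /gamma_weight /right_factor -/y /k0 /e0 (CpowD (a - 1) (- b) yn); ring.
have iG : Cintegrable hl G.
  have := CintegrableZ k0^-1 (@measurable_hl R) i1.
  by apply: Cintegrable_ext => [|t /hlP t0]; [exact: measurable_hl|rewrite e // mulKf].
have -> : Cintegral hl (fun t =>
    contour_right (a - 1) (c - a - 1) (- b) x s (el * x) (x^-1 * t)) = k0 * Cintegral hl G.
  by rewrite -CintegralZ //; apply: eq_Cintegral => t /hlP; exact: e.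
have eac : a - c = - (c - a) by rewrite opprB.
rewrite eac -(Cpow_sgiN _ hs) (CpowN (c - a) xn) /k0 !CpowB1 // rmorphV ?unitfE ?gt_eqF //=.
rewrite /e0; move: (Cexp _) (Cpow x%:C (- b)) (Cpow (- sgi s) _) (Cintegral _ _) => X1 X2 X3 X4.
field; by rewrite wn xn Cpow_neq0.
Qed.

(** An expansion in w / (1 + t v) leaves the powers (1 + t v) ^ (a - 1 - b - n);
    each of them is expanded in t v to the order N - n, so that all the
    remainders are of order x ^ (- N). *)
Lemma right_factor_expansion a b N : exists B M : R, [/\ 0 <= B, 0 <= M &
  forall x s t, 1 <= x -> `|s| = 1 -> 0 < t ->
  Cabs (right_factor a b (x^-1)%:C ((x^-1)%:C * sgi s) t -
    \sum_(0 <= k < N) \sum_(0 <= n < k.+1)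
      binc b n * (- (x^-1)%:C) ^+ n * (binc (b - a + 1 + n%:R) (k - n) *
       (- (t%:C * ((x^-1)%:C * sgi s))) ^+ (k - n)))
  <= B * x^-1 ^+ N * (1 + t) `^ M].
Proof.
pose d := a - 1 - b.
have [K1 K10 h1] := Cpow_growth d ltr01 (ltr01 : (0 : R) < 1).
have [K2 [M2 [K20 M20 h2]]] := Cpow_remainder (- b) N.
have [K3 [M3 [K30 M30 h3]]] := Cpow_remainder_family d N N.
pose S := \sum_(0 <= n < N) Cabs (binc b n).
have S0 : 0 <= S by apply: sumr_ge0 => n _; exact: Cabs_ge0.
exists (K1 * (K2 * 2 `^ M2) + S * K3), (`|Re d| + (M3 + N%:R)); split.
- by rewrite addr_ge0 // mulr_ge0 // ?mulr_ge0 ?powR_ge0 // ltW.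
- by rewrite !addr_ge0.
move=> x s t x1 hs t0; have x0 : 0 < x by lra.
have xi0 : 0 < x^-1 by rewrite invr_gt0.
have xi1 : x^-1 <= 1 by rewrite invf_le1.
have tt := ltW t0.
have t1 : 0 < 1 + t by lra.
set w := (x^-1)%:C; pose tau := t%:C * (w * sgi s).
have etau : tau = (t * x^-1)%:C * sgi s by rewrite /tau /w rmorphM mulrA.
have rtau : Re tau = 0 by rewrite etau ReM /= mulr0 mul0r subr0.
have atau : Cabs tau = t * x^-1 by rewrite etau Cabs_mul_sgi // mulr_ge0 // ltW.
have tx : t * x^-1 <= t by rewrite ler_piMr.
pose y := 1 + tau.
have ry : Re y = 1 by rewrite ReD Re_1 rtau addr0.
have ry0 : 0 < Re y by rewrite ry.
have yn := Re_gt0_neq0 ry0.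
have y1 : 1 <= Cabs y by apply: le_trans (Re_le_Cabs y); rewrite ry normr1.
have y2 : Cabs y <= 1 * (1 + t).
  by apply: le_trans (CabsD _ _) _; rewrite Cabs1 atau; lra.
pose u := w / y.
have ru : 0 <= Re u.
  rewrite /u /w ReM Re_real Im_real mul0r subr0.
  by apply: mulr_ge0; apply: ltW => //; exact: Re_inv_gt0.
have au : Cabs u <= x^-1.
  rewrite /u /w CabsM CabsV Cabs_real gtr0_norm // ler_piMr ?(ltW xi0) // invf_le1 //.
  exact: lt_le_trans y1.
rewrite /right_factor -/tau -/y -/u -/d.
(* r1 is the remainder of the expansion in w / (1 + t v), r2 n that of its n-th
   term in t v *)
pose r1 := Cpow (1 + u) (- b) - binomial_sum (- b) N u.
pose r2 n := Cpow y (d - n%:R) - binomial_sum (d - n%:R) (N - n) tau.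
have hr1 : Cabs r1 <= K2 * x^-1 ^+ N * 2 `^ M2.
  apply: le_trans (h2 u ru) _; apply: ler_pM; rewrite ?powR_ge0 ?mulr_ge0 ?exprn_ge0 ?Cabs_ge0 //.
    by rewrite ler_wpM2l // lerXn2r ?nnegrE ?Cabs_ge0 // ltW.
  have u2 : 1 + Cabs u <= 2 by rewrite -[leRHS]/(1 + 1) lerD2l; exact: le_trans au xi1.
  by apply: ge0_ler_powR; rewrite ?nnegrE ?addr_ge0 ?Cabs_ge0.
have hr2 n : (n < N)%N -> x^-1 ^+ n * Cabs (r2 n) <= K3 * x^-1 ^+ N * (1 + t) `^ (M3 + N%:R).
  move=> nN; have := h3 n tau nN; rewrite rtau lexx -/y -/(r2 n) atau => /(_ isT) h.
  have hx : 0 <= x^-1 ^+ n by rewrite exprn_ge0 // ltW.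
  apply: le_trans (ler_wpM2l hx h) _; rewrite exprMn.
  have -> : forall X : R, x^-1 ^+ n * (K3 * (t ^+ (N - n) * x^-1 ^+ (N - n)) * X) =
     K3 * (x^-1 ^+ n * x^-1 ^+ (N - n)) * (t ^+ (N - n) * X) by move=> X; ring.
  rewrite -exprD subnKC ?(ltnW nN) //.
  have k0 : 0 <= K3 * x^-1 ^+ N by rewrite mulr_ge0 ?exprn_ge0 // ltW.
  rewrite ler_wpM2l //; apply: le_trans (_ : (1 + t) `^ N%:R * (1 + t) `^ M3 <= _); last first.
    by rewrite -powRDp // (addrC N%:R).
  apply: ler_pM; rewrite ?exprn_ge0 ?powR_ge0 //.
    rewrite powR_nat //; apply: le_trans (_ : (1 + t) ^+ (N - n) <= _).
      by rewrite lerXn2r ?nnegrE ?lerDr // ltW.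
    by apply: ler_weXn2l; rewrite ?leq_subr // lerDl.
  apply: ge0_ler_powR => //; rewrite ?nnegrE.
  - by rewrite addr_ge0 // mulr_ge0 // ltW.
  - exact: ltW.
  - by rewrite lerD2l.
rewrite -(triangular_sum (fun n j => binc b n * (- w) ^+ n * (binc (b - a + 1 + n%:R) j * (- tau) ^+ j))).
have -> : Cpow y d * Cpow (1 + u) (- b) -
    \sum_(0 <= n < N) \sum_(0 <= j < N - n) binc b n * (- w) ^+ n * (binc (b - a + 1 + n%:R) j * (- tau) ^+ j)
  = Cpow y d * r1 + \sum_(0 <= n < N) binc b n * (- w) ^+ n * r2 n.
  have -> : Cpow (1 + u) (- b) = r1 + binomial_sum (- b) N u by rewrite /r1 subrK.
  rewrite mulrDr -addrA; congr (_ + _); rewrite /binomial_sum mulr_sumr -sumrB.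
  apply: eq_bigr => n _; rewrite -mulr_sumr opprK /r2 /binomial_sum mulrBr.
  have -> : - (d - n%:R) = b - a + 1 + n%:R by rewrite /d; ring.
  have -> : - u = - w * y^-1 by rewrite /u mulNr.
  by congr (_ - _); rewrite CpowD // CpowN // Cpow_nat // exprMn exprVn; ring.
apply: le_trans (CabsD _ _) _; rewrite mulrDl mulrDl; apply: lerD.
  rewrite CabsM; have h := h1 y t tt; rewrite y1 y2 in h.
  apply: le_trans (ler_pM (Cabs_ge0 _) (Cabs_ge0 _) (h isT) hr1) _.
  rewrite powRDp //; have p1 : 1 <= (1 + t) `^ (M3 + N%:R).
    by rewrite powR_pos // -[leLHS]expR0 ler_expR mulr_ge0 ?addr_ge0 // ln_ge0 // lerDl ltW.
  have -> : K1 * (1 + t) `^ `|Re d| * (K2 * x^-1 ^+ N * 2 `^ M2) =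
     K1 * (K2 * 2 `^ M2) * x^-1 ^+ N * ((1 + t) `^ `|Re d| * 1) by ring.
  rewrite ler_wpM2l //; last by rewrite ler_wpM2l // powR_ge0.
  by rewrite !mulr_ge0 ?exprn_ge0 ?powR_ge0 // ltW.
apply: le_trans (Cabs_sum _ _ _) _.
have p1 : 1 <= (1 + t) `^ `|Re d|.
  by rewrite powR_pos // -[leLHS]expR0 ler_expR mulr_ge0 // ln_ge0 // lerDl ltW.
apply: le_trans (_ : S * (K3 * x^-1 ^+ N * (1 + t) `^ (M3 + N%:R)) <= _).
  rewrite /S mulr_suml big_nat [leRHS]big_nat; apply: ler_sum => n /andP[_ nN].
  rewrite CabsM CabsM CabsX CabsN Cabs_real gtr0_norm // -mulrA.
  by rewrite ler_wpM2l ?Cabs_ge0 // hr2.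
rewrite (@powRDp _ _ `|Re d|) //.
have -> : S * (K3 * x^-1 ^+ N * (1 + t) `^ (M3 + N%:R)) =
  S * K3 * x^-1 ^+ N * (1 * (1 + t) `^ (M3 + N%:R)) by ring.
rewrite ler_wpM2l //; last by rewrite ler_wpM2r // powR_ge0.
by rewrite !mulr_ge0 ?exprn_ge0 // ltW.
Qed.

End RightExpansion.

(** * Contribution of the endpoint 1 *)

Section Assembly.
Variable R : realType.
Local Notation C := R[i].
Local Notation Re := (@complex.Re R).
Local Notation Im := (@complex.Im R).
Local Notation mu := (@lebesgue_measure R).
Local Notation hl := (`]0, +oo[%classic : set R).
Local Notation ui := (`]0, 1[%classic : set R).
Implicit Types (z w u v a b c p q r : C) (t x s el : R) (n k N : nat).

Lemma Cmeasurable_right_factor a b x v : 0 < x -> Re v = 0 ->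
  Cmeasurable hl (right_factor a b x%:C v).
Proof.
move=> x0 rv; apply: CmeasurableM; first by apply: Cmeasurable_Cpow_1D; rewrite rv.
apply: Cmeasurable_diff; first exact: open_hl.
move=> t _; have ry : 0 < Re (1 + t%:C * v).
  by rewrite ReD ReM Re_1 Re_real Im_real rv mulr0 mul0r subr0 addr0.
apply: Cdiff_Cpow.
  apply: log_plane_Re; rewrite ReD Re_1 ReM Re_real Im_real mul0r subr0.
  by apply: ltr_wpDr => //; rewrite mulr_ge0 // ltW // Re_inv_gt0.
apply: CdiffD; first exact: Cdiff_cst.
apply: CdiffM; first exact: Cdiff_cst.
by apply: Cdiff_inv; [exact: log_plane_Re|exact: Cdiff_lin].
Qed.

Lemma gamma_weight_monomial z el (cf : C) n : 0 < Re z -> 0 < el ->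
  Cintegrable hl (fun t => gamma_weight z el t * (cf * t%:C ^+ n)) /\
  Cintegral hl (fun t => gamma_weight z el t * (cf * t%:C ^+ n)) =
    cf * (pochhammer z n * CGamma z * (Cpow el%:C (- z) * el%:C^-1 ^+ n)).
Proof.
move=> z0 el0; have zn := Re_addn n z0.
have eln : el%:C != 0 :> C by exact: Re_gt0_neq0.
have e t : 0 < t -> cf * gamma_weight (z + n%:R) el t = gamma_weight z el t * (cf * t%:C ^+ n).
  by move=> t0; rewrite -gamma_weightX //; ring.
have i1 := Cintegrable_gamma zn el0.
split.
  apply: Cintegrable_ext (CintegrableZ cf (@measurable_hl R) i1); first exact: measurable_hl.
  by move=> t /hlP; exact: e.
rewrite -(@eq_Cintegral _ _ (fun t => cf * gamma_weight (z + n%:R) el t)); last first.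
  by move=> t /hlP; exact: e.
rewrite CintegralZ // Cintegral_gamma // CGamma_addn // opprD CpowD // (CpowN n%:R) // Cpow_nat // exprVn.
by congr (_ * _); ring.
Qed.

(** The identity (i s) ^ (- j) = (- i s) ^ j matches the powers of i s. *)
Lemma right_coef_match a b c s el x k : `|s| = 1 -> 0 < el -> 0 < x ->
  Cpow x%:C (a - c) * Cpow (sgi s) (a - c) *
  \sum_(0 <= n < k.+1) binc b n * (- (x^-1)%:C) ^+ n *
    (binc (b - a + 1 + n%:R) (k - n) * (- ((x^-1)%:C * sgi s)) ^+ (k - n)) *
    (pochhammer (c - a) (k - n) * CGamma (c - a) *
      (Cpow el%:C (- (c - a)) * el%:C^-1 ^+ (k - n)))
  = CGamma (c - a) * (humbert_coef1 a b c k (sgi s * el%:C) *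
      Cpow (sgi s * el%:C * x%:C) (a - c - k%:R)).
Proof.
move=> hs el0 x0; have eln : el%:C != 0 :> C by exact: Re_gt0_neq0.
have xn : x%:C != 0 :> C by exact: Re_gt0_neq0.
have wn := sgi_neq0 hs; have ww := sgi_sqr hs.
have -> : (x^-1)%:C = x%:C^-1 :> C by rewrite rmorphV // unitfE gt_eqF.
have eP : Cpow (sgi s * el%:C * x%:C) (a - c - k%:R) =
   Cpow (sgi s) (a - c) * Cpow el%:C (- (c - a)) * Cpow x%:C (a - c) *
   (- sgi s * el%:C^-1 * x%:C^-1) ^+ k.
  rewrite -mulrA -rmorphM Cpow_sgi_mul_Re ?mulr_gt0 //= Cpow_mulrr //.
  rewrite !CpowD // !(CpowN k%:R) // !Cpow_nat // opprB !CpowD // !exprMn !exprVn.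
  have -> : (sgi s ^+ k)^-1 = (- sgi s) ^+ k.
    rewrite -exprVn; congr (_ ^+ _); apply: (mulfI wn).
    by rewrite divff // mulrN ww opprK.
  by ring.
rewrite eP /humbert_coef1 mulr_suml !mulr_sumr big_mkord; apply: eq_bigr => -[n nk] _ /=.
set j := (k - n)%N; have -> : k = (n + j)%N by rewrite /j subnKC.
rewrite exprD /binc invfM.
have h : (- (sgi s * el%:C)) ^+ n * (- sgi s * el%:C^-1 * x%:C^-1) ^+ n = (- x%:C^-1) ^+ n.
  rewrite -exprMn; congr (_ ^+ _).
  have -> : - (sgi s * el%:C) * (- sgi s * el%:C^-1 * x%:C^-1) =
    sgi s * sgi s * (el%:C * el%:C^-1) * x%:C^-1 by ring.
  by rewrite ww divff // mulr1 mulN1r.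
have h' : (- sgi s * el%:C^-1 * x%:C^-1) ^+ j = (- (x%:C^-1 * sgi s)) ^+ j * el%:C^-1 ^+ j.
  by rewrite -exprMn; congr (_ ^+ _); ring.
rewrite h' -h; move: (n`!%:R^-1) (j`!%:R^-1) => f1 f2; ring.
Qed.

(** [right_factor_expansion] is integrated against the Gamma weight; the terms
    with n + j = k make up the k-th coefficient. *)
Lemma right_expansion a b c s el N : 0 < Re (c - a) -> `|s| = 1 -> 0 < el ->
  exists K, forall x, 1 <= x ->
  Cabs (- (sgi s * Cintegral hl (contour_right (a - 1) (c - a - 1) (- b) x s (el * x))) -
    CGamma (c - a) * (Cpow x%:C (- b) * Cexp (sgi s * (el * x)%:C) *
     \sum_(k < N) (humbert_coef1 a b c k (sgi s * el%:C) *
       Cpow (sgi s * el%:C * x%:C) (a - c - k%:R))))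
  <= K * x `^ (Re (a - b - c) - N%:R).
Proof.
move=> ca0 hs el0.
have [B [M [B0 M0 hB]]] := right_factor_expansion a b N.
have [D D0 hD] := gamma_weight_integral_le M ca0 el0.
exists (Cabs (Cpow (sgi s) (a - c)) * (D * B)) => x x1; have x0 : 0 < x by lra.
have xn : x%:C != 0 :> C by exact: Re_gt0_neq0.
have xi0 : 0 < x^-1 by rewrite invr_gt0.
rewrite contour_right_scaled // opprK.
set v := (x^-1)%:C * sgi s; set g := right_factor a b _ v.
pose cf k n : C := binc b n * (- (x^-1)%:C) ^+ n * (binc (b - a + 1 + n%:R) (k - n) * (- v) ^+ (k - n)).
pose h k t : C := \sum_(0 <= n < k.+1) cf k n * t%:C ^+ (k - n).
pose rho t := g t - \sum_(0 <= k < N) h k t.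
have rv : Re v = 0 by rewrite /v ReM /= mulr0 mul0r subr0.
have ih k : Cintegrable hl (fun t => gamma_weight (c - a) el t * h k t) /\
  Cintegral hl (fun t => gamma_weight (c - a) el t * h k t) =
  \sum_(0 <= n < k.+1) cf k n * (pochhammer (c - a) (k - n) * CGamma (c - a) *
      (Cpow el%:C (- (c - a)) * el%:C^-1 ^+ (k - n))).
  have ii n := gamma_weight_monomial (cf k n) (k - n) ca0 el0.
  have [i1 e1] := Cintegrable_sum k.+1 (@measurable_hl R) (fun n => proj1 (ii n)).
  have ex t : \sum_(0 <= n < k.+1) gamma_weight (c - a) el t * (cf k n * t%:C ^+ (k - n)) =
    gamma_weight (c - a) el t * h k t by rewrite /h mulr_sumr.
  split; first by apply: Cintegrable_ext i1.
  rewrite -(@eq_Cintegral _ _ _ _ (fun t _ => ex t)) e1.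
  by apply: eq_bigr => n _; rewrite (proj2 (ii n)).
have mh k : Cmeasurable hl (h k).
  apply: Cmeasurable_sum => n; apply: CmeasurableM; first exact: Cmeasurable_cst.
  apply: CmeasurableX; first exact: measurable_hl.
  by apply: Cmeasurable_ext (Cmeasurable_lin 1) => t _; rewrite mulr1.
have [irho brho] : Cintegrable hl (fun t => gamma_weight (c - a) el t * rho t) /\
   Cabs (Cintegral hl (fun t => gamma_weight (c - a) el t * rho t)) <= D * (B * x^-1 ^+ N).
  apply: hD.
  - by rewrite mulr_ge0 // exprn_ge0 // ltW.
  - apply: CmeasurableB; first exact: Cmeasurable_right_factor.
    by apply: Cmeasurable_sum => k; exact: mh.
  - move=> t t0; apply: le_trans (hB x s t x1 hs t0).
    rewrite -/v le_eqVlt; apply/orP; left; apply/eqP; congr (Cabs (_ - _)).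
    apply: eq_bigr => k _; apply: eq_bigr => n _.
    have -> : - (t%:C * v) = - v * t%:C by ring.
    by rewrite exprMn /cf; ring.
have Eg t : 0 < t -> g t = \sum_(0 <= k < N) 1 * h k t + rho t.
  move=> _; have -> : \sum_(0 <= k < N) 1 * h k t = \sum_(0 <= k < N) h k t.
    by apply: eq_bigr => k _; rewrite mul1r.
  by rewrite /rho [RHS]addrC subrK.
rewrite (gamma_weight_expansion Eg (fun k => proj1 (ih k)) irho).
set P := Cpow x%:C (- b); set e := Cexp _; set Q := Cpow x%:C (a - c) * _.
have -> : P * e * Q * (\sum_(0 <= k < N) 1 * Cintegral hl (fun t => gamma_weight (c - a) el t * h k t)
     + Cintegral hl (fun t => gamma_weight (c - a) el t * rho t)) -
   CGamma (c - a) * (P * e * \sum_(k < N) (humbert_coef1 a b c k (sgi s * el%:C) *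
       Cpow (sgi s * el%:C * x%:C) (a - c - k%:R)))
  = P * e * Q * Cintegral hl (fun t => gamma_weight (c - a) el t * rho t).
  have -> : CGamma (c - a) * (P * e * \sum_(k < N) (humbert_coef1 a b c k (sgi s * el%:C) *
       Cpow (sgi s * el%:C * x%:C) (a - c - k%:R))) =
    P * e * Q * (\sum_(0 <= k < N) 1 * Cintegral hl (fun t => gamma_weight (c - a) el t * h k t)).
    rewrite mulrCA -[RHS]mulrA; congr (_ * _); rewrite !mulr_sumr big_mkord.
    apply: eq_bigr => k _; rewrite mul1r (proj2 (ih k)).
    by rewrite -right_coef_match.
  by rewrite mulrDr addrC addKr.
have e1 : Cabs e = 1.
  by rewrite /e Cabs_Cexp ReM /= mul0r mulr0 subr0 expR0.
rewrite CabsM (CabsM (P * e)) (CabsM P) e1 mulr1 /Q CabsM /P !Cabs_Cpow_real //.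
have -> : x `^ (Re (a - b - c) - N%:R) = x `^ Re (- b) * x `^ Re (a - c) * x^-1 ^+ N.
  rewrite exprVn -powR_nat // -powRN -!powRDp //; congr (_ `^ _).
  by rewrite !ReD !ReN; ring.
set X := x `^ _; set Y := x `^ _; set Z := Cabs (Cpow (sgi s) _).
have k0 : 0 <= X * (Y * Z) by rewrite !mulr_ge0 ?powR_ge0 ?Cabs_ge0.
by apply: le_eq_trans (ler_wpM2l k0 brho) _; ring.
Qed.

Lemma euler_kernel_contour a b c x s el t :
  euler_kernel a b c (- x%:C) t * Cexp (t%:C * (sgi s * el%:C)) =
  contour_fun (a - 1) (c - a - 1) (- b) x s el t%:C.
Proof.
rewrite /euler_kernel /contour_fun rmorphB rmorph1.
by congr (_ * _ * Cpow _ _ * Cexp _); ring.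
Qed.

End Assembly.

Theorem theorem3p9 (R : realType) (a b c : R[i]) (lam : R)
  (ha : 0 < complex.Re a) (hac : complex.Re a < complex.Re c)
  (hlam : lam != 0) :
  forall N : nat, exists K : R, \forall x \near +oo,
    Cabs (humbert_Phi1 a b c (- x%:C) ('i%C * lam%:C * x%:C)
          - CGamma c / CGamma a * Cpow x%:C (- b)
              * Cexp ('i%C * lam%:C * x%:C)
              * \sum_(k < N) (humbert_coef1 a b c k ('i%C * lam%:C)
                  * Cpow ('i%C * lam%:C * x%:C) (a - c - k%:R))
          - CGamma c / CGamma (c - a)
              * \sum_(k < N) (humbert_coef2 a b c k (- ('i%C * lam%:C))
                  * Cpow x%:C (- a - k%:R)))
    <= K * (x `^ (complex.Re (a - b - c) - N%:R)
            + x `^ (- complex.Re a - N%:R)).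
Proof.
move=> N; pose s := Num.sg lam; pose el := `|lam|.
have hs : `|s| = 1 by rewrite /s normr_sg hlam.
have el0 : 0 < el by rewrite normr_gt0.
have ca0 : 0 < complex.Re (c - a) by rewrite ReD ReN subr_gt0.
have c0 : 0 < complex.Re c by exact: lt_trans hac.
have eil : 'i%C * lam%:C = sgi s * el%:C.
  have -> : lam%:C = s%:C * el%:C by rewrite -rmorphM /s /el -numEsg.
  by rewrite mulrA; congr (_ * _); apply: eqC => /=; ring.
rewrite eil.
have [K1 h1] := left_expansion b c N ha hs el0.
have [K2 h2] := right_expansion b N ca0 hs el0.
set B := (CBeta a (c - a))^-1.
have eB : B = CGamma c / (CGamma a * CGamma (c - a)).
  by rewrite /B CBetaE // (addrC a) subrK invf_div.
exists (Cabs B * (`|K1| + `|K2|)).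
apply: filterS (nbhs_pinfty_ge (num_real (1 : R))) => x x1.
have x0 : 0 < x by apply: lt_le_trans x1.
have Ga := CGamma_neq0 ha; have Gca := CGamma_neq0 ca0.
have ex : sgi s * el%:C * x%:C = sgi s * (el * x)%:C by rewrite rmorphM mulrA.
rewrite humbert_Phi1_integral // -/B ex.
rewrite (eq_Cintegral (fun t _ => euler_kernel_contour a b c x s (el * x) t)).
have a1 : 0 < complex.Re (a - 1) + 1 by rewrite ReD ReN Re_1 subrK.
have q1 : 0 < complex.Re (c - a - 1) + 1 by rewrite ReD ReN Re_1 subrK.
rewrite contour_shift ?mulr_gt0 //.
have {}h1 := h1 x x1; have {}h2 := h2 x x1; rewrite ex in h2.
move: h1 h2; set L := sgi s * Cintegral _ _; set Rr := sgi s * Cintegral _ _.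
set S2 := \sum_(k < N) _; set S1 := \sum_(k < N) _; set P := Cpow x%:C (- b); set e := Cexp _ => h1 h2.
have -> : B * (L - Rr) - CGamma c / CGamma a * P * e * S1 - CGamma c / CGamma (c - a) * S2 =
   B * ((L - CGamma a * S2) + (- Rr - CGamma (c - a) * (P * e * S1))).
  by rewrite eB; field; rewrite Ga Gca.
rewrite CabsM -[leRHS]mulrA ler_wpM2l ?Cabs_ge0 //.
apply: le_trans (CabsD _ _) _; apply: le_trans (lerD h1 h2) _.
set X := x `^ _; set Y := x `^ _.
have X0 : 0 <= X by exact: powR_ge0.
have Y0 : 0 <= Y by exact: powR_ge0.
have g1 : K1 * X <= `|K1| * X by rewrite ler_wpM2r // ler_norm.
have g2 : K2 * Y <= `|K2| * Y by rewrite ler_wpM2r // ler_norm.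
have g3 : 0 <= `|K1| * Y by rewrite mulr_ge0.
have g4 : 0 <= `|K2| * X by rewrite mulr_ge0.
by rewrite mulrDl !mulrDr; lra.
Qed.
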